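(* Let $X(t)\in\mathbb{R}$, $t\ge 0$, be the solution of the one-dimensional McKean-Vlasov equation $$dX(t)=b(t,X(t),\mu_t)\,dt+\sigma(t,X(t),\mu_t)\,dB(t),\qquad X(0)=Z,$$ driven by a one-dimensional Brownian motion $B$, where $\mu_t=\mu_t(dx,\omega)$ is the regular conditional distribution of $X(t)$ given $\mathcal{F}_t$. Then the Donsker delta measure $\mu_t=\delta_{X(t)}(dx,\omega)$ satisfies, in the sense of distributions, the equation $$d\mu_t=\Big\{-D[b(t,x,\mu_t)\mu_t]+\tfrac12 D^2[\sigma^2(t,x,\mu_t)\mu_t]\Big\}dt-D[\sigma(t,x,\mu_t)\mu_t]\,dB(t),\quad t\ge 0,$$ $$\mu_0=\mathcal{L}(X(0)),$$ where $\mathcal{L}(X(0))$ is the law of $X(0)$, and $D=\frac{\partial}{\partial x}$ and $D^2=\frac{\partial^2}{\partial x^2}$ are taken in the sense of distributions.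
   Context: $B$ is a one-dimensional Brownian motion on a probability space $(\Omega,\mathcal{F},P)$; $Z$ is a random variable independent of the $\sigma$-algebra generated by $B(\cdot)$ with $\mathbb{E}[|Z|^2]<\infty$; $\mathbb{F}=\{\mathcal{F}_t\}_{t\ge0}$ is the filtration generated by $Z$ and $B(\cdot)$. $\mathbb{M}$ denotes the set of Borel measures on $\mathbb{R}$. The coefficients $b,\sigma:[0,T]\times\mathbb{R}\times\mathbb{M}\to\mathbb{R}$ are bounded and $\mathbb{F}$-predictable processes for all $x,\mu$, and are continuous in $t$ and $x$ for all $\mu$; it is assumed that the McKean-Vlasov equation has a unique solution (as is the case e.g. under Lipschitz and linear growth conditions). The regular conditional distribution $\mu_t(dx,\omega)$ of $X(t)$ given $\mathcal{F}_t$ is a Borel probability measure on $\mathbb{R}$ for all $t\in[0,T]$, $\omega\in\Omega$, with $\int_{\mathbb{R}}g(x)\mu_t(dx,\omega)=\mathbb{E}[g(X(t))|\mathcal{F}_t](\omega)$ for all $g$ with $\mathbb{E}[|g(X(t))|]<\infty$. It is called the Donsker delta measure of $X(t)$ and denoted $\delta_{X(t)}(dx,\omega)$; since $X(t)$ is $\mathcal{F}_t$-measurable, $\int_{\mathbb{R}}g(x)\mu_t(dx,\omega)=g(X(t))$. $\mathcal{L}(\cdot)$ denotes the law of a random variable. ''In the sense of distributions'' means: for a.a. $\omega$, $\mu_t$ is regarded as an element of the space $\mathcal{S}'(\mathbb{R})$ of tempered distributions, and the equation is understood after pairing with test functions in the Schwartz space $\mathcal{S}(\mathbb{R})$.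
   Formalization: The initial condition μ_0 = L(X(0)) fails for random Z (b=σ=0, Z a fair coin: μ_0=δ_Z). It is replaced by: μ_0=δ_{X(0)} a.s., E[μ_0]=L(X(0)), and μ_0=L(X(0)) a.s. if and only if X(0) is a.s. constant. *)

(* Defs.v *)
From HB Require Import structures.
From mathcomp Require Export all_boot all_order all_algebra.
From mathcomp Require Export all_classical all_reals all_analysis.
From mathcomp Require Export measurable_realfun.
Export Order.TTheory GRing.Theory Num.Theory.
Export numFieldNormedType.Exports.

Set Implicit Arguments.
Unset Strict Implicit.
Unset Printing Implicit Defensive.

#[export] Set Implicit Arguments.
#[export] Unset Strict Implicit.

Local Open Scope classical_set_scope.
Local Open Scope ring_scope.

(** * Brownian motion, filtration *)

Section Stochastic.
Context {R : realType} {d : measure_display} {Omega : measurableType d}.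
Variable P : probability Omega R.

Definition independent (G H : set (set Omega)) : Prop :=
  forall A C, G A -> H C -> (P (A `&` C) = P A * P C)%E.

Definition sigma_rv (X : Omega -> R) : set (set Omega) :=
  [set X @^-1` A | A in [set A : set (measurableTypeR R) | measurable A]].

Definition sigma_process (D : set R) (B : R -> Omega -> R) : set (set Omega) :=
  <<s \bigcup_(t in D) sigma_rv (B t) >>.

(** [normal_prob m s] is the normal law of mean [m] and standard deviation [s];
    for [s = 0] it is not a Dirac mass, whence the strict [s < t]. *)
Definition brownian_motion (B : R -> {RV P >-> R}) : Prop :=
  [/\ {ae P, forall w, B 0 w = 0},
      forall s t, 0 <= s -> s < t ->
        independent (sigma_process `[0, s] B)
                    (sigma_rv (fun w => B t w - B s w)),
      forall s t, 0 <= s -> s < t ->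
        forall A : set (measurableTypeR R), measurable A ->
          P ((fun w => B t w - B s w) @^-1` A)
          = normal_prob 0 (Num.sqrt (t - s)) A
    & {ae P, forall w, {within `[0, +oo[, continuous (fun t => B t w)}}].

Definition filtration_of (Z : Omega -> R) (B : R -> Omega -> R) (t : R)
    : set (set Omega) :=
  <<s sigma_rv Z `|` \bigcup_(s in `[0, t]) sigma_rv (B s) >>.

(** Measurability with respect to a sub-sigma-algebra [G], given as a set of
    sets. *)
Definition measurable_wrt (G : set (set Omega)) d' (T' : measurableType d')
    (f : Omega -> T') : Prop :=
  forall A : set T', measurable A -> G (f @^-1` A).

(** Generators of the predictable sigma-algebra on [[0, +oo[ x Omega]. *)
Definition predictable_rectangles (F : R -> set (set Omega))
    : set (set (R * Omega)) :=
  [set C | (exists2 A, F 0 A & C = [set 0] `*` A) \/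
           (exists s t A, [/\ 0 <= s, s < t, F s A & C = `]s, t] `*` A])].

Definition predictable (F : R -> set (set Omega)) (T : R)
    (H : R -> Omega -> R) : Prop :=
  measurable_fun
    (`[0, T] `*` setT : set (g_sigma_algebraType (predictable_rectangles F)))
    (fun p => H p.1 p.2 : measurableTypeR R).

(** [V] is a version of the conditional expectation of [Y] given [G]. *)
Definition is_condexp (G : set (set Omega)) (Y : Omega -> R)
    (V : Omega -> \bar R) : Prop :=
  [/\ measurable_wrt G V, P.-integrable setT V
    & forall A, G A ->
        (\int[P]_(w in A) V w = \int[P]_(w in A) (Y w)%:E)%E].

(** [mu t w] is the regular conditional distribution of [X t] given [F t]. *)
Definition regular_cond_distr (F : R -> set (set Omega)) (T : R)
    (X : R -> Omega -> R)
    (mu : R -> Omega -> probability (measurableTypeR R) R) : Prop :=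
  forall t, 0 <= t <= T ->
  forall g : measurableTypeR R -> measurableTypeR R, measurable_fun setT g ->
    P.-integrable setT (fun w => (g (X t w))%:E) ->
    is_condexp (F t) (fun w => g (X t w))
               (fun w => \int[mu t w]_x (g x)%:E)%E.

(** * Integrals of processes

    Integrands are identified with their jointly measurable modifications:
    [mu] is only determined up to a null set for each separate [t], and
    nothing forces an integrand depending on it to be jointly measurable in
    [(t, w)].  For a jointly measurable integrand, Fubini's theorem makes the
    notions below the usual ones. *)

Definition measurable_modification (t : R) (H K : R -> Omega -> R) : Prop :=
  (forall s, 0 <= s <= t -> {ae P, forall w, H s w = K s w}) /\
  measurable_fun (`[0, t] `*` setT : set (measurableTypeR R * Omega)%type)
    (fun p => K p.1 p.2 : measurableTypeR R).

(** [J] is a version of [int_0^t H s ds]. *)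
Definition is_time_integral (H : R -> Omega -> R) (t : R) (J : Omega -> R)
    : Prop :=
  exists K : R -> Omega -> R,
  [/\ measurable_modification t H K,
      {ae P, forall w,
        lebesgue_measure.-integrable `[0, t] (fun s : R => (K s w)%:E)}
    & {ae P, forall w, J w = \int[lebesgue_measure]_(s in `[0, t]) K s w}].

(** The process [sum_(i < n) xi i 1_(]t i, t i.+1])]. *)
Record simple_process (F : R -> set (set Omega)) := SimpleProcess {
  sp_size : nat;
  sp_time : nat -> R;
  sp_val : nat -> Omega -> R;
  sp_time0 : 0 <= sp_time 0;
  sp_time_mono : forall i, (i < sp_size)%N -> sp_time i <= sp_time i.+1;
  sp_adapted : forall i, (i < sp_size)%N ->
    measurable_wrt (T' := measurableTypeR R) (F (sp_time i)) (sp_val i);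
  sp_bounded : forall i, (i < sp_size)%N ->
    exists C, forall w, `|sp_val i w| <= C
}.

Definition sp_eval F (h : simple_process F) (s : R) (w : Omega) : R :=
  \sum_(i < sp_size h)
    (if sp_time h i < s <= sp_time h i.+1 then sp_val h i w else 0).

Definition sp_integral F (B : R -> Omega -> R) (h : simple_process F)
    (t : R) (w : Omega) : R :=
  \sum_(i < sp_size h)
    sp_val h i w * (B (Num.min (sp_time h i.+1) t) w
                    - B (Num.min (sp_time h i) t) w).

(** [I] is a version of the Ito integral [int_0^t H s dB s]: it is the limit in
    [L^2(P)] of integrals of simple processes converging to [H] in
    [L^2([0, t] x Omega)]. *)
Definition is_ito_integral (F : R -> set (set Omega)) (B : R -> Omega -> R)
    (H : R -> Omega -> R) (t : R) (I : Omega -> R) : Prop :=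
  measurable_fun setT (I : Omega -> measurableTypeR R) /\
  exists (K : R -> Omega -> R) (h : nat -> simple_process F),
  [/\ measurable_modification t H K,
      (\int[P]_w \int[lebesgue_measure]_(s in `[0%R, t])
         ((K s w - sp_eval (h n) s w) ^+ 2)%:E)%E @[n --> \oo] --> 0%E
    & (\int[P]_w ((I w - sp_integral B (h n) t w) ^+ 2)%:E)%E
         @[n --> \oo] --> 0%E].

(** * The McKean-Vlasov equation *)

Definition coefficient : Type :=
  R -> R -> {measure set (measurableTypeR R) -> \bar R} -> Omega -> R.

(** The last clause: library measures are functions on all sets, so [f] must
    not depend on their values outside the Borel sets. *)
Definition admissible_coefficient (F : R -> set (set Omega)) (T : R)
    (f : coefficient) : Prop :=
  [/\ exists C, forall t x m w, 0 <= t <= T -> `|f t x m w| <= C,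
      forall x m, predictable F T (fun t => f t x m),
      forall m w, {within `[0, T] `*` setT,
                     continuous (fun p : R * R => f p.1 p.2 m w)}
    & forall t x (m m' : {measure set (measurableTypeR R) -> \bar R}),
        (forall A, measurable A -> m A = m' A) -> f t x m = f t x m'].

Definition mckean_vlasov_solution (T : R) (Z : Omega -> R)
    (B : R -> Omega -> R) (b sigma : coefficient) (X : R -> {RV P >-> R})
    (mu : R -> Omega -> probability (measurableTypeR R) R) : Prop :=
  let F := filtration_of Z B in
  [/\ forall t, 0 <= t <= T ->
        measurable_wrt (T' := measurableTypeR R) (F t) (X t),
      {ae P, forall w, {within `[0, T], continuous (fun t => X t w)}},
      regular_cond_distr F T X mu,
      {ae P, forall w, X 0 w = Z w}
    & forall t, 0 <= t <= T -> exists J I : Omega -> R,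
        [/\ is_time_integral (fun s w => b s (X s w) (mu s w) w) t J,
            is_ito_integral F B (fun s w => sigma s (X s w) (mu s w) w) t I
          & {ae P, forall w, X t w = Z w + J w + I w}]].

Definition mckean_vlasov_unique_solution (T : R) (Z : Omega -> R)
    (B : R -> Omega -> R) (b sigma : coefficient) (X : R -> {RV P >-> R})
    (mu : R -> Omega -> probability (measurableTypeR R) R) : Prop :=
  mckean_vlasov_solution T Z B b sigma X mu /\
  forall (X' : R -> {RV P >-> R})
         (mu' : R -> Omega -> probability (measurableTypeR R) R),
    mckean_vlasov_solution T Z B b sigma X' mu' ->
    forall t, 0 <= t <= T -> {ae P, forall w, X' t w = X t w}.

End Stochastic.

(** * Tempered distributions *)

Section Distributions.
Context {R : realType}.

Definition schwartz (phi : R -> R) : Prop :=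
  (forall n x, derivable (derive1n n phi) x 1) /\
  (forall m n, exists C, forall x, `|x ^+ m * derive1n n phi x| <= C).

(** A functional on test functions, relevant on Schwartz functions only. *)
Definition functional : Type := (R -> R) -> R.

Definition tempered (S : functional) : Prop :=
  (forall (a : R) phi psi, schwartz phi -> schwartz psi ->
     S (fun x => a * phi x + psi x) = a * S phi + S psi) /\
  (exists (C : R) (N : nat), forall phi (M : R), schwartz phi ->
     (forall m n x, (m <= N)%N -> (n <= N)%N -> `|x ^+ m * derive1n n phi x| <= M) ->
     `|S phi| <= C * M).

(** The measure [f(x) m(dx)] as a distribution. *)
Definition density (f : R -> R) (m : probability (measurableTypeR R) R)
    : functional :=
  fun phi => \int[m]_x (f x * phi x).

Definition dist_of (m : probability (measurableTypeR R) R) : functional :=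
  density (fun=> 1) m.

(** The distributional derivative. *)
Definition D (S : functional) : functional := fun phi => - S (derive1 phi).

Section Equation.
Context {d : measure_display} {Omega : measurableType d}.
Variable P : probability Omega R.
Variables (b sigma : @coefficient R d Omega).
Variable mu : R -> Omega -> probability (measurableTypeR R) R.

Definition drift_dist (t : R) (w : Omega) : functional := fun phi =>
  - D (density (fun x => b t x (mu t w) w) (mu t w)) phi
  + 2^-1 * D (D (density (fun x => sigma t x (mu t w) w ^+ 2) (mu t w))) phi.

Definition noise_dist (t : R) (w : Omega) : functional := fun phi =>
  - D (density (fun x => sigma t x (mu t w) w) (mu t w)) phi.

(** [d mu = drift_dist dt + noise_dist dB] on [[0, T]], tested against
    Schwartz functions. *)
Definition stochastic_fokker_planck (F : R -> set (set Omega)) (T : R)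
    (B : R -> Omega -> R) : Prop :=
  (forall t, 0 <= t <= T -> {ae P, forall w,
     [/\ tempered (dist_of (mu t w)), tempered (drift_dist t w)
       & tempered (noise_dist t w)]}) /\
  (forall phi, schwartz phi -> forall t, 0 <= t <= T ->
     exists J I : Omega -> R,
     [/\ is_time_integral P (fun s w => drift_dist s w phi) t J,
         is_ito_integral P F B (fun s w => noise_dist s w phi) t I
       & {ae P, forall w,
           dist_of (mu t w) phi = dist_of (mu 0 w) phi + J w + I w}]).

(** [F 0] contains the sigma-algebra of [X 0], so the conditional law [mu 0] of
    [X 0] given [F 0] is the random measure [\d_(X 0)], whose mean is the law
    of [X 0].  The pathwise identity "[mu 0] is the law of [X 0]" can thus not
    hold unless [X 0] is almost surely constant. *)
Definition initial_condition (X0 : {RV P >-> R})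
    (mu0 : Omega -> probability (measurableTypeR R) R) : Prop :=
  [/\ {ae P, forall w, forall A : set (measurableTypeR R), measurable A ->
         mu0 w A = dirac (X0 w) A},
      forall A : set (measurableTypeR R), measurable A ->
        (\int[P]_w mu0 w A)%E = distribution P X0 A
    & (exists c : R, {ae P, forall w, X0 w = c}) <->
      {ae P, forall w, forall A : set (measurableTypeR R), measurable A ->
         mu0 w A = distribution P X0 A}].

End Equation.
End Distributions.

(* Main.v *)
(** Since [X t] is [F t]-measurable, its conditional law [mu t] is almost surely the
    Dirac mass at [X t].  Tested against a Schwartz function [phi], the equation is
    therefore Ito's formula for [phi (X t)].

    To prove Ito's formula, approximate the diffusion coefficient along the solution
    by a simple process [H], refine its jump times to a fine grid, and expand
    [phi (X t) - phi (X 0)] by Taylor's formula over the cells.  The Taylor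
    remainders are small in L1; the sums of [phi'' H^2 (dB^2 - dt)] have orthogonal
    terms and are small in L2.  Hence [phi (X t) - phi (X 0)] minus the drift is
    close in L1 to the integral of the simple process [phi' H].  By the isometry
    these integrals are Cauchy in L2, which turns the L1 limit into an L2 limit. *)

Require Import Defs.
From mathcomp Require Import ring lra.

Local Open Scope classical_set_scope.
Local Open Scope ring_scope.

(** The definition of the Ito integral hands out a separate approximating sequence for each time.
    The isometry makes the sequence belonging to the final time [t] serve all earlier times, so that
    the martingale part of the solution can be compared, cell by cell, with the integral of one
    simple process.

    Fourth moments are available only for the simple process, through a uniform bound that may
    deteriorate as the approximation improves. The accuracy is therefore fixed before this bound is
    known, and the mesh of the grid after it. The rest of an increment of the solution is controlled
    in L2 only; it may enter the Taylor remainder at most quadratically, which is why the estimate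
    for [phi (X t)] comes out in L1.

    Sums over cells that approximate the drift are time integrals of step processes. To compare them
    with the drift itself one needs jointly measurable versions of the coefficients and of [X]: the
    former come with the integrals, the latter from the continuity of the paths. *)

(** * Upper bounds for integrals of nonnegative functions *)

Section bounded_integral.
Context d (T : measurableType d) (R : realType).
Variable m : {measure set T -> \bar R}.
Implicit Types (f g : T -> R) (a b c : R).

(** The bound is a real number, so that estimates combine by linear arithmetic. *)
Definition integral_bound f a : Prop :=
  [/\ measurable_fun setT f, (forall x, 0 <= f x) &
      (\int[m]_x (f x)%:E <= a%:E)%E].

Lemma integral_bound_le f g a b : measurable_fun setT f ->
  (forall x, 0 <= f x <= g x) -> integral_bound g a -> a <= b ->
  integral_bound f b.
Proof.
move=> mf fg [mg g0 ga] ab; split => // [x|]; first by case/andP: (fg x).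
apply: le_trans (_ : (a%:E <= b%:E)%E); last by rewrite lee_fin.
apply: le_trans ga; apply: ge0_le_integral => //.
- by move=> x _; rewrite lee_fin; case/andP: (fg x).
- exact/measurable_EFinP.
- exact/measurable_EFinP.
- by move=> x _; rewrite lee_fin; case/andP: (fg x).
Qed.

Lemma integral_boundW f a b : integral_bound f a -> a <= b -> integral_bound f b.
Proof.
by move=> [mf f0 fa] ab; split=> //; rewrite (le_trans fa)// lee_fin.
Qed.

Lemma integral_boundD f g a b : integral_bound f a -> integral_bound g b ->
  integral_bound (fun x => f x + g x) (a + b).
Proof.
move=> [mf f0 fa] [mg g0 gb]; split; first exact: measurable_funD.
  by move=> x; rewrite addr_ge0.
under eq_integral do rewrite EFinD.
rewrite ge0_integralD//; first by rewrite EFinD leeD.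
all: try by move=> x _; rewrite lee_fin.
all: exact/measurable_EFinP.
Qed.

Lemma integral_boundZ f a c : 0 <= c -> integral_bound f a ->
  integral_bound (fun x => c * f x) (c * a).
Proof.
move=> c0 [mf f0 fa]; split; first exact: measurable_funM.
  by move=> x; rewrite mulr_ge0.
under eq_integral do rewrite EFinM.
rewrite ge0_integralZl_EFin//; first by rewrite EFinM lee_wpmul2l.
- by move=> x _; rewrite lee_fin.
- exact/measurable_EFinP.
Qed.

Lemma integral_bound0 : integral_bound (fun=> 0) 0.
Proof. by split => //; rewrite integral0. Qed.

Lemma integral_bound_sum I (r : seq I) (f : I -> T -> R) (a : I -> R) :
  (forall i, integral_bound (f i) (a i)) ->
  integral_bound (fun x => \sum_(i <- r) f i x) (\sum_(i <- r) a i).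
Proof.
move=> fa; elim: r => [|i r IH].
  rewrite big_nil (_ : (fun _ => _) = fun=> 0); first exact: integral_bound0.
  by apply/funext => x; rewrite big_nil.
rewrite big_cons (_ : (fun _ => _) = fun x => f i x + \sum_(i <- r) f i x).
  exact: integral_boundD.
by apply/funext => x; rewrite big_cons.
Qed.

Lemma integral_bound_ge0 f a : integral_bound f a -> 0 <= a.
Proof.
move=> [mf f0 fa]; rewrite -lee_fin (le_trans _ fa)// integral_ge0// => x _.
by rewrite lee_fin.
Qed.

Lemma integral_bound_eq f g a : f =1 g -> integral_bound f a -> integral_bound g a.
Proof. by move=> /funext ->. Qed.

Lemma integral_bound_integrable f g a : measurable_fun setT f ->
  (forall x, `|f x| <= g x) -> integral_bound g a ->
  m.-integrable setT (EFin \o f).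
Proof.
move=> mf fg [mg g0 ga]; apply/integrableP; split.
  exact/measurable_EFinP.
apply: le_lt_trans (ltry a); apply: le_trans ga; apply: ge0_le_integral => //=.
- by apply/measurable_EFinP; exact: measurableT_comp.
- exact/measurable_EFinP.
- by move=> x _; rewrite lee_fin.
Qed.

Lemma integral_bound_ae f g a : measurable_fun setT g -> (forall x, 0 <= g x) ->
  {ae m, forall x, g x = f x} -> integral_bound f a -> integral_bound g a.
Proof.
move=> mg g0 gf [mf f0 fa]; split => //.
rewrite (_ : (\int[m]_x (g x)%:E = \int[m]_x (f x)%:E)%E)//.
apply: ae_eq_integral => //; first exact/measurable_EFinP.
  exact/measurable_EFinP.
by apply: filterS gf => x /= -> _.
Qed.

End bounded_integral.

Lemma integral_bound_cst d (T : measurableType d) (R : realType)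
  (P : probability T R) (c : R) : 0 <= c -> integral_bound P (fun=> c) c.
Proof.
by move=> c0; split => //; rewrite integral_cst//= probability_setT mule1.
Qed.

(** * Moments of normal laws *)

Section density.
Import HBNNSimple.
Context d (T : measurableType d) (R : realType).
Variables (mu nu : {measure set T -> \bar R}) (p : T -> R).
Hypotheses (mp : measurable_fun setT p) (p0 : forall x, 0 <= p x).
Hypothesis nuE : forall A, measurable A -> nu A = (\int[mu]_(x in A) (p x)%:E)%E.

Let nn_integral_density (h : {nnsfun T >-> R}) :
  (\int[nu]_x (h x)%:E = \int[mu]_x (h x * p x)%:E)%E.
Proof.
have mpE : measurable_fun setT (EFin \o p) by exact/measurable_EFinP.
transitivity (\int[nu]_x
   (\sum_(y \in range h) (y * \1_(h @^-1` [set y]) x)%:E))%E.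
  by apply: eq_integral => t tE; rewrite /= fimfunE -fsumEFin.
have indich r : measurable_fun setT (fun x => (r * \1_(h @^-1` [set r]) x)%:E).
  by apply: (measurable_comp measurableT) => //; exact: measurable_funM.
rewrite ge0_integral_fsum//; last by move=> m y Ey; exact: nnfun_muleindic_ge0.
transitivity (\int[mu]_x (\sum_(y \in range h)
    (y * \1_(h @^-1` [set y]) x)%:E * (p x)%:E))%E; last first.
  apply: eq_integral => x xE.
  rewrite -ge0_mule_fsuml => [|y]; last exact: nnfun_muleindic_ge0.
  by rewrite fsumEFin // -(fimfunE _ x) EFinM.
rewrite ge0_integral_fsum//; last 2 first.
  - by move=> y; apply: emeasurable_funM.
  - by move=> m y Ey; apply: mule_ge0; [exact: nnfun_muleindic_ge0|rewrite lee_fin].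
apply: eq_fsbigr => r rhn.
under eq_integral do rewrite EFinM.
rewrite integralZl_indic_nnsfun => //.
under [RHS]eq_integral do rewrite EFinM -muleA.
rewrite ge0_integralZl//.
- congr (_ * _)%E; under [RHS]eq_integral do rewrite muleC.
  rewrite [RHS](eq_integral ((EFin \o p) \_ (h @^-1` [set r]))); last first.
    by move=> x xE; rewrite epatch_indic.
  by rewrite -integral_mkcond -nuE// integral_indic// setIT.
- by apply: emeasurable_funM => //; exact/measurable_EFinP.
- by move=> t Et; rewrite mule_ge0 ?lee_fin.
- by move: rhn; rewrite inE => -[t _ <-]; rewrite lee_fin.
Qed.

(** Monotone convergence reduces this to simple functions, where linearity leaves only [nuE]. It is
    applied with a normal density and with the indicator of [[0, t]], the density of Lebesgue
    measure restricted to that interval. *)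
Lemma ge0_integral_density (g : T -> R) : measurable_fun setT g ->
  (forall x, 0 <= g x) ->
  (\int[nu]_x (g x)%:E = \int[mu]_x (g x * p x)%:E)%E.
Proof.
move=> mg g0.
have mgE : measurable_fun setT (EFin \o g) by exact/measurable_EFinP.
pose h := nnsfun_approx measurableT mgE.
have hg x : (EFin \o h n) x @[n --> \oo] --> (g x)%:E.
  by apply: cvg_nnsfun_approx => // ? _; rewrite lee_fin.
transitivity (lim (\int[nu]_x (h n x)%:E @[n --> \oo])%E).
  rewrite -monotone_convergence//.
  - by apply: eq_integral => x _; apply/esym/cvg_lim => //; exact: hg.
  - by move=> n; exact/measurable_EFinP/measurable_funP.
  - by move=> n x _; rewrite lee_fin.
  - by move=> x _ a b ab; rewrite lee_fin; exact/lefP/nd_nnsfun_approx.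
under eq_fun do rewrite nn_integral_density.
rewrite -monotone_convergence//.
- apply: eq_integral => x _; apply/cvg_lim => //.
  under eq_fun do rewrite EFinM; rewrite EFinM; apply: cvgeZr => //; exact: hg.
- by move=> n; apply/measurable_EFinP; apply: measurable_funM.
- by move=> n x _; rewrite lee_fin mulr_ge0.
- move=> x _ a b ab; rewrite lee_fin ler_wpM2r//.
  exact/lefP/nd_nnsfun_approx.
Qed.

End density.

Section normal_moments.
Context d (Omega : measurableType d) (R : realType).
Variables (P : probability Omega R) (W : Omega -> R) (s : R).
Hypotheses (mW : measurable_fun setT W) (s0 : 0 < s).
Hypothesis WE : forall A : set (measurableTypeR R), measurable A ->
  P (W @^-1` A) = normal_prob 0 s A.

Let ge0_expect_normal (g : R -> R) : measurable_fun setT g ->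
  (forall x, 0 <= g x) ->
  (\int[P]_w (g (W w))%:E
   = \int[lebesgue_measure]_x (g x * normal_pdf 0 s x)%:E)%E.
Proof.
move=> mg g0.
have mW' : measurable_fun [set: Omega] (W : Omega -> measurableTypeR R) by [].
have := @ge0_integral_density _ (measurableTypeR R) R lebesgue_measure
  (pushforward P (W : Omega -> measurableTypeR R)) (normal_pdf 0 s).
move=> /(_ mW (measurable_normal_pdf _ _) (fun x => normal_pdf_ge0 _ _ x)).
move=> /(_ WE g mg g0) <-.
rewrite (@ge0_integral_pushforward _ _ _ (measurableTypeR R) _ _ mW')//.
- exact/measurable_EFinP.
- by move=> y _; rewrite lee_fin.
Qed.

(** Completing the square: [exp (c x)] times the centred normal density is a constant times the
    normal density of mean [c s ^ 2], which has mass 1. *)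
Let normal_expR_lin (c : R) :
  (\int[P]_w (expR (c * W w))%:E = (expR (c ^+ 2 * s ^+ 2 / 2))%:E)%E.
Proof.
rewrite (ge0_expect_normal (g := fun x => expR (c * x))); first last.
- by move=> x; exact: expR_ge0.
- by apply: measurableT_comp => //; exact: measurable_funM.
transitivity (\int[lebesgue_measure]_x ((expR (c ^+ 2 * s ^+ 2 / 2))%:E * (normal_pdf (c * s ^+ 2) s x)%:E))%E.
  apply: eq_integral => x _; rewrite -EFinM; congr (_%:E).
  rewrite !normal_pdfE ?gt_eqF// /normal_fun.
  rewrite mulrCA [RHS]mulrCA; congr (_ * _); rewrite -!expRD; congr expR.
  by field; rewrite gt_eqF.
rewrite integralZl//; last exact: integrable_normal_pdf.
by rewrite integral_normal_pdf mule1.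
Qed.

(** The exponent is chosen to turn the centred density of deviation [s] into the one of deviation
    [s'], up to the ratio [s' / s] of the peaks. *)
Let normal_expR_sqr (s' : R) : 0 < s' ->
  (\int[P]_w (expR ((s ^- 2 - s' ^- 2) / 2 * W w ^+ 2))%:E = (s' / s)%:E)%E.
Proof.
move=> s'0.
rewrite (ge0_expect_normal
  (g := fun x => expR ((s ^- 2 - s' ^- 2) / 2 * x ^+ 2))); first last.
- by move=> x; exact: expR_ge0.
- by apply: measurableT_comp => //; exact: measurable_funM.
have peakE : normal_peak s = s' / s * normal_peak s'.
  rewrite /normal_peak -!mulrnAr !(sqrtrM _ (sqr_ge0 _)) !sqrtr_sqr.
  have q0 : 0 < Num.sqrt (pi *+ 2 : R) by rewrite sqrtr_gt0 pmulrn_lgt0// pi_gt0.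
  by rewrite !gtr0_norm//; set q := Num.sqrt _ in q0 *; field; rewrite !gt_eqF.
transitivity (\int[lebesgue_measure]_x ((s' / s)%:E * (normal_pdf 0 s' x)%:E))%E.
  apply: eq_integral => x _; rewrite -EFinM; congr (_%:E).
  rewrite !normal_pdfE ?gt_eqF// /normal_fun peakE.
  rewrite mulrC -!mulrA; congr (_ * (_ * (_ * _))); rewrite -!expRD; congr expR.
  by field; rewrite !gt_eqF.
rewrite integralZl//; last exact: integrable_normal_pdf.
by rewrite integral_normal_pdf mule1.
Qed.

(** From [x ^ 2 <= 2 exp x]; the exact value [3 s ^ 4] is not needed. *)
Lemma normal_moment4_le : (\int[P]_w (W w ^+ 4)%:E <= (29 * s ^+ 4)%:E)%E.
Proof.
have s20 : 0 < s *+ 2 by rewrite pmulrn_lgt0.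
(* The choice [s' = 2 s] gives [l = 3 / (8 s ^ 2)] and [E exp (l W ^ 2) = 2]. Hence [E W ^ 4] is at
   most [2 / l ^ 2] times 2, that is [256 / 9 s ^ 4], and [256 / 9 < 29]. *)
set l := (s ^- 2 - (s *+ 2) ^- 2) / 2.
have lE : l = 3 / 8 / s ^+ 2 by rewrite /l; field; rewrite gt_eqF.
have l0 : 0 < l by rewrite lE divr_gt0// exprn_gt0.
apply: (@le_trans _ _ (\int[P]_w ((2 / l ^+ 2)%:E * (expR (l * W w ^+ 2))%:E)%E)%E).
  apply: ge0_le_integral => //.
  - by move=> w _; rewrite lee_fin; apply: exprn_even_ge0.
  - by apply/measurable_EFinP; exact: measurable_funX.
  - apply/measurable_EFinP; apply: measurable_funM => //; apply: measurableT_comp => //.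
    by apply: measurable_funM => //; exact: measurable_funX.
  move=> w _; rewrite -EFinM lee_fin.
  rewrite mulrAC ler_pdivlMr ?exprn_gt0//.
  have := @expR_ge1Dxn R (l * W w ^+ 2) 1.
  have y0 : 0 <= l * W w ^+ 2 by rewrite mulr_ge0 ?sqr_ge0// ltW.
  move=> /(_ y0);rewrite (_ : W w ^+ 4 * l ^+ 2 = (l * W w ^+ 2) ^+ 2); last by ring.
  rewrite (_ : 2`!%:R = 2 :> R)//; set e := expR _; set y := _ ^+ 2; lra.
rewrite ge0_integralZl_EFin//.
- rewrite normal_expR_sqr// -EFinM lee_fin lE.
  rewrite [leLHS](_ : _ = 256 / 9 * s ^+ 4); last by field; rewrite gt_eqF.
  by rewrite ler_wpM2r ?exprn_ge0 ?(ltW s0)//; lra.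
- apply/measurable_EFinP; apply: measurableT_comp => //.
  by apply: measurable_funM => //; exact: measurable_funX.
- by rewrite divr_ge0// exprn_ge0// ltW.
Qed.

Let mWn n : measurable_fun setT (fun w => W w ^+ n).
Proof. exact: measurable_funX. Qed.

Lemma normal_integrable n : (n <= 4)%N -> P.-integrable setT (fun w => (W w ^+ n)%:E).
Proof.
move=> n4.
have b4 : integral_bound P (fun w => 1 + W w ^+ 4) (1 + 29 * s ^+ 4).
  apply: integral_boundD; first exact: integral_bound_cst.
  by split => // [w|]; [exact: exprn_even_ge0|exact: normal_moment4_le].
apply: (integral_bound_integrable _ _ b4) => // w.
rewrite normrX -(ger0_norm (exprn_even_ge0 (n := 4) (W w) isT)) normrX.
have [h|h] := leP `|W w| 1.
  by apply: (@le_trans _ _ 1); [exact: exprn_ile1|rewrite lerDl exprn_ge0].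
apply: (@le_trans _ _ (`|W w| ^+ 4)); last by rewrite lerDr.
by rewrite ler_weXn2l// ltW.
Qed.

(** The inequality [1 + Y <= exp Y], integrated. Applied to [Y] with a parameter of either sign, it
    bounds a moment from both sides by exponential moments known exactly. *)
Let expR_lower (Y : Omega -> R) (y a : R) : P.-integrable setT (EFin \o Y) ->
  (\int[P]_w (Y w)%:E = y%:E)%E -> (\int[P]_w (expR (Y w))%:E = a%:E)%E ->
  1 + y <= a.
Proof.
move=> iY Yy Ya.
have mY : measurable_fun setT Y by apply/measurable_EFinP; exact: measurable_int iY.
have i1 : P.-integrable setT (EFin \o fun=> 1).
  exact: (finite_measure_integrable_cst _ 1).
rewrite -lee_fin -Ya EFinD -Yy.
have -> : 1%:E = (\int[P]_w (1%:E : \bar R))%E.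
  by rewrite integral_cst//= probability_setT mule1.
rewrite -integralD//; apply: le_integral => //.
- exact: integrableD.
- apply/integrableP; split.
    by apply/measurable_EFinP; exact: measurableT_comp.
  under eq_integral do rewrite /= ger0_norm ?expR_ge0//.
  by rewrite Ya ltry.
- by move=> w _; rewrite -EFinD lee_fin expR_ge1Dx.
Qed.

(** [1 + c E W <= E exp (c W)] for all [c], compared to first order at [c = 0];
    likewise for [W ^ 2] below. *)
Lemma normal_moment1 : (\int[P]_w (W w)%:E = 0)%E.
Proof.
have iW : P.-integrable setT (EFin \o W) := normal_integrable (isT : (1 <= 4)%N).
have [v vE] : exists v, (\int[P]_w (W w)%:E = v%:E)%E.
  by exists (fine (\int[P]_w (W w)%:E)%E); rewrite fineK// integrable_fin_num.
have key c : 1 + c * v <= expR (c ^+ 2 * s ^+ 2 / 2).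
  apply: (expR_lower (Y := fun w => c * W w)) => //.
  - by have := integrableZl measurableT c iW; apply: eq_integrable.
  - under eq_integral do rewrite EFinM.
    by rewrite integralZl// vE.
rewrite vE; congr EFin; apply/eqP; rewrite -normr_le0.
apply/ler_addgt0Pr => e e0; rewrite add0r.
have s20 : 0 < s ^+ 2 by rewrite exprn_gt0.
(* The bound [c <= 1 / s] keeps the exponent [c ^ 2 s ^ 2 / 2] below [1 / 2], where
   [exp y <= 1 + 2 y]. Then [key] at [c] and [- c] gives [|v| <= c s ^ 2], and [c <= e / s ^ 2]
   makes this at most [e]. *)
pose c := Num.min (s ^-1) (e / s ^+ 2).
have c0 : 0 < c by rewrite lt_min invr_gt0 s0 divr_gt0.
have cs : c ^+ 2 * s ^+ 2 <= 1.
  rewrite -exprMn exprn_ile1 ?mulr_ge0// ?(ltW c0) ?(ltW s0)//.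
  by rewrite -ler_pdivlMr// div1r /c ge_min lexx.
have ce : c * s ^+ 2 <= e.
  by rewrite -ler_pdivlMr// /c ge_min lexx orbT.
have small (y : R) : 0 <= y -> y <= 1 / 2 -> expR y <= 1 + 2 * y.
  move=> y0 y1; have := expR_ge1Dx (- y); rewrite expRN => h.
  have : (1 - y) * expR y <= 1.
    by rewrite -ler_pdivlMr ?expR_gt0// div1r.
  have := expR_ge0 y; set E := expR y; nra.
have hb : expR (c ^+ 2 * s ^+ 2 / 2) <= 1 + c ^+ 2 * s ^+ 2.
  have cs0 : 0 <= c ^+ 2 * s ^+ 2 by rewrite mulr_ge0 ?sqr_ge0.
  by apply: le_trans (small (c ^+ 2 * s ^+ 2 / 2) _ _) _; lra.
have k1 := le_trans (key c) hb.
have := key (- c); rewrite sqrrN => /le_trans/(_ hb) k2.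
rewrite ler_norml; apply/andP; split; rewrite -(ler_pM2l c0).
- by apply: (@le_trans _ _ (- (c * (c * s ^+ 2)))); [rewrite mulrN lerN2 ler_pM2l|lra].
- by apply: (@le_trans _ _ (c * (c * s ^+ 2))); [lra|rewrite ler_pM2l].
Qed.

Lemma normal_moment2 : (\int[P]_w (W w ^+ 2)%:E = (s ^+ 2)%:E)%E.
Proof.
have iW := normal_integrable (isT : (2 <= 4)%N).
have [v vE] : exists v, (\int[P]_w (W w ^+ 2)%:E = v%:E)%E.
  by exists (fine (\int[P]_w (W w ^+ 2)%:E)%E); rewrite fineK// integrable_fin_num.
have v0 : 0 <= v by rewrite -lee_fin -vE integral_ge0// => w _; rewrite lee_fin sqr_ge0.
have s20 : 0 < s ^+ 2 by rewrite exprn_gt0.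
(* This is [expR_lower] with [s' = s (1 + e)], whose exponential moment is [1 + e]. The common
   factor [e] is kept because its sign decides the direction: positive [e] bounds [v] from above,
   negative [e] from below. *)
have key e : -1 < e -> (2 + e) * e * v <= e * (2 * s ^+ 2 * (1 + e) ^+ 2).
  move=> e1; have se : 0 < s * (1 + e) by rewrite mulr_gt0//; lra.
  have := expR_lower (Y := fun w => (s ^- 2 - (s * (1 + e)) ^- 2) / 2 * W w ^+ 2)
    (y := (s ^- 2 - (s * (1 + e)) ^- 2) / 2 * v) _ _ (normal_expR_sqr se).
  have e10 : 0 < 1 + e by lra.
  have -> : (s ^- 2 - (s * (1 + e)) ^- 2) / 2 = (2 + e) * e / (2 * s ^+ 2 * (1 + e) ^+ 2).
    by field; rewrite !gt_eqF.
  rewrite (mulrC s) mulfK ?gt_eqF// => /(_ _ _)/wrap[].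
    by have := integrableZl measurableT ((2 + e) * e / (2 * s ^+ 2 * (1 + e) ^+ 2)) iW; apply: eq_integrable.
    under eq_integral do rewrite EFinM.
    by rewrite integralZl// vE.
  rewrite lerD2l mulrAC ler_pdivrMr//; last by rewrite !mulr_gt0// exprn_gt0.
rewrite vE; congr EFin; apply/eqP; rewrite -subr_eq0 -normr_le0.
apply/ler_addgt0Pr => e0 e00; rewrite add0r.
pose e := Num.min (1 / 2) (e0 / (3 * s ^+ 2)).
have e_gt0 : 0 < e by rewrite lt_min divr_gt0//= divr_gt0// mulr_gt0.
have e1 : e <= 1 / 2 by rewrite /e ge_min lexx.
have ee : 3 * s ^+ 2 * e <= e0.
  by rewrite mulrC -ler_pdivlMr ?mulr_gt0// /e ge_min lexx orbT.
have k1 : (2 + e) * v <= 2 * s ^+ 2 * (1 + e) ^+ 2.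
  by rewrite -(ler_pM2l e_gt0) mulrCA mulrA key//; lra.
have k2 : 2 * s ^+ 2 * (1 - e) ^+ 2 <= (2 - e) * v.
  rewrite -(ler_pM2l e_gt0).
  have /key : -1 < - e by lra.
  by move=> ?; lra.
rewrite ler_norml; apply/andP; split; nra.
Qed.

End normal_moments.

(** * Brownian increments and the filtration *)

Section independent_expectation.
Context d (Omega : measurableType d) (R : realType) (P : probability Omega R).

Section independent_pair.
Variables (U V : {RV P >-> R}).
Hypothesis UV : independent P (sigma_rv U) (sigma_rv V).

Let UVpair (w : Omega) : (R * R)%type := (U w, V w).

Let mUV : measurable_fun setT UVpair.
Proof. by apply: measurable_fun_pair; exact: measurable_funPT. Qed.

(** A product measure is determined by its values on rectangles, and on these independence is the
    product formula. *)
Let joint_law (A : set (R * R)%type) : measurable A ->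
  pushforward P UVpair A = (distribution P U \x distribution P V)%E A.
Proof.
move=> mA; apply/esym.
apply: (@product_measure_unique _ _ _ _ _ (distribution P U) (distribution P V)
  (pushforward P (UVpair : Omega -> _))) => //.
move=> B C mB mC; change (P ((U @^-1` B) `&` (V @^-1` C)) = P (U @^-1` B) * P (V @^-1` C))%E.
by rewrite UV//; [exists B|exists C].
Qed.

Lemma ge0_independent_integralM :
  (forall w, 0 <= U w) -> (forall w, 0 <= V w) ->
  (\int[P]_w (U w * V w)%:E
   = (\int[P]_w (U w)%:E) * (\int[P]_w (V w)%:E))%E.
Proof.
move=> U0 V0.
(* Tonelli's theorem asks for an integrand that is nonnegative on the whole plane; the absolute
   values provide this and change nothing at the values of [U] and [V]. *)
pose h (p : (R * R)%type) := (`|p.1| * `|p.2|)%:E.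
have mh : measurable_fun setT h.
  apply/measurable_EFinP.
  by apply: measurable_funM; apply: measurableT_comp.
have mn : measurable_fun setT (fun x : R => `|x|%:E).
  by apply/measurable_EFinP; exact: normr_measurable.
have h0 p : (0 <= h p)%E by rewrite lee_fin mulr_ge0.
transitivity (\int[pushforward P UVpair]_p h p)%E.
  rewrite ge0_integral_pushforward//.
  by apply: eq_integral => w _; rewrite /h /= !ger0_norm.
rewrite (eq_measure_integral (distribution P U \x distribution P V)%E); last first.
  by move=> A mA _; exact: joint_law.
rewrite fubini_tonelli1//.
transitivity (\int[distribution P U]_x (`|x|%:E * \int[distribution P V]_y `|y|%:E))%E.
  apply: eq_integral => x _; rewrite /fubini_F /h /=.
  under eq_integral do rewrite EFinM.
  by rewrite ge0_integralZl_EFin.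
rewrite ge0_integralZr//; last by rewrite integral_ge0// => y _; rewrite lee_fin.
rewrite !ge0_integral_distribution//.
by congr (_ * _)%E; apply: eq_integral => w _; rewrite /= ger0_norm.
Qed.

(** Tonelli's theorem for the absolute values makes the product integrable under the product of the
    laws; Fubini's theorem then integrates out [V], whose mean is zero. *)
Lemma independent_integralM_eq0 : P.-integrable setT (EFin \o U) ->
  P.-integrable setT (EFin \o V) -> (\int[P]_w (V w)%:E = 0)%E ->
  P.-integrable setT (fun w => (U w * V w)%:E) /\
  (\int[P]_w (U w * V w)%:E = 0)%E.
Proof.
move=> iU iV V0.
pose h (p : (R * R)%type) := (p.1 * p.2)%:E.
have mh : measurable_fun setT h.
  by apply/measurable_EFinP; apply: measurable_funM.
have mabs : measurable_fun setT (fun x : R => `|x|%:E).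
  by apply/measurable_EFinP; exact: normr_measurable.
have fubini_abs : (\int[distribution P U]_x \int[distribution P V]_y `|h (x, y)| < +oo)%E.
  under eq_integral => x _.
    under eq_integral do rewrite /h /= normrM EFinM.
    rewrite ge0_integralZl_EFin//.
    over.
  rewrite ge0_integralZr//; last by rewrite integral_ge0// => y _; rewrite lee_fin.
  rewrite !ge0_integral_distribution//.
  move/integrableP : iU => [_ iU]; move/integrableP : iV => [_ iV].
  apply: lte_mul_pinfty => //; first by apply: integral_ge0 => w _ /=; rewrite lee_fin.
  rewrite ge0_fin_numE//; apply: integral_ge0 => w _ /=; rewrite lee_fin//.
have ih := (integrable12ltyP (distribution P U) (distribution P V) mh).2 fubini_abs.
have iUV : P.-integrable setT (h \o UVpair).
  apply/integrableP; split; first exact: measurableT_comp.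
  move/integrableP : ih => [_].
  rewrite -(eq_measure_integral _ (fun A mA _ => joint_law mA)).
  by rewrite ge0_integral_pushforward//; exact: measurableT_comp.
split; first exact: iUV.
transitivity (\int[pushforward P UVpair]_p h p)%E.
  by rewrite (integral_pushforward mUV).
rewrite (eq_measure_integral _ (fun A mA _ => joint_law mA)).
rewrite -integral12_prod_meas1//.
apply: integral0_eq => x _; rewrite /fubini_F.
under eq_integral do rewrite /h /= EFinM.
rewrite integralZl//.
  by rewrite (integral_distribution (f := EFin))// V0 mule0.
  exact: integrable_pushforward.
exact: mUV.
Qed.

End independent_pair.
End independent_expectation.

(** This passes from sigma-algebras given as sets of sets to measurable functions on a measurable
    type, from which the closure properties of [measurable_wrt] are inherited. *)
Lemma measurable_wrt_gen d (Omega : measurableType d) d' (T' : measurableType d')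
    (G : set (set Omega)) (f : Omega -> T') :
  measurable_wrt <<s G >> f <->
  measurable_fun setT (f : g_sigma_algebraType G -> T').
Proof.
split=> [mf _ A mA|mf A mA]; first by rewrite setTI; exact: mf.
by rewrite -[_ @^-1` _]setTI; exact: mf.
Qed.

Section filtration.
Context d (Omega : measurableType d) (R : realType) (P : probability Omega R).
Variables (B : R -> {RV P >-> R}) (Z : {RV P >-> R}).
Local Notation F := (filtration_of Z B).

Lemma sigma_rv_measurable (U : {RV P >-> R}) A : sigma_rv U A -> measurable A.
Proof.
by move=> [C mC <-]; rewrite -[_ @^-1` _]setTI; exact: (measurable_funPT U).
Qed.

Lemma sigma_rv_setI (U : Omega -> R) : setI_closed (sigma_rv U).
Proof.
move=> A C [A' mA <-] [C' mC <-]; exists (A' `&` C') => //; exact: measurableI.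
Qed.

Lemma filtration_mono s t : s <= t -> F s `<=` F t.
Proof.
move=> st; apply: sub_sigma_algebra2 => A [ZA|[u us BA]]; [by left|right].
exists u => //; move: us; rewrite /= !in_itv/= => /andP[-> /le_trans]; exact.
Qed.

Lemma filtration_measurable t A : F t A -> measurable A.
Proof.
apply: smallest_sub => [|C [|[u _]]]; first exact: sigma_algebra_measurable.
- exact: sigma_rv_measurable.
- exact: sigma_rv_measurable.
Qed.

Lemma sigma_process_measurable D A : sigma_process D B A -> measurable A.
Proof.
apply: smallest_sub => [|C [u _]]; first exact: sigma_algebra_measurable.
exact: sigma_rv_measurable.
Qed.

Lemma measurable_wrt_measurable_fun t (f : Omega -> R) : measurable_wrt (F t) f ->
  measurable_fun setT f.
Proof. by move=> mf _ A mA; rewrite setTI; apply: filtration_measurable (mf _ mA). Qed.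

Lemma brownian_measurable_wrt s t : 0 <= s <= t -> measurable_wrt (T' := R) (F t) (B s).
Proof.
move=> st A mA; apply: sub_sigma_algebra; right; exists s; first by rewrite /= in_itv.
by exists A.
Qed.

Lemma sigma_process_increment s t : 0 <= s -> 0 <= t ->
  sigma_rv (fun w => B t w - B s w) `<=` sigma_process `[0, +oo[ B.
Proof.
move=> s0 t0 _ [A mA <-].
have mB u : 0 <= u -> measurable_wrt (T' := R) (sigma_process `[0, +oo[ B) (B u).
  move=> u0 C mC; apply: sub_sigma_algebra; exists u; last by exists C.
  by rewrite /= in_itv/= u0.
have /measurable_wrt_gen mBt := mB _ t0; have /measurable_wrt_gen mBs := mB _ s0.
have /measurable_wrt_gen := measurable_funB mBt mBs.
exact.
Qed.

Hypothesis BM : brownian_motion B.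
Hypothesis ZB : independent P (sigma_rv Z) (sigma_process `[0, +oo[ B).

(** Brownian motion provides independence from its own past only, whereas [F s] also contains [Z].
    On intersections of an event [A1] of [Z] with an event [A2] of the past of [B], independence of
    [Z] from all of [B] gives [P (A1 A2 D) = P A1 P (A2 D) = P A1 P A2 P D]. These intersections
    form a pi-system [G] whose generated sigma-algebra contains [F s], and the finite measures
    [P (. D)] and [P D P] agree on it. *)
Lemma filtration_independent_increment s t : 0 <= s -> s < t ->
  independent P (F s) (sigma_rv (fun w => B t w - B s w)).
Proof.
move=> s0 st A D FA sD.
have t0 : 0 <= t by exact: le_trans (ltW st).
have BD := sigma_process_increment s0 t0 sD.
have mD := sigma_process_measurable BD.
pose G : set (set Omega) :=
  [set E | exists A1 A2, [/\ sigma_rv Z A1, sigma_process `[0, s] B A2 & E = A1 `&` A2]].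
have BsT A2 : sigma_process `[0, s] B A2 -> sigma_process `[0, +oo[ B A2.
  apply: sub_sigma_algebra2 => E [u us]; exists u => //.
  by move: us; rewrite /= !in_itv/= => /andP[->].
have GI : setI_closed G.
  move=> _ _ [A1 [A2 [ZA1 BA2 ->]]] [C1 [C2 [ZC1 BC2 ->]]].
  exists (A1 `&` C1), (A2 `&` C2); split; last by rewrite setIACA.
  - exact: sigma_rv_setI.
  - exact: (@measurableI _ (g_sigma_algebraType _)).
have mG : G `<=` measurable.
  move=> _ [A1 [A2 [ZA1 BA2 ->]]]; apply: measurableI.
    exact: sigma_rv_measurable ZA1.
  exact: sigma_process_measurable BA2.
have sZT : sigma_rv Z setT by exists setT; [exact: measurableT|].
have sBT : sigma_process `[0, s] B setT.
  exact: (@measurableT _ (g_sigma_algebraType _)).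
have GA : <<s G >> A.
  move: FA; apply: smallest_sub; first exact: smallest_sigma_algebra.
  move=> C [ZC|BC]; apply: sub_sigma_algebra.
  - by exists C, setT; rewrite setIT.
  - by exists setT, C; rewrite setTI; split => //; exact: sub_sigma_algebra.
have PD0 : 0 <= fine (P D) by exact: fine_ge0.
have PDE : (fine (P D))%:E = P D by rewrite fineK// fin_num_measure.
pose m2 := mscale (NngNum PD0) P.
have GT : G setT by exists setT, setT; rewrite setIT.
have H : mrestr P mD A = m2 A.
  apply: (@g_sigma_algebra_measure_unique _ _ _ G mG (fun=> setT)) => //.
  - by rewrite bigcup_const.
  - move=> _ [A1 [A2 [ZA1 BA2 ->]]]; rewrite /= /mrestr /m2 /mscale /= PDE.
    have BA2D : sigma_process `[0, +oo[ B (A2 `&` D).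
      by apply: (@measurableI _ (g_sigma_algebraType _)) => //; exact: BsT.
    case: BM => _ /(_ s t s0 st) indB _ _.
    rewrite -setIA ZB// indB// ZB//; last exact: BsT.
    by rewrite muleA muleC.
  - by move=> _; rewrite /= /mrestr setTI -ge0_fin_numE ?fin_num_measure.
by rewrite -[LHS]/(mrestr P mD A) H /m2 /mscale/= PDE muleC.
Qed.

Lemma increment_independent s t (g Y : Omega -> R) (k : R -> R) :
  0 <= s -> s < t -> measurable_wrt (F s) Y -> measurable_fun setT k ->
  (forall w, g w = k (B t w - B s w)) ->
  independent P (sigma_rv Y) (sigma_rv g).
Proof.
move=> s0 st mY mk gE _ _ [A mA <-] [C mC <-].
apply: (filtration_independent_increment s0 st); first exact: mY.
exists (k @^-1` C); first by rewrite -[_ @^-1` _]setTI; exact: mk.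
by apply/seteqP; split => w /=; rewrite gE.
Qed.

Lemma increment_law s t : 0 <= s -> s < t ->
  forall A : set (measurableTypeR R), measurable A ->
  P ((fun w => B t w - B s w) @^-1` A) = normal_prob 0 (Num.sqrt (t - s)) A.
Proof. by case: BM => _ _ + _; apply. Qed.

Lemma increment_measurable s t : measurable_fun setT (fun w => B t w - B s w).
Proof. exact: measurable_funB. Qed.

Lemma increment_integrable s t n : 0 <= s -> s <= t -> (n <= 4)%N ->
  P.-integrable setT (fun w => ((B t w - B s w) ^+ n)%:E).
Proof.
move=> s0; rewrite le_eqVlt => /predU1P[-> n4|st n4].
  under eq_fun do rewrite subrr.
  exact: (finite_measure_integrable_cst _ (0 ^+ n)).
apply: (normal_integrable (s := Num.sqrt (t - s))) => //.
- exact: increment_measurable.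
- by rewrite sqrtr_gt0 subr_gt0.
- exact: increment_law.
Qed.

Lemma increment_moment1 s t : 0 <= s -> s <= t ->
  (\int[P]_w (B t w - B s w)%:E = 0)%E.
Proof.
move=> s0; rewrite le_eqVlt => /predU1P[->|st].
  by under eq_integral do rewrite subrr; rewrite integral0.
apply: (normal_moment1 (s := Num.sqrt (t - s))) => //.
- exact: increment_measurable.
- by rewrite sqrtr_gt0 subr_gt0.
- exact: increment_law.
Qed.

Lemma increment_moment2 s t : 0 <= s -> s <= t ->
  (\int[P]_w ((B t w - B s w) ^+ 2)%:E = (t - s)%:E)%E.
Proof.
move=> s0; rewrite le_eqVlt => /predU1P[->|st].
  under eq_integral do rewrite subrr expr0n/=.
  by rewrite integral0 subrr.
rewrite (normal_moment2 (s := Num.sqrt (t - s))) ?sqr_sqrtr ?subr_ge0 ?(ltW st)//.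
- exact: increment_measurable.
- by rewrite sqrtr_gt0 subr_gt0.
- exact: increment_law.
Qed.

Lemma increment_moment4 s t : 0 <= s -> s <= t ->
  (\int[P]_w ((B t w - B s w) ^+ 4)%:E <= (29 * (t - s) ^+ 2)%:E)%E.
Proof.
move=> s0; rewrite le_eqVlt => /predU1P[->|st].
  under eq_integral do rewrite subrr expr0n/=.
  by rewrite integral0 subrr expr0n/= mulr0.
have {1}<- : Num.sqrt (t - s) ^+ 2 = t - s by rewrite sqr_sqrtr// subr_ge0 ltW.
rewrite -exprM; apply: normal_moment4_le.
- exact: increment_measurable.
- by rewrite sqrtr_gt0 subr_gt0.
- exact: increment_law.
Qed.

(** The martingale property of [B], tested against a weight from the past. *)
Lemma integral_increment s t (Y : Omega -> R) : 0 <= s -> s <= t ->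
  measurable_wrt (F s) Y -> P.-integrable setT (EFin \o Y) ->
  P.-integrable setT (fun w => (Y w * (B t w - B s w))%:E) /\
  (\int[P]_w (Y w * (B t w - B s w))%:E = 0)%E.
Proof.
move=> s0; rewrite le_eqVlt => /predU1P[-> _ _|st mY iY].
  under eq_fun do rewrite subrr mulr0.
  by rewrite integral0; split => //; exact: integrable0.
have mY' := measurable_wrt_measurable_fun mY.
pose U : {RV P >-> R} := mfun_Sub (mem_set mY').
pose V : {RV P >-> R} := mfun_Sub (mem_set (increment_measurable s t)).
apply: (@independent_integralM_eq0 _ _ _ _ U V) => //.
- by apply: (@increment_independent s t V U id).
- by have := increment_integrable s0 (ltW st) (isT : (1 <= 4)%N).
- exact: increment_moment1 (ltW st).
Qed.

(** The martingale property of [B ^ 2 - t], for an increment written in terms of the square of the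
    increment of [B]. *)
Lemma integral_increment_var s t (Y : Omega -> R) : 0 <= s -> s <= t ->
  measurable_wrt (F s) Y -> P.-integrable setT (EFin \o Y) ->
  P.-integrable setT (fun w => (Y w * ((B t w - B s w) ^+ 2 - (t - s)))%:E) /\
  (\int[P]_w (Y w * ((B t w - B s w) ^+ 2 - (t - s)))%:E = 0)%E.
Proof.
move=> s0; rewrite le_eqVlt => /predU1P[-> _ _|st mY iY].
  under eq_fun do rewrite !subrr expr0n/= subrr mulr0.
  by rewrite integral0; split => //; exact: integrable0.
have mY' := measurable_wrt_measurable_fun mY.
have mV : measurable_fun setT (fun w => (B t w - B s w) ^+ 2 - (t - s)).
  by apply: measurable_funB => //; apply: measurable_funX; exact: increment_measurable.
pose U : {RV P >-> R} := mfun_Sub (mem_set mY').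
pose V : {RV P >-> R} := mfun_Sub (mem_set mV).
have i2 := increment_integrable s0 (ltW st) (isT : (2 <= 4)%N).
have i0 : P.-integrable setT (fun w => (cst (t - s) w)%:E).
  exact: (finite_measure_integrable_cst _ (t - s)).
apply: (@independent_integralM_eq0 _ _ _ _ U V) => //.
- apply: (@increment_independent s t V U (fun x => x ^+ 2 - (t - s))) => //.
  by apply: measurable_funB => //; exact: measurable_funX.
- by have := integrableB measurableT i2 i0; apply: eq_integrable.
- under eq_integral do rewrite /= EFinB.
  rewrite (integralB measurableT i2 i0) increment_moment2 ?(ltW st)//.
  rewrite (_ : \int[P]_x _ = (t - s)%:E)%E; first by rewrite -EFinB subrr.
  transitivity ((t - s)%:E * P setT)%E; last by rewrite probability_setT mule1.
  exact: (integral_cst P measurableT (t - s)%:E).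
Qed.

Lemma ge0_integral_increment s t (Y : Omega -> R) n : 0 <= s -> s < t ->
  measurable_wrt (F s) Y -> (forall w, 0 <= Y w) -> ~~ odd n ->
  (\int[P]_w (Y w * (B t w - B s w) ^+ n)%:E
   = (\int[P]_w (Y w)%:E) * (\int[P]_w ((B t w - B s w) ^+ n)%:E))%E.
Proof.
move=> s0 st mY Y0 n2.
have mY' := measurable_wrt_measurable_fun mY.
have mV : measurable_fun setT (fun w => (B t w - B s w) ^+ n).
  by apply: measurable_funX; exact: increment_measurable.
pose U : {RV P >-> R} := mfun_Sub (mem_set mY').
pose V : {RV P >-> R} := mfun_Sub (mem_set mV).
apply: (@ge0_independent_integralM _ _ _ _ U V) => //.
- by apply: (@increment_independent s t V U (fun x => x ^+ n)).
- by move=> w; exact: exprn_even_ge0.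
Qed.

Lemma integral_increment_sqr s t (Y : Omega -> R) : 0 <= s -> s <= t ->
  measurable_wrt (F s) Y -> (forall w, 0 <= Y w) ->
  (\int[P]_w (Y w * (B t w - B s w) ^+ 2)%:E
   = (t - s)%:E * \int[P]_w (Y w)%:E)%E.
Proof.
move=> s0; rewrite le_eqVlt => /predU1P[-> _ _|st mY Y0].
  by under eq_integral do rewrite subrr expr0n/= mulr0; rewrite integral0 subrr mul0e.
by rewrite ge0_integral_increment// increment_moment2 ?(ltW st)// muleC.
Qed.

Lemma integral_bound_increment4 s t (Y : Omega -> R) a : 0 <= s -> s <= t ->
  measurable_wrt (F s) Y -> integral_bound P Y a ->
  integral_bound P (fun w => Y w * (B t w - B s w) ^+ 4) (29 * (t - s) ^+ 2 * a).
Proof.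
move=> s0 st mY [mY' Y0 Ya]; split.
- apply: measurable_funM => //; apply: measurable_funX; exact: increment_measurable.
- by move=> w; rewrite mulr_ge0// exprn_even_ge0.
move: st; rewrite le_eqVlt => /predU1P[->|st].
  under eq_integral do rewrite subrr expr0n/= mulr0.
  by rewrite integral0 subrr expr0n/= mulr0 mul0r.
rewrite ge0_integral_increment// muleC EFinM.
apply: lee_pmul => //; [| |exact: increment_moment4 (ltW st)].
- by apply: integral_ge0 => w _; rewrite lee_fin exprn_even_ge0.
- by apply: integral_ge0 => w _; rewrite lee_fin.
Qed.

End filtration.

(** * Orthogonal sums and sums over Brownian increments *)

Section orthogonal_sum.
Context d (Omega : measurableType d) (R : realType) (P : probability Omega R).
Variables (M : nat -> Omega -> R) (a : nat -> R) (N : nat).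
Let S n w := \sum_(j < n) M j w.

Hypothesis Ma : forall j, (j < N)%N ->
  measurable_fun setT (M j) /\ integral_bound P (fun w => M j w ^+ 2) (a j).
Hypothesis SM : forall j b, (j < N)%N ->
  integral_bound P (fun w => S j w ^+ 2) b ->
  P.-integrable setT (fun w => (S j w * M j w)%:E) /\
  (\int[P]_w (S j w * M j w)%:E = 0)%E.

(** Pythagoras by induction on the number of terms. The induction supplies the L2 bound on the
    partial sum that [SM] asks for; in the applications this bound is what makes the mixed product
    integrable. *)
Lemma integral_bound_orthogonal_sum :
  integral_bound P (fun w => (\sum_(j < N) M j w) ^+ 2) (\sum_(j < N) a j).
Proof.
have mS n : (n <= N)%N -> measurable_fun setT (S n).
  elim: n => [_|n IH nN].
    by rewrite /S (_ : (fun _ => _) = fun=> 0)//; apply/funext => w; rewrite big_ord0.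
  rewrite /S (_ : (fun _ => _) = fun w => S n w + M n w); last first.
    by apply/funext => w; rewrite big_ord_recr.
  by apply: measurable_funD; [exact: IH (ltnW nN)|case: (Ma nN)].
suff : forall n, (n <= N)%N -> integral_bound P (fun w => S n w ^+ 2) (\sum_(j < n) a j).
  exact.
elim=> [_|n IH nN].
  rewrite big_ord0; apply: integral_bound_eq (integral_bound0 P) => w.
  by rewrite /S big_ord0 expr0n.
have {IH} bS := IH (ltnW nN).
have [mM bM] := Ma nN.
have [iSM SM0] := SM nN bS.
have mSn := mS n (ltnW nN).
split=> [|w|]; [by apply: measurable_funX; exact: mS|exact: sqr_ge0|].
have iS : P.-integrable setT (fun w => (S n w ^+ 2)%:E).
  apply: integral_bound_integrable bS => [|w]; first exact: measurable_funX.
  by rewrite ger0_norm// sqr_ge0.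
have iM : P.-integrable setT (fun w => (M n w ^+ 2)%:E).
  apply: integral_bound_integrable bM => [|w]; first exact: measurable_funX.
  by rewrite ger0_norm// sqr_ge0.
have -> : (\int[P]_w (S n.+1 w ^+ 2)%:E =
    \int[P]_w (((S n w ^+ 2)%:E + (M n w ^+ 2)%:E) + 2%:E * (S n w * M n w)%:E))%E.
  apply: eq_integral => w _; rewrite -EFinM -!EFinD; congr EFin.
  by rewrite /S big_ord_recr/=; ring.
rewrite integralD//; first last.
- exact: integrableZl.
- exact: integrableD.
rewrite integralD// integralZl// SM0 mule0 adde0 big_ord_recr/= EFinD.
by case: bS => _ _ bS; case: bM => _ _ bM; exact: leeD.
Qed.

End orthogonal_sum.

Section measurable_wrt_closure.
Context d (Omega : measurableType d) (R : realType).
Variable G : set (set Omega).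
Local Notation mwrt := (measurable_wrt (T' := R) <<s G >>).

Lemma measurable_wrt_cst (c : R) : mwrt (fun=> c).
Proof. by apply/measurable_wrt_gen. Qed.

Lemma measurable_wrtD (f g : Omega -> R) : mwrt f -> mwrt g ->
  mwrt (fun w => f w + g w).
Proof.
move=> /measurable_wrt_gen mf /measurable_wrt_gen mg; apply/measurable_wrt_gen.
exact: measurable_funD.
Qed.

Lemma measurable_wrtB (f g : Omega -> R) : mwrt f -> mwrt g ->
  mwrt (fun w => f w - g w).
Proof.
move=> /measurable_wrt_gen mf /measurable_wrt_gen mg; apply/measurable_wrt_gen.
exact: measurable_funB.
Qed.

Lemma measurable_wrtM (f g : Omega -> R) : mwrt f -> mwrt g ->
  mwrt (fun w => f w * g w).
Proof.
move=> /measurable_wrt_gen mf /measurable_wrt_gen mg; apply/measurable_wrt_gen.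
exact: measurable_funM.
Qed.

Lemma measurable_wrtX (f : Omega -> R) n : mwrt f -> mwrt (fun w => f w ^+ n).
Proof.
move=> /measurable_wrt_gen mf; apply/measurable_wrt_gen; exact: measurable_funX.
Qed.

Lemma measurable_wrt_comp (f : Omega -> R) (k : R -> R) : measurable_fun setT k ->
  mwrt f -> mwrt (fun w => k (f w)).
Proof.
move=> mk /measurable_wrt_gen mf; apply/measurable_wrt_gen; exact: measurableT_comp.
Qed.

Lemma measurable_wrt_sum I (r : seq I) (p : pred I) (f : I -> Omega -> R) :
  (forall i, p i -> mwrt (f i)) -> mwrt (fun w => \sum_(i <- r | p i) f i w).
Proof.
move=> mf; elim: r => [|i r IH].
  rewrite (_ : (fun _ => _) = fun=> 0); first exact: measurable_wrt_cst.
  by apply/funext => w; rewrite big_nil.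
have [pi|npi] := boolP (p i); last first.
  rewrite (_ : (fun _ => _) = fun w => \sum_(i <- r | p i) f i w)//.
  by apply/funext => w; rewrite big_cons (negbTE npi).
rewrite (_ : (fun _ => _) = fun w => f i w + \sum_(i <- r | p i) f i w).
  by apply: measurable_wrtD => //; exact: mf.
by apply/funext => w; rewrite big_cons pi.
Qed.

End measurable_wrt_closure.

Section increment_sums.
Context d (Omega : measurableType d) (R : realType) (P : probability Omega R).
Variables (B : R -> {RV P >-> R}) (Z : {RV P >-> R}).
Local Notation F := (filtration_of Z B).
Hypothesis BM : brownian_motion B.
Hypothesis ZB : independent P (sigma_rv Z) (sigma_process `[0, +oo[ B).

Lemma measurable_wrt_filtrationW s t (f : Omega -> R) : s <= t ->
  measurable_wrt (T' := R) (F s) f -> measurable_wrt (T' := R) (F t) f.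
Proof. by move=> st mf A mA; exact: filtration_mono (mf _ mA). Qed.

Lemma measurable_wrt_increment s t : 0 <= s -> s <= t ->
  measurable_wrt (T' := R) (F t) (fun w => B t w - B s w).
Proof.
move=> s0 st; apply: measurable_wrtB; apply: brownian_measurable_wrt.
  by rewrite (le_trans s0 st) lexx.
by rewrite s0 st.
Qed.

Variables (v : nat -> R) (N : nat) (G : nat -> Omega -> R) (a : nat -> R).
Hypothesis v0 : 0 <= v 0%N.
Hypothesis vS : forall j, (j < N)%N -> v j <= v j.+1.
Hypothesis GF : forall j, (j < N)%N -> measurable_wrt (T' := R) (F (v j)) (G j).
Hypothesis GC : forall j, (j < N)%N -> exists C : R, forall w, `|G j w| <= C.
Local Notation dv j := (v j.+1 - v j).
Local Notation dB j w := (B (v j.+1) w - B (v j) w).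

Let v_mono i j : (i <= j <= N)%N -> v i <= v j.
Proof.
move=> /andP[]; elim: j => [|j IH]; first by rewrite leqn0 => /eqP->.
rewrite leq_eqVlt => /predU1P[->//|]; rewrite ltnS => ij jN.
exact: le_trans (IH ij (ltnW jN)) (vS jN).
Qed.

Let v_ge0 j : (j <= N)%N -> 0 <= v j.
Proof. by move=> jN; exact: le_trans v0 (v_mono _). Qed.

Let mG j : (j < N)%N -> measurable_fun setT (G j).
Proof. by move=> jN; exact: measurable_wrt_measurable_fun (GF jN). Qed.

Let mdB j : measurable_fun setT (fun w => dB j w).
Proof. exact: increment_measurable. Qed.

Let integrable_bounded_mul (S : Omega -> R) j b : (j < N)%N ->
  measurable_fun setT S -> integral_bound P (fun w => S w ^+ 2) b ->
  P.-integrable setT (EFin \o (fun w => S w * G j w)).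
Proof.
move=> jN mS bS; have [C GC'] := GC jN.
have C0 : 0 <= C by exact: le_trans (GC' point).
have b1 := integral_boundZ C0 (integral_boundD (integral_bound_cst P ler01) bS).
apply: integral_bound_integrable b1 => [|w]; first by apply: measurable_funM => //; exact: mG.
rewrite normrM mulrC ler_pM//.
have := sqr_ge0 (`|S w| - 1); rewrite -(real_normK (num_real (S w))).
have := normr_ge0 (S w); set x := `|S w|; nra.
Qed.

(** The discrete Ito isometry, as an inequality: the sum of the earlier terms times [G j] is known
    at time [v j], hence orthogonal to the next increment. The bounds are kept cell by cell, since
    they come from an integral over time. *)
Lemma integral_bound_increment_sum :
  (forall j, (j < N)%N -> integral_bound P (fun w => G j w ^+ 2) (a j)) ->
  integral_bound P (fun w => (\sum_(j < N) G j w * dB j w) ^+ 2)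
    (\sum_(j < N) dv j * a j).
Proof.
move=> Ga; apply: (@integral_bound_orthogonal_sum _ _ _ P (fun j w => G j w * dB j w)
   (fun j => dv j * a j)) => [j jN|j b jN bS].
  split; first by apply: measurable_funM => //; exact: mG.
  split=> [|w|]; [|exact: sqr_ge0|].
    by apply: measurable_funX; apply: measurable_funM => //; exact: mG.
  under eq_integral do rewrite exprMn.
  rewrite (@integral_increment_sqr _ _ _ P B Z)//; last 4 first.
  - by rewrite v_ge0// ltnW.
  - exact: vS.
  - by apply: measurable_wrtX; exact: GF.
  - by move=> w; exact: sqr_ge0.
  rewrite EFinM lee_wpmul2l// ?lee_fin ?subr_ge0; first exact: vS.
  by case: (Ga _ jN).
have mS : measurable_wrt (T' := R) (F (v j)) (fun w => \sum_(i < j) G i w * dB i w).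
  apply: measurable_wrt_sum => i _; have ij : (i < N)%N by exact: ltn_trans jN.
  apply: measurable_wrtM.
    apply: measurable_wrt_filtrationW (GF ij); apply: v_mono.
    by rewrite (ltnW (ltn_ord i)) ltnW.
  apply: measurable_wrt_filtrationW (measurable_wrt_increment _ (vS ij)).
    by apply: v_mono; rewrite ltn_ord ltnW.
  by rewrite v_ge0// ltnW.
under eq_fun do rewrite mulrA.
apply: (integral_increment BM ZB); [by rewrite v_ge0// ltnW|exact: vS| |].
  by apply: measurable_wrtM => //; exact: GF.
by apply: integrable_bounded_mul bS => //; exact: measurable_wrt_measurable_fun mS.
Qed.

(** The terms are orthogonal by the martingale property of [B ^ 2 - t]. Each square is at most
    [G ^ 2 (2 dB ^ 4 + 2 dv ^ 2)], and the fourth moment contributes 29, so that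
    [60 = 2 * 29 + 2]. *)
Lemma integral_bound_increment_var_sum :
  (forall j, (j < N)%N -> integral_bound P (fun w => G j w ^+ 2) (a j)) ->
  integral_bound P (fun w => (\sum_(j < N) G j w * (dB j w ^+ 2 - dv j)) ^+ 2)
    (\sum_(j < N) 60 * dv j ^+ 2 * a j).
Proof.
move=> Ga; apply: (@integral_bound_orthogonal_sum _ _ _ P
    (fun j w => G j w * (dB j w ^+ 2 - dv j))
   (fun j => 60 * dv j ^+ 2 * a j)) => [j jN|j b jN bS].
  have mM : measurable_fun setT (fun w => G j w * (dB j w ^+ 2 - dv j)).
    apply: measurable_funM; first exact: mG.
    by apply: measurable_funB => //; exact: measurable_funX.
  split => //.
  have dv0 : 0 <= dv j by rewrite subr_ge0; exact: vS.
  have vj0 : 0 <= v j by rewrite v_ge0// ltnW.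
  have mG2 : measurable_wrt (T' := R) (F (v j)) (fun w => G j w ^+ 2).
    by apply: measurable_wrtX; exact: GF.
  have b4 := integral_boundZ (ler0n _ 2)
    (integral_bound_increment4 BM ZB vj0 (vS jN) mG2 (Ga _ jN)).
  have c2 : 0 <= 2 * dv j ^+ 2 by rewrite mulr_ge0// sqr_ge0.
  have b2 := integral_boundZ c2 (Ga _ jN).
  apply: (integral_bound_le _ _ (integral_boundD b4 b2)).
  - exact: measurable_funX.
  - move=> w; rewrite sqr_ge0/=.
    rewrite [leRHS](_ : _ = G j w ^+ 2 * (2 * (dB j w ^+ 2) ^+ 2 + 2 * dv j ^+ 2)); last by ring.
    rewrite exprMn ler_wpM2l ?sqr_ge0//.
    have := sqr_ge0 (dB j w ^+ 2 + dv j); nra.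
  - by rewrite le_eqVlt; apply/orP; left; apply/eqP; ring.
have mS : measurable_wrt (T' := R) (F (v j))
    (fun w => \sum_(i < j) G i w * (dB i w ^+ 2 - dv i)).
  apply: measurable_wrt_sum => i _; have ij : (i < N)%N by exact: ltn_trans jN.
  apply: measurable_wrtM.
    apply: measurable_wrt_filtrationW (GF ij); apply: v_mono.
    by rewrite (ltnW (ltn_ord i)) ltnW.
  apply: measurable_wrtB; last exact: measurable_wrt_cst.
  apply: measurable_wrtX.
  apply: measurable_wrt_filtrationW (measurable_wrt_increment _ (vS ij)).
    by apply: v_mono; rewrite ltn_ord ltnW.
  by rewrite v_ge0// ltnW.
under eq_fun do rewrite mulrA.
apply: (integral_increment_var BM ZB); [by rewrite v_ge0// ltnW|exact: vS| |].
  by apply: measurable_wrtM => //; exact: GF.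
by apply: integrable_bounded_mul bS => //; exact: measurable_wrt_measurable_fun mS.
Qed.

End increment_sums.

(** * Integrals over time and the sample space *)

Section time_space.
Context d (Omega : measurableType d) (R : realType) (P : probability Omega R).
Variable (t : R).
Hypothesis t0 : 0 <= t.
Local Notation lambda := (@lebesgue_measure R).

Let mt : measurable (`[0, t]%classic : set (measurableTypeR R)). Proof. exact: measurable_itv. Qed.

Let itv_oo a b : (lambda `[a, b] < +oo)%E.
Proof.
by rewrite lebesgue_measure_itv/= lte_fin; case: ifP => //; rewrite -EFinD ltry.
Qed.

Let lt_oo : (lambda `[0%R, t] < +oo)%E := itv_oo 0 t.

(** A finite measure on the whole line, rather than an integral over an interval, so that its
    product with [P] can be formed and Tonelli's theorem applies. *)
Definition time_measure : {finite_measure set (measurableTypeR R) -> \bar R} :=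
  mfrestr mt lt_oo.

Lemma integral_time_measure (g : measurableTypeR R -> R) : measurable_fun setT g ->
  (forall x, 0 <= g x) ->
  (\int[time_measure]_s (g s)%:E = \int[lambda]_(s in `[0%R, t]) (g s)%:E)%E.
Proof.
move=> mg g0.
rewrite (@ge0_integral_density _ (measurableTypeR R) _ lambda time_measure (\1_(`[0, t] : set R)))//; last first.
  move=> A mA; rewrite integral_indic// /time_measure /mfrestr /mrestr.
  by rewrite setIC.
rewrite [RHS]integral_mkcond; apply: eq_integral => s _.
by rewrite patchE indicE; case: ifPn => _; rewrite ?mulr1 ?mulr0.
Qed.

Definition time_space_measure :
  {measure set (measurableTypeR R * Omega)%type -> \bar R} := (time_measure \x P)%E.

Lemma integral_time_space (f : measurableTypeR R * Omega -> R) : measurable_fun setT f ->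
  (forall p, 0 <= f p) ->
  (\int[time_space_measure]_p (f p)%:E =
   \int[P]_w \int[lambda]_(s in `[0%R, t]) (f (s, w))%:E)%E.
Proof.
move=> mf f0.
have mfE : measurable_fun setT (EFin \o f) by exact/measurable_EFinP.
have f0E p : (0 <= (EFin \o f) p)%E by rewrite lee_fin.
rewrite [LHS](fubini_tonelli2 (m1 := time_measure) (m2 := P) (EFin \o f) mfE f0E).
apply: eq_integral => w _; rewrite /fubini_G integral_time_measure//.
exact: measurable_fun_pair1.
Qed.

(** Cells of grids are open on the left and cover []0, t]] only; the time 0 they miss is a null
    set. *)
Lemma time_space_ae : {ae time_space_measure, forall p, 0 < p.1 <= t}.
Proof.
pose N : set (measurableTypeR R) := ~` `]0, t]%classic.
have mN : measurable N by apply: measurableC; exact: measurable_itv.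
exists (N `*` setT); split.
- exact: measurableX.
- transitivity (time_measure N * P setT)%E; first exact: product_measure1E.
  rewrite (_ : time_measure N = 0)%E ?mul0e//.
  rewrite /time_measure /= /mfrestr /mrestr.
  apply/eqP; rewrite -measure_le0 -(lebesgue_measure_set1 (0 : R)).
  apply: le_measure; rewrite ?inE//; first exact: measurableI.
  move=> s [] /=; rewrite !in_itv/= => /negP; rewrite negb_and -leNgt.
  case/orP => [h /andP[h1 _]|/negP h /andP[_ h2]]; last by exfalso; exact: h.
  by apply/eqP; rewrite eq_le h h1.
- by move=> p /= h; split => //= hN; apply: h; move: hN; rewrite /= in_itv.
Qed.

Lemma integral_bound_time_space (f : measurableTypeR R * Omega -> R) a :
  measurable_fun setT f -> (forall p, 0 <= f p) -> 0 <= a ->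
  (forall s, 0 < s <= t -> (\int[P]_w (f (s, w))%:E <= a%:E)%E) ->
  integral_bound time_space_measure f (t * a).
Proof.
move=> mf f0 a0 fa.
(* The bound on [f] is assumed for times in []0, t]]; after the cut-off it holds for all times, as
   the comparison under the outer integral requires. *)
pose chi : measurableTypeR R -> R := \1_(`]0, t]%classic : set (measurableTypeR R)).
have mchi : measurable_fun setT chi by apply: measurable_indic; exact: measurable_itv.
pose f' (p : measurableTypeR R * Omega) := chi p.1 * f p.
have mf' : measurable_fun setT f'.
  by apply: measurable_funM => //; exact: measurableT_comp mchi measurable_fst.
have f'0 p : 0 <= f' p by rewrite mulr_ge0 // /chi indicE.
have bf' : integral_bound time_space_measure f' (t * a).
  split => //.
  have mfE : measurable_fun setT (EFin \o f') by exact/measurable_EFinP.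
  have f0E p : (0 <= (EFin \o f') p)%E by rewrite lee_fin.
  rewrite [leLHS](fubini_tonelli1 (m1 := time_measure) (m2 := P) (EFin \o f') mfE f0E).
  apply: (@le_trans _ _ (\int[time_measure]_s a%:E)%E).
    apply: ge0_le_integral => //.
    - by move=> s _; apply: integral_ge0.
    - exact: (measurable_fun_fubini_tonelli_F (m2 := P)).
    - move=> s _; rewrite /fubini_F/= /f' /= /chi.
      have [st|st] := boolP (s \in (`]0, t]%classic : set (measurableTypeR R))).
        rewrite indicE st; under eq_integral do rewrite mul1r.
        by apply: fa; move: st; rewrite inE/= in_itv.
      rewrite indicE (negbTE st); under eq_integral do rewrite mul0r.
      by rewrite integral0 lee_fin.
  rewrite integral_cst// /time_measure/= /mfrestr /mrestr setTI.
  rewrite lebesgue_measure_itv/= lte_fin.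
  case: ifP => [_|]; first by rewrite -EFinD subr0 -EFinM lee_fin mulrC.
  by rewrite mule0 lee_fin mulr_ge0.
apply: integral_bound_ae bf' => //.
have FM : Filter (almost_everywhere time_space_measure).
  exact: (ae_filter_ringOfSetsType time_space_measure).
apply: filterS time_space_ae => p pt; rewrite /f' /chi indicE mem_set ?mul1r//.
Qed.

Lemma integral_bound_le_time_space (f g : measurableTypeR R * Omega -> R) a b :
  measurable_fun setT f -> (forall p, 0 <= f p) ->
  (forall p, 0 < p.1 <= t -> f p <= g p) ->
  integral_bound time_space_measure g a -> a <= b ->
  integral_bound time_space_measure f b.
Proof.
move=> mf f0 fg [mg g0 ga] ab; split => //.
apply: (@le_trans _ _ (a%:E)); last by rewrite lee_fin.
apply: le_trans ga; apply: ae_ge0_le_integral => //.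
- by move=> p _; rewrite lee_fin.
- exact/measurable_EFinP.
- by move=> p _; rewrite lee_fin.
- exact/measurable_EFinP.
- have FM : Filter (almost_everywhere time_space_measure).
    exact: (ae_filter_ringOfSetsType time_space_measure).
  by apply: filterS time_space_ae => p pt _; rewrite lee_fin fg.
Qed.

Section bounded_process.
Variables (f : measurableTypeR R * Omega -> R) (C : R).
Hypothesis mf : measurable_fun setT f.
Hypothesis fC : forall p, `|f p| <= C.

Lemma bounded_integrable (a b : R) w :
  lambda.-integrable `[a, b] (fun s : measurableTypeR R => (f (s, w))%:E).
Proof.
apply: measurable_bounded_integrable => //.
- exact: itv_oo.
- by apply: measurable_funTS; exact: measurable_fun_pair1.
- exists C; split; first exact: num_real.
  by move=> x Cx s _; rewrite /= (le_trans (fC _))// ltW.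
Qed.

Definition time_integral w : R := \int[lambda]_(s in `[0, t]) f (s, w).

Lemma measurable_time_integral : measurable_fun setT time_integral.
Proof.
(* Tonelli's theorem gives measurability of integrals of nonnegative functions; adding the bound [C]
   makes [f] nonnegative and adds [C t] to the integral. *)
pose g p := f p + C.
have mg : measurable_fun setT g by exact: measurable_funD.
have g0 p : 0 <= g p by have := fC p; rewrite ler_norml /g => /andP[? _]; lra.
have C0 : 0 <= C by exact: le_trans (fC (0, point)).
have mgE : measurable_fun setT (EFin \o g) by exact/measurable_EFinP.
have g0E p : (0 <= (EFin \o g) p)%E by rewrite lee_fin.
have := measurable_fun_fubini_tonelli_G (m1 := time_measure) (EFin \o g) mgE g0E.
move=> mG.
have -> : time_integral = fun w => fine (fubini_G time_measure (EFin \o g) w) - C * t.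
  apply/funext => w; rewrite /fubini_G integral_time_measure//; last exact: measurable_fun_pair1.
  rewrite -[fine _]/(\int[lambda]_(s in `[0, t]) g (s, w)) /g RintegralD//.
  - rewrite Rintegral_cst//.
    rewrite (_ : fine _ = t) ?addrK//.
    transitivity (fine (lambda `[0%R, t]))%E => //.
    rewrite lebesgue_measure_itv/= lte_fin.
    case: ifPn => [_|]; first by rewrite /= oppr0 addr0.
    by rewrite -leNgt => t0'; apply/eqP; rewrite eq_le /= t0 t0'.
  - exact: bounded_integrable.
  - apply: measurable_bounded_integrable => //.
    by exists C; split; [exact: num_real|move=> x Cx s _; rewrite /= ger0_norm// ltW].
by apply: measurable_funB => //; apply: measurableT_comp mG.
Qed.

Lemma integral_bound_time_integral a :
  integral_bound time_space_measure (fun p => `|f p|) a ->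
  integral_bound P (fun w => `|time_integral w|) a.
Proof.
move=> [mnf nf0 fa]; split => //.
  by apply: measurableT_comp => //; exact: measurable_time_integral.
apply: le_trans fa; rewrite integral_time_space//.
apply: ge0_le_integral => //.
- apply/measurable_EFinP; apply: measurableT_comp => //; exact: measurable_time_integral.
- pose h p : R := `|f p|.
  have mE : measurable_fun setT (EFin \o h) by exact/measurable_EFinP.
  have E0 p : (0 <= (EFin \o h) p)%E by rewrite lee_fin normr_ge0.
  have := measurable_fun_fubini_tonelli_G (m1 := time_measure) _ mE E0.
  congr (measurable_fun _ _); apply/funext => w.
  rewrite /fubini_G (integral_time_measure (g := fun s => h (s, w)))//.
  - by rewrite /h; exact: (measurable_fun_pair1 w mnf).
  - by move=> s; exact: normr_ge0.
- move=> w _.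
  have iabs : lambda.-integrable `[0, t] (fun s : measurableTypeR R => `|f (s, w)|%:E).
    exact: integrable_abse (bounded_integrable 0 t w).
  rewrite -[leRHS]fineK ?integrable_fin_num// lee_fin.
  apply: le_normr_Rintegral => //; exact: bounded_integrable.
Qed.

End bounded_process.

End time_space.

(** * Simple processes on grids *)

Section grid.
Context {R : realType}.
Implicit Types (v : nat -> R) (N : nat) (x r s t : R).

Definition grid v N t :=
  [/\ v 0%N = 0, v N = t & forall j, (j < N)%N -> v j <= v j.+1].

(** [x] is not interior to a cell: a simple process with such jump times is
    constant in time on every cell. *)
Definition splits v N x := forall j, (j < N)%N -> x <= v j \/ v j.+1 <= x.

Lemma grid_mono v N t i j : grid v N t -> (i <= j)%N -> (j <= N)%N -> v i <= v j.
Proof.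
move=> [_ _ vS]; elim: j => [|j IH]; first by rewrite leqn0 => /eqP->.
rewrite leq_eqVlt => /predU1P[->//|]; rewrite ltnS => ij jN.
exact: le_trans (IH ij (ltnW jN)) (vS _ jN).
Qed.

Lemma grid_ge0 v N t j : grid v N t -> (j <= N)%N -> 0 <= v j.
Proof. by move=> g jN; case: (g) => <- _ _; exact: grid_mono g _ jN. Qed.

Lemma grid_le v N t j : grid v N t -> (j <= N)%N -> v j <= t.
Proof. by move=> g jN; case: (g) => _ <- _; exact: grid_mono g jN _. Qed.

(** Inside a cell, whether a time has passed [x] is already decided at the left end. *)
Lemma splits_lt v N x j s : splits v N x -> (j < N)%N -> v j < s <= v j.+1 ->
  (x < s) = (x <= v j).
Proof.
move=> vx jN /andP[js sj]; apply/idP/idP => [xs|xj]; last exact: le_lt_trans js.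
case: (vx _ jN) => // jx; have := lt_le_trans xs (le_trans sj jx).
by rewrite ltxx.
Qed.

Lemma grid_cell v N t s : grid v N t -> 0 < s <= t ->
  exists2 j, (j < N)%N & v j < s <= v j.+1.
Proof.
move=> [v0 vN _] /andP[s0 st].
suff : forall n, s <= v n -> exists2 j, (j < n)%N & v j < s <= v j.+1 by apply; rewrite vN.
elim=> [|n IH sn]; first by rewrite v0 leNgt s0.
have [/IH[j jn jsj]|ns] := leP s (v n); first by exists j => //; exact: ltnW.
by exists n => //; rewrite ns.
Qed.

Lemma grid_cell_eq v N t s i j : grid v N t -> (i < N)%N -> (j < N)%N ->
  v i < s <= v i.+1 -> v j < s <= v j.+1 -> i = j.
Proof.
move=> g iN jN /andP[i1 i2] /andP[j1 j2]; case: (ltngtP i j) => // ij; exfalso.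
- have := grid_mono g ij (ltnW jN); have := lt_le_trans j1 i2; lra.
- have := grid_mono g ij (ltnW iN); have := lt_le_trans i1 j2; lra.
Qed.

(** The grid consists of 0, [t], the points of [xs] and the multiples of [delta], restricted to
    [[0, t]] and sorted. A point outside [[0, t]] lies on one side of every cell, so it splits the
    grid trivially. *)
Lemma exists_grid t (xs : seq R) (delta : R) : 0 <= t -> 0 < delta ->
  exists v N, [/\ grid v N t, (forall j, (j < N)%N -> v j.+1 - v j <= delta) &
    forall x, x \in xs -> splits v N x].
Proof.
move=> t0 delta0.
have [K tK] : exists K : nat, t < K%:R * delta.
  exists (Num.truncn (t / delta)).+1; rewrite -ltr_pdivrMr//.
  exact: truncnS_gt.
pose ys := [seq i%:R * delta | i <- iota 0 K.+1].
pose l := sort <=%R [seq x <- 0 :: t :: (xs ++ ys) | 0 <= x <= t].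
have lS : sorted <=%R l by apply: sort_sorted; exact: le_total.
have memlP x : (x \in l) = (0 <= x <= t) && (x \in 0 :: t :: (xs ++ ys)).
  by rewrite mem_sort mem_filter.
have l0 : 0 \in l by rewrite memlP lexx t0 mem_head.
have lt : t \in l by rewrite memlP lexx t0 !inE eqxx orbT.
have sl : (0 < size l)%N by case: (l) l0.
pose v j := nth t l j; pose N := (size l).-1.
have vl j : (j <= N)%N -> v j \in l by move=> jN; rewrite mem_nth// -(prednK sl) ltnS.
have vmono i j : (i <= j)%N -> (j <= N)%N -> v i <= v j.
  move=> ij jN; have jl : (j < size l)%N by rewrite -(prednK sl) ltnS.
  apply: (sorted_leq_nth le_trans le_refl _ lS) => //; rewrite inE//.
  exact: leq_ltn_trans ij jl.
have splitl x : x \in l -> splits v N x.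
  move=> xl j jN; have [xj|jx] := leqP (index x l) j.
    by left; rewrite -(nth_index t xl); apply: vmono => //; exact: ltnW.
  right; rewrite -(nth_index t xl); apply: vmono => //.
  by rewrite -ltnS (prednK sl) index_mem.
have vt j : (j <= N)%N -> 0 <= v j <= t by move=> /vl; rewrite memlP => /andP[].
have g : grid v N t.
  split; last by move=> j jN; exact: vmono.
  - apply/eqP; rewrite eq_le; case/andP: (vt _ (leq0n N)) => -> _; rewrite andbT.
    by rewrite -[leRHS](nth_index t l0); apply: vmono => //; rewrite -ltnS (prednK sl) index_mem.
  - apply/eqP; rewrite eq_le; case/andP: (vt _ (leqnn N)) => _ -> /=.
    by rewrite -[leLHS](nth_index t lt); apply: vmono => //; rewrite -ltnS (prednK sl) index_mem.
have splitall x : x \in xs ++ ys -> splits v N x.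
  move=> xin; have [x0|x0] := ltP x 0.
    by move=> j jN; left; rewrite (le_trans (ltW x0))//; case/andP: (vt _ (ltnW jN)).
  have [tx|xt] := ltP t x.
    by move=> j jN; right; rewrite (le_trans _ (ltW tx))//; case/andP: (vt _ jN).
  by apply: splitl; rewrite memlP x0 xt !inE xin !orbT.
exists v, N; split => // [j jN|x xin]; last by apply: splitall; rewrite mem_cat xin.
(* Take the least multiple of [delta] beyond [v j]. The preceding multiple is at most [v j], and the
   multiple itself is not interior to the cell, so it is at least [v j.+1]. *)
have ex : exists i, v j < i%:R * delta.
  by exists K; rewrite (le_lt_trans _ tK)//; case/andP: (vt _ (ltnW jN)).
case: (ex_minnP ex) => -[|i] vi imin.
  by move: vi; rewrite mul0r ltNge; case/andP: (vt _ (ltnW jN)) => ->.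
have iK : (i.+1 <= K)%N.
  by apply: imin; rewrite (le_lt_trans _ tK)//; case/andP: (vt _ (ltnW jN)).
have vi' : i%:R * delta <= v j by rewrite leNgt; apply/negP => /imin; rewrite ltnn.
have : i.+1%:R * delta \in xs ++ ys.
  rewrite mem_cat; apply/orP; right; apply/mapP; exists i.+1 => //.
  by rewrite mem_iota add0n ltnS.
move=> /splitall/(_ j jN)[|h]; first by rewrite leNgt vi.
move: h; rewrite -natr1 mulrDl mul1r; lra.
Qed.

End grid.

Section simple_process_grid.
Context {R : realType} {d : measure_display} {Omega : measurableType d}.
Context {P : probability Omega R}.
Variables (B : R -> {RV P >-> R}) (Z : {RV P >-> R}).
Local Notation F := (filtration_of Z B).
Implicit Types (h : simple_process F) (v : nat -> R).

(** The value just after time [r]: compared with [sp_eval], the strict and the weak inequality are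
    exchanged. On a cell without interior jump times the process equals this value at the left end,
    and the value is already known at that time. *)
Definition left_value h (r : R) (w : Omega) : R :=
  \sum_(i < sp_size h)
    (if sp_time h i <= r < sp_time h i.+1 then sp_val h i w else 0).

Definition sp_times h : seq R := [seq sp_time h i | i <- iota 0 (sp_size h).+1].

Lemma mem_sp_times h i : (i <= sp_size h)%N -> sp_time h i \in sp_times h.
Proof. by move=> ih; apply/mapP; exists i => //; rewrite mem_iota add0n ltnS. Qed.

Lemma left_value_measurable_wrt h r : measurable_wrt (T' := R) (F r) (left_value h r).
Proof.
apply: measurable_wrt_sum => i _.
case: (boolP (sp_time h i <= r < sp_time h i.+1)) => [/andP[ir _]|_].
  by apply: (measurable_wrt_filtrationW ir); exact: sp_adapted.
exact: measurable_wrt_cst.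
Qed.

Lemma sp_val_bounded h : exists2 C : R, 0 <= C &
  forall i w, (i < sp_size h)%N -> `|sp_val h i w| <= C.
Proof.
suff : forall n, (n <= sp_size h)%N -> exists2 C : R, 0 <= C &
    forall i w, (i < n)%N -> `|sp_val h i w| <= C by exact.
elim=> [_|n IH nh]; first by exists 0.
have [C C0 HC] := IH (ltnW nh).
have [C' HC'] := sp_bounded nh.
exists (Num.max C C') => [|i w]; first by rewrite le_max C0.
rewrite ltnS leq_eqVlt => /predU1P[->|/HC iC]; first by rewrite le_max HC' orbT.
by rewrite le_max iC.
Qed.

Lemma left_value_bounded h : exists2 C : R, 0 <= C &
  forall r w, `|left_value h r w| <= C.
Proof.
have [C C0 HC] := sp_val_bounded h.
exists ((sp_size h)%:R * C) => [|r w]; first by rewrite mulr_ge0.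
apply: le_trans (ler_norm_sum _ _ _) _.
rewrite -[in leRHS](card_ord (sp_size h)) mulr_natl -sumr_const.
by apply: ler_sum => i _; case: ifPn => _; [exact: HC|rewrite normr0].
Qed.

Lemma sp_val_measurable h i : (i < sp_size h)%N -> measurable_fun setT (sp_val h i).
Proof. by move=> ih; exact: measurable_wrt_measurable_fun (sp_adapted ih). Qed.

Lemma sp_eval_measurable h :
  measurable_fun setT (fun p : measurableTypeR R * Omega => sp_eval h p.1 p.2).
Proof.
rewrite /sp_eval; apply: measurable_sum => i.
pose A : set (measurableTypeR R) := `]sp_time h i, sp_time h i.+1]%classic.
have mA : measurable_fun setT (\1_A : measurableTypeR R -> R).
  by apply: measurable_indic; exact: measurable_itv.
rewrite (_ : (fun _ => _) = fun p : measurableTypeR R * Omega => \1_A p.1 * sp_val h i p.2).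
  apply: measurable_funM.
    exact: measurableT_comp mA measurable_fst.
  by apply: measurableT_comp => //; exact: sp_val_measurable.
apply/funext => p; rewrite indicE; have [pA|pA] := boolP (p.1 \in A).
  by move: pA; rewrite inE /A/= in_itv/= => ->; rewrite mul1r.
case: ifPn => [pA'|]; last by rewrite mul0r.
by move: pA; rewrite notin_setE /A/= in_itv/= pA'.
Qed.

Section on_grid.
Variables (v : nat -> R) (N : nat) (t : R) (h : simple_process F).
Hypothesis gv : grid v N t.
Hypothesis hv : forall x, x \in sp_times h -> splits v N x.

Let tv i : (i <= sp_size h)%N -> splits v N (sp_time h i).
Proof. by move=> ih; apply/hv/mem_sp_times. Qed.

Lemma sp_eval_grid j s w : (j < N)%N -> v j < s <= v j.+1 ->
  sp_eval h s w = left_value h (v j) w.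
Proof.
move=> jN sj; apply: eq_bigr => i _.
rewrite (splits_lt (tv (ltnW (ltn_ord i))) jN sj).
by rewrite (leNgt s) (splits_lt (tv (ltn_ord i)) jN sj) -ltNge.
Qed.

Let telescope_split x (l : nat) (f : R -> R) : splits v N x -> 0 <= x -> (l <= N)%N ->
  f (Num.min x (v l)) - f 0 =
  \sum_(j < l) (if v j < x then f (v j.+1) - f (v j) else 0).
Proof.
case: gv => v0 vN vS vx x0; elim: l => [_|l IH lN].
  by rewrite big_ord0 v0 min_r// subrr.
rewrite big_ord_recr/= -IH ?(ltnW lN)//.
have vl := vS _ lN.
case: ifPn => [lx|]; last first.
  by rewrite -leNgt => xl; rewrite !min_l ?addr0// (le_trans xl).
case: (vx _ lN) => [|lx']; first by rewrite leNgt lx.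
rewrite !min_r ?(ltW lx)//; ring.
Qed.

(** An increment of [B] between two jump times stopped at [v l] telescopes over the cells in
    between; exchanging the two sums collects on each cell the value of [h] there. *)
Lemma sp_integral_grid l w : (l <= N)%N ->
  sp_integral B h (v l) w =
  \sum_(j < l) left_value h (v j) w * (B (v j.+1) w - B (v j) w).
Proof.
move=> lN; rewrite /sp_integral /left_value.
under [RHS]eq_bigr do rewrite mulr_suml.
rewrite exchange_big/=; apply: eq_bigr => i _.
have t0 k : (k <= sp_size h)%N -> 0 <= sp_time h k.
  elim: k => [_|k IH kh]; first exact: sp_time0.
  exact: le_trans (IH (ltnW kh)) (sp_time_mono kh).
have iS : (i < sp_size h)%N := ltn_ord i.
have := @telescope_split _ l (B^~ w) (tv iS) (t0 _ iS) lN.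
have := @telescope_split _ l (B^~ w) (tv (ltnW iS)) (t0 _ (ltnW iS)) lN.
move=> e1 e2.
have -> : B (Num.min (sp_time h i.+1) (v l)) w - B (Num.min (sp_time h i) (v l)) w =
   (B (Num.min (sp_time h i.+1) (v l)) w - B 0 w) -
   (B (Num.min (sp_time h i) (v l)) w - B 0 w) by ring.
rewrite e1 e2 -sumrB mulr_sumr; apply: eq_bigr => j _.
have ti := sp_time_mono iS.
have [jt|jt] := ltP (v j) (sp_time h i).
  by rewrite (lt_le_trans jt ti) subrr mulr0/= mul0r.
by case: ifPn => _; rewrite ?subr0 ?mulr0 ?mul0r.
Qed.

End on_grid.

Section grid_simple.
Variables (v : nat -> R) (N : nat) (t : R) (G : nat -> Omega -> R).
Hypothesis gv : grid v N t.
Hypothesis GF : forall j, (j < N)%N -> measurable_wrt (T' := R) (F (v j)) (G j).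
Hypothesis GC : forall j, (j < N)%N -> exists C : R, forall w, `|G j w| <= C.

Let v0 : 0 <= v 0%N. Proof. exact: grid_ge0 gv _. Qed.

Let vS j : (j < N)%N -> v j <= v j.+1. Proof. by case: gv => _ _; exact. Qed.

Definition grid_simple : simple_process F := SimpleProcess v0 vS GF GC.

Lemma sp_eval_grid_simple j s w : (j < N)%N -> v j < s <= v j.+1 ->
  sp_eval grid_simple s w = G j w.
Proof.
move=> jN sj; rewrite /sp_eval /= (bigD1 (Ordinal jN))//= sj big1 ?addr0// => i ij.
case: ifPn => // si; move/eqP: ij; case; apply/val_inj => /=.
exact: grid_cell_eq gv _ jN si sj.
Qed.

Lemma sp_integral_grid_simple w :
  sp_integral B grid_simple t w = \sum_(j < N) G j w * (B (v j.+1) w - B (v j) w).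
Proof.
apply: eq_bigr => i _ /=.
by rewrite !min_l//; apply: (grid_le gv) => //; exact: ltnW.
Qed.

End grid_simple.

End simple_process_grid.

(** * Step processes and the isometry in time and space *)

Section step_process.
Context {R : realType} {d : measure_display} {Omega : measurableType d}.
Variables (P : probability Omega R) (v : nat -> R) (N : nat) (t : R).
Hypotheses (t0 : 0 <= t) (gv : grid v N t).
Local Notation M := (time_space_measure P t).
Local Notation lambda := (@lebesgue_measure R).

(** The same sum as [sp_eval], but for arbitrary cell values: those of the solution, [X (v k)],
    carry no uniform bound. *)
Definition step (G : nat -> Omega -> R) (p : measurableTypeR R * Omega) : R :=
  \sum_(j < N) (if v j < p.1 <= v j.+1 then G j p.2 else 0).

Lemma step_cell G j s w : (j < N)%N -> v j < s <= v j.+1 -> step G (s, w) = G j w.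
Proof.
move=> jN sj; rewrite /step (bigD1 (Ordinal jN))//= sj big1 ?addr0// => i ij.
case: ifPn => // si; move/eqP: ij; case; apply/val_inj => /=.
exact: grid_cell_eq gv _ jN si sj.
Qed.

Let cell j : set (measurableTypeR R) := `]v j, v j.+1]%classic.

Let stepE G p : step G p = \sum_(j < N) (\1_(cell j) p.1 * G j p.2).
Proof.
apply: eq_bigr => j _; rewrite indicE; case: ifPn => h.
  by rewrite mem_set ?mul1r// /cell/= in_itv.
by rewrite memNset ?mul0r// /cell/= in_itv/=; exact/negP.
Qed.

Let mcell j : measurable_fun setT (\1_(cell j) : measurableTypeR R -> R).
Proof. by apply: measurable_indic; exact: measurable_itv. Qed.

Lemma measurable_step (G : nat -> Omega -> R) : (forall j, (j < N)%N -> measurable_fun setT (G j)) ->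
  measurable_fun setT (step G).
Proof.
move=> mG; rewrite (funext (stepE G)); apply: measurable_sum => j.
apply: measurable_funM; first exact: measurableT_comp (mcell j) measurable_fst.
by apply: measurableT_comp => //; exact: mG.
Qed.

Lemma step_le G C : 0 <= C -> (forall j w, (j < N)%N -> `|G j w| <= C) ->
  forall p, `|step G p| <= C.
Proof.
move=> C0 GC [s w]; have [/grid_cell|h] := boolP (0 < s <= t).
  by move=> /(_ _ _ gv)[j jN sj]; rewrite (step_cell _ _ jN sj) GC.
rewrite /step big1 ?normr0// => j _; case: ifPn => //= /andP[js sj].
move: h; rewrite (le_lt_trans (grid_ge0 gv (ltnW (ltn_ord j))) js)/=.
by rewrite (le_trans sj)// (grid_le gv).
Qed.

Lemma integral_step (G : nat -> Omega -> R) : (forall j, (j < N)%N -> measurable_fun setT (G j)) ->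
  (forall j w, (j < N)%N -> 0 <= G j w) ->
  (\int[M]_p (step G p)%:E = \sum_(j < N) (v j.+1 - v j)%:E * \int[P]_w (G j w)%:E)%E.
Proof.
move=> mG G0.
have s0 p : 0 <= step G p by apply: sumr_ge0 => j _; case: ifP => // _; exact: G0.
rewrite integral_time_space//; last exact: measurable_step.
transitivity (\int[P]_w \sum_(j < N) ((v j.+1 - v j)%:E * (G j w)%:E))%E.
  apply: eq_integral => w _.
  under eq_integral do rewrite stepE -sumEFin.
  rewrite ge0_integral_sum//.
  - apply: eq_bigr => j _ /=; under eq_integral do rewrite EFinM muleC.
    rewrite ge0_integralZl_EFin//; last exact: G0.
      rewrite integral_indic//; last exact: measurable_itv.
      rewrite muleC; congr (_ * _)%E.
      rewrite (_ : _ `&` _ = cell j); last first.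
        apply/setIidl => s; rewrite /cell/= !in_itv/= => /andP[js sj].
        rewrite (le_trans (grid_ge0 gv (ltnW (ltn_ord j))) (ltW js))/=.
        by rewrite (le_trans sj)// (grid_le gv).
      transitivity (lambda `]v j, v j.+1]) => //.
      rewrite lebesgue_measure_itv/= lte_fin; case: ifPn => // h.
      have := grid_mono gv (leqnSn j) (ltn_ord j); rewrite le_eqVlt (negbTE h) orbF => /eqP->.
      by rewrite subrr.
    by apply/measurable_EFinP; apply: measurable_funTS; exact: mcell.
  - move=> j; apply/measurable_EFinP; apply: measurable_funM.
      by apply: measurable_funTS; exact: mcell.
    exact: (measurable_cst (G j w)).
  - by move=> j s _; rewrite lee_fin mulr_ge0//; exact: G0.
rewrite ge0_integral_sum//.
- apply: eq_bigr => j _; rewrite ge0_integralZl_EFin//.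
  + by move=> w _; rewrite lee_fin; exact: G0.
  + by apply/measurable_EFinP; exact: mG.
  + by rewrite subr_ge0 (grid_mono gv).
- by move=> j; apply/measurable_EFinP; apply: measurable_funM => //; exact: mG.
- move=> j w _; rewrite mule_ge0 ?lee_fin ?subr_ge0//; last exact: G0.
  by rewrite (grid_mono gv).
Qed.

(** A bound on an integral over time and space is converted into bounds cell by cell, in the form
    the discrete isometry asks for; [b j] is the mean of [G j]. *)
Lemma step_bound (G : nat -> Omega -> R) (f : measurableTypeR R * Omega -> R) a :
  (forall j, (j < N)%N -> measurable_fun setT (G j)) ->
  (forall j w, (j < N)%N -> 0 <= G j w) ->
  (forall j, (j < N)%N -> exists C : R, forall w, `|G j w| <= C) ->
  (forall j s w, (j < N)%N -> v j < s <= v j.+1 -> G j w <= f (s, w)) ->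
  integral_bound M f a ->
  exists b : nat -> R, (forall j, (j < N)%N -> integral_bound P (G j) (b j)) /\
    \sum_(j < N) (v j.+1 - v j) * b j <= a.
Proof.
move=> mG G0 GC Gf fa.
have fin j : (j < N)%N -> (\int[P]_w (G j w)%:E)%E \is a fin_num.
  move=> jN; have [C HC] := GC _ jN; apply: integrable_fin_num => //.
  apply: (integral_bound_integrable (mG _ jN) HC).
  exact: integral_bound_cst (le_trans (normr_ge0 _) (HC point)).
exists (fun j => fine (\int[P]_w (G j w)%:E)%E); split => [j jN|].
  by split; [exact: mG|move=> w; exact: G0|rewrite fineK// fin].
have : integral_bound M (step G) a.
  apply: (integral_bound_le_time_space _ _ _ fa) => //.
  - exact: measurable_step.
  - by move=> p; apply: sumr_ge0 => j _; case: ifP => // _; exact: G0.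
  - move=> [s w] /= /(grid_cell gv)[j jN sj].
    by rewrite (step_cell _ _ jN sj); exact: Gf.
case=> _ _; rewrite integral_step// => h; rewrite -lee_fin; apply: le_trans h.
rewrite -sumEFin; apply: lee_sum => j _.
by rewrite EFinM fineK// fin.
Qed.

Variables (B : R -> {RV P >-> R}) (Z : {RV P >-> R}).
Local Notation F := (filtration_of Z B).
Hypothesis BM : brownian_motion B.
Hypothesis ZB : independent P (sigma_rv Z) (sigma_process `[0, +oo[ B).

Lemma integral_bound_increment_sum_time_space (G : nat -> Omega -> R)
    (f : measurableTypeR R * Omega -> R) a :
  (forall j, (j < N)%N -> measurable_wrt (T' := R) (F (v j)) (G j)) ->
  (forall j, (j < N)%N -> exists C : R, forall w, `|G j w| <= C) ->
  (forall j s w, (j < N)%N -> v j < s <= v j.+1 -> G j w ^+ 2 <= f (s, w)) ->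
  integral_bound M f a ->
  integral_bound P (fun w => (\sum_(j < N) G j w * (B (v j.+1) w - B (v j) w)) ^+ 2) a.
Proof.
move=> GF GC Gf fa.
have [||||b [Gb ba]] := @step_bound (fun j w => G j w ^+ 2) f a _ _ _ _ fa.
- move=> j jN; apply: measurable_funX; exact: measurable_wrt_measurable_fun (GF _ jN).
- by move=> j w _; exact: sqr_ge0.
- move=> j jN; have [C HC] := GC _ jN; exists (C ^+ 2) => w.
  by rewrite normrX lerXn2r// ?nnegrE// (le_trans _ (HC w)).
- exact: Gf.
apply: integral_boundW ba; apply: (integral_bound_increment_sum BM ZB) => //.
- by case: gv => ->.
- by case: gv.
Qed.

End step_process.

Lemma integral_bound_lim d (T : measurableType d) (R : realType)
    (m : {measure set T -> \bar R}) (f : T -> R) a :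
  (forall e, 0 < e -> integral_bound m f (a + e)) -> integral_bound m f a.
Proof.
move=> H; have [mf f0 _] := H _ ltr01; split => //.
apply/lee_addgt0Pr => e e0; have [_ _] := H _ e0; by rewrite EFinD.
Qed.

Lemma integral_bound_fin_sum d (T : measurableType d) (R : realType)
    (m : {measure set T -> \bar R}) (N : nat) (f : nat -> T -> R) (a : nat -> R) :
  (forall j, (j < N)%N -> integral_bound m (f j) (a j)) ->
  integral_bound m (fun x => \sum_(j < N) f j x) (\sum_(j < N) a j).
Proof.
move=> H; have := @integral_bound_sum _ T R m 'I_N (index_enum 'I_N) (fun j => f j)
  (fun j => a j) (fun j => H j (ltn_ord j)).
exact.
Qed.

Lemma lebesgue_measure_itvoc (R : realType) (u s : R) : u <= s ->
  (@lebesgue_measure R) `]u, s]%classic = (s - u)%:E.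
Proof.
move=> us; rewrite lebesgue_measure_itv/= lte_fin; case: ifPn => // h.
by move: us; rewrite le_eqVlt (negbTE h) orbF => /eqP->; rewrite subrr.
Qed.

(** * Elementary inequalities and sums over grids *)

Section grid_sums.
Context {R : realType}.
Implicit Types (v : nat -> R) (N : nat) (x r s t : R).

Lemma grid_mem v N t x : grid v N t -> splits v N x -> 0 <= x <= t ->
  exists2 l, (l <= N)%N & v l = x.
Proof.
move=> gv vx /andP[]; rewrite le_eqVlt => /predU1P[<- _|x0 xt].
  by exists 0%N => //; case: gv.
have [|j jN /andP[jx xj]] := grid_cell gv (s := x); first by rewrite x0.
exists j.+1 => //; apply/eqP; rewrite eq_le xj andbT.
by case: (vx _ jN) => //; rewrite leNgt jx.
Qed.

Lemma grid_sum_cell_le v N t r (psi : nat -> R) (K : R) : grid v N t -> 0 <= K ->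
  (forall k, (k < N)%N -> `|psi k| <= K) ->
  `|\sum_(k < N) (if v k <= r < v k.+1 then psi k else 0)| <= K.
Proof.
move=> gv K0 psiK.
have [[k kr]|nk] := pselect (exists k : 'I_N, v k <= r < v k.+1); last first.
  by rewrite big1 ?normr0// => k _; case: ifPn => // kr; case: nk; exists k.
rewrite (bigD1 k)//= kr big1 ?addr0 ?psiK// => i ik.
case: ifPn => // /andP[ir ri]; exfalso; move/andP: kr => [kr rk].
case: (ltngtP i k) => [ltik|ltki|/val_inj eik]; last by rewrite eik eqxx in ik.
- by have := lt_le_trans ri (le_trans (grid_mono gv ltik (ltnW (ltn_ord k))) kr); rewrite ltxx.
- by have := lt_le_trans rk (le_trans (grid_mono gv ltki (ltnW (ltn_ord i))) ir); rewrite ltxx.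
Qed.

(** The Cauchy-Schwarz inequality against the constant 1. *)
Lemma sqr_sum_le N (r : nat -> R) :
  (\sum_(k < N) r k) ^+ 2 <= N%:R * \sum_(k < N) r k ^+ 2.
Proof.
elim: N => [|N IH]; first by rewrite !big_ord0 expr0n mulr0.
rewrite !big_ord_recr/= -natr1.
set S := \sum_(k < N) r k in IH *; set Q := \sum_(k < N) r k ^+ 2 in IH *.
have [N0|N0] := leqP N 0.
  have S0 : S = 0 by rewrite /S; move: N0; rewrite leqn0 => /eqP->; rewrite big_ord0.
  have Q0 : Q = 0 by rewrite /Q; move: N0; rewrite leqn0 => /eqP->; rewrite big_ord0.
  by rewrite S0 Q0; move: N0; rewrite leqn0 => /eqP->; rewrite !add0r mul1r.
have n0 : 0 < N%:R :> R by rewrite ltr0n.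
have := sqr_ge0 (S - N%:R * r N); rewrite sqrrB => h.
rewrite -(ler_pM2l n0); nra.
Qed.

(** A form of Young's inequality that replaces the Cauchy-Schwarz inequality for integrals: if the
    integral of [y ^ 2] is of order [e ^ 2], then that of the right-hand side over a finite measure
    is of order [e]. *)
Lemma normr_le_sqr (e y : R) : 0 < e -> `|y| <= e + e^-1 * y ^+ 2.
Proof.
move=> e0; rewrite -(ler_pM2l e0) mulrDr mulrA mulfV ?gt_eqF// mul1r.
rewrite -(real_normK (num_real y)); have := sqr_ge0 (e - `|y|).
have := normr_ge0 y; set z := `|y|; nra.
Qed.

Lemma sum_sqr_mesh_le N (dv : nat -> R) (c A delta t eta : R) : 0 <= c -> 0 <= A ->
  0 <= t -> \sum_(j < N) dv j ^+ 2 <= delta * t -> A * delta <= eta ->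
  \sum_(j < N) c * dv j ^+ 2 * A <= c * t * eta.
Proof.
move=> c0 A0 t0; rewrite -mulr_suml -mulr_sumr.
move: (\sum_(j < N) dv j ^+ 2) => S St Aeta.
have h1 := ler_wpM2l A0 St; have h2 := ler_wpM2r t0 Aeta.
rewrite -mulrA in h2; have := ler_wpM2l c0 (le_trans h1 h2).
by rewrite (mulrC eta) (mulrC A) !mulrA.
Qed.

(** The bookkeeping for the Taylor remainders: [S1] bounds the sum of the second moments of the
    Brownian parts, [S4] that of their fourth moments, and the last term that of the squares of the
    rest. The latter two are of order [e ^ 2], which absorbs the factor [e^-1]. *)
Lemma ito_taylor_arith (e t C delta S1 S4 : R) : 0 < e -> e <= 1 -> 0 <= t ->
  delta <= e ^+ 2 -> S1 <= 2 * C ^+ 2 * t + 2 * e ^+ 2 -> S4 <= 29 * t * e ^+ 2 ->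
  e * S1 + e^-1 * S4 + e^-1 * (2 * C ^+ 2 * (delta * t) + 2 * (10 * e ^+ 2)) <=
  (4 * C ^+ 2 * t + 29 * t + 22) * e.
Proof.
move=> e0 e1 t0 de hS1 hS4.
have c0 := sqr_ge0 C; set c := C ^+ 2 in c0 hS1 *.
have ei : e^-1 * e = 1 by rewrite mulVf// gt_eqF.
have ei0 : 0 < e^-1 by rewrite invr_gt0.
have e3 : e ^+ 2 <= e by rewrite expr2 ler_piMl// ltW.
have h1 : e * S1 <= (2 * c * t + 2) * e.
  rewrite [leRHS]mulrC ler_pM2l//; lra.
have h4 : e^-1 * S4 <= 29 * t * e.
  apply: le_trans (_ : e^-1 * (29 * t * e ^+ 2) <= _); first by rewrite ler_pM2l.
  by rewrite expr2 mulrCA (mulrA e^-1) ei mul1r.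
have hd : c * t * delta <= c * t * e ^+ 2 by rewrite ler_wpM2l// mulr_ge0.
have h5 : e^-1 * (2 * c * (delta * t) + 2 * (10 * e ^+ 2)) <= (2 * c * t + 20) * e.
  apply: le_trans (_ : e^-1 * ((2 * c * t + 20) * e ^+ 2) <= _).
    rewrite ler_pM2l//; lra.
  by rewrite expr2 mulrCA (mulrA e^-1) ei mul1r.
lra.
Qed.

End grid_sums.

Section sp_grid.
Context {R : realType} {d : measure_display} {Omega : measurableType d}.
Context {P : probability Omega R}.
Variables (B : R -> {RV P >-> R}) (Z : {RV P >-> R}).
Local Notation F := (filtration_of Z B).
Variables (v : nat -> R) (N : nat) (t : R) (h : simple_process F).
Hypothesis gv : grid v N t.
Hypothesis hv : forall x, x \in sp_times h -> splits v N x.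

Lemma sp_integral_splits s w : splits v N s -> 0 <= s <= t ->
  sp_integral B h s w = \sum_(j < N)
    (if v j < s then left_value h (v j) w else 0) * (B (v j.+1) w - B (v j) w).
Proof.
move=> vs st; have [l lN lE] := grid_mem gv vs st.
rewrite -lE (sp_integral_grid gv hv _ lN).
rewrite (big_ord_widen N (fun j => left_value h (v j) w * (B (v j.+1) w - B (v j) w)) lN).
rewrite big_mkcond; apply: eq_bigr => j _.
have [jl|lj] := ltnP j l; last first.
  by rewrite ltNge (grid_mono gv lj (ltnW (ltn_ord j))) mul0r.
case: ifPn => //; rewrite -leNgt => lj.
(* Grid points may repeat: here the cell before [v l] starts at [v l] already, so it is empty and
   contributes nothing. *)
suff -> : v j.+1 = v j by rewrite subrr !mulr0.
apply/eqP; rewrite eq_le (grid_mono gv (leqnSn j) (ltn_ord j)) andbT.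
exact: le_trans (grid_mono gv jl lN) lj.
Qed.

Lemma sp_integral_increment u s w : splits v N u -> splits v N s ->
  0 <= u -> u <= s -> s <= t ->
  sp_integral B h s w - sp_integral B h u w = \sum_(j < N)
    (if u <= v j < s then left_value h (v j) w else 0) * (B (v j.+1) w - B (v j) w).
Proof.
move=> vu vs u0 us st.
rewrite !sp_integral_splits ?u0 ?(le_trans us st) ?(le_trans u0 us)//.
rewrite -sumrB; apply: eq_bigr => j _; rewrite -mulrBl; congr (_ * _).
have [ju|uj] := ltP (v j) u; first by rewrite (lt_le_trans ju us) subrr.
by case: ifPn; rewrite subr0.
Qed.

End sp_grid.

(** * Ito's formula *)

Section ito.
Context {R : realType} {d : measure_display} {Omega : measurableType d}.
Variables (P : probability Omega R) (B : R -> {RV P >-> R}) (Z : {RV P >-> R}).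
Local Notation F := (filtration_of Z B).
Hypothesis BM : brownian_motion B.
Hypothesis ZB : independent P (sigma_rv Z) (sigma_process `[0, +oo[ B).
Variable t : R.
Hypothesis t0 : 0 <= t.
Local Notation M := (time_space_measure P t).
Local Notation lambda := (@lebesgue_measure R).

Lemma integral_bound_time_indic u s : 0 <= u -> u <= s -> s <= t ->
  integral_bound M (fun p => \1_(`]u, s]%classic : set (measurableTypeR R)) p.1) (s - u).
Proof.
move=> u0 us st.
have m1 : measurable_fun setT (\1_(`]u, s]%classic) : measurableTypeR R -> R).
  by apply: measurable_indic; exact: measurable_itv.
have mf : measurable_fun setT (fun p : measurableTypeR R * Omega => \1_(`]u, s]%classic : set (measurableTypeR R)) p.1 : R).
  exact: measurableT_comp m1 measurable_fst.
have f0 (p : measurableTypeR R * Omega) : 0 <= \1_(`]u, s]%classic : set (measurableTypeR R)) p.1 :> R by rewrite indicE.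
split => //; rewrite integral_time_space//.
rewrite (_ : (fun w => _) = fun=> (s - u)%:E).
  by rewrite integral_cst//= probability_setT mule1.
apply/funext => w /=; rewrite integral_indic//.
rewrite (_ : _ `&` _ = `]u, s]%classic); last first.
  apply/setIidl => r; rewrite /= !in_itv/= => /andP[ur rs].
  by rewrite (le_trans u0 (ltW ur)) (le_trans rs st).
exact: lebesgue_measure_itvoc.
Qed.

Variables (X : R -> Omega -> R) (beta gamma : measurableTypeR R * Omega -> R).
Variables (hm : nat -> simple_process F) (C : R).
Hypotheses (mb : measurable_fun setT beta) (mg : measurable_fun setT gamma).
Hypotheses (bC : forall p, `|beta p| <= C) (gC : forall p, `|gamma p| <= C).
Hypothesis XF : forall s, 0 <= s <= t -> measurable_wrt (T' := R) (F s) (X s).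

(** The martingale part of [X]. It is known only through [HY], as the limit of the integrals of the
    simple processes [hm] that approximate [gamma]. *)
Let Y s w : R := X s w - X 0 w - time_integral s beta w.

Hypothesis Hgamma : forall e, 0 < e -> exists n0, forall n, (n0 <= n)%N ->
  integral_bound M (fun p => (gamma p - sp_eval (hm n) p.1 p.2) ^+ 2) e.
Hypothesis HY : forall s, 0 <= s <= t -> forall e, 0 < e ->
  exists n0, forall n, (n0 <= n)%N ->
  integral_bound P (fun w => (Y s w - sp_integral B (hm n) s w) ^+ 2) e.

Let C0 : 0 <= C. Proof. exact: le_trans (bC (0, point)). Qed.

(** [HY] is not uniform in time, but a grid has finitely many points, so one index serves all of
    them. *)
Let approx_on_grid (v : nat -> R) (N : nat) e : grid v N t -> 0 < e ->
  exists n, integral_bound M (fun p => (gamma p - sp_eval (hm n) p.1 p.2) ^+ 2) e /\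
   forall k, (k <= N)%N ->
     integral_bound P (fun w => (Y (v k) w - sp_integral B (hm n) (v k) w) ^+ 2) e.
Proof.
move=> gv e0; have [n1 n1P] := Hgamma e0.
suff [n2 n2P] : exists n2, forall n, (n2 <= n)%N -> forall k, (k <= N)%N ->
    integral_bound P (fun w => (Y (v k) w - sp_integral B (hm n) (v k) w) ^+ 2) e.
  exists (maxn n1 n2); split; first by apply: n1P; exact: leq_maxl.
  by apply: n2P; exact: leq_maxr.
suff : forall K, (K <= N)%N -> exists n2, forall n, (n2 <= n)%N -> forall k, (k <= K)%N ->
    integral_bound P (fun w => (Y (v k) w - sp_integral B (hm n) (v k) w) ^+ 2) e.
  exact.
have vt k : (k <= N)%N -> 0 <= v k <= t.
  by move=> kN; rewrite (grid_ge0 gv kN) (grid_le gv kN).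
elim=> [_|K IH KN].
  have [n2 n2P] := HY (vt _ (leq0n _)) e0.
  by exists n2 => n n2n k; rewrite leqn0 => /eqP->; exact: n2P.
have [n2 n2P] := IH (ltnW KN); have [n3 n3P] := HY (vt _ KN) e0.
exists (maxn n2 n3) => n; rewrite geq_max => /andP[n2n n3n] k.
by rewrite leq_eqVlt => /predU1P[->|]; [exact: n3P|exact: n2P].
Qed.

Let mX s : 0 <= s <= t -> measurable_fun setT (X s).
Proof. by move=> st; exact: measurable_wrt_measurable_fun (XF st). Qed.

Let mY s : 0 <= s <= t -> measurable_fun setT (Y s).
Proof.
move=> /andP[s0 st]; apply: measurable_funB; last exact: measurable_time_integral bC.
by apply: measurable_funB; apply: mX; rewrite ?lexx ?s0.
Qed.

(** The isometry for [hm n], whose square is at most [2 gamma ^ 2 + 2 (gamma - hm n) ^ 2], gives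
    [2 C ^ 2 (s - u)] up to the error; splitting the increment of [Y] into three terms costs another
    factor 3. The errors add up to [3 (2 + 1 + 1) e / 12 = e]. *)
Let Y_increment u s : 0 <= u -> u <= s -> s <= t ->
  integral_bound P (fun w => (Y s w - Y u w) ^+ 2) (6 * C ^+ 2 * (s - u)).
Proof.
move=> u0 us st; apply: integral_bound_lim => e e0.
have e0' : 0 < e / 12 by rewrite divr_gt0.
have s0 := le_trans u0 us; have ut := le_trans us st.
have [n1 n1P] := HY (s := s) (e := e / 12) ltac:(by rewrite s0) e0'.
have [n2 n2P] := HY (s := u) (e := e / 12) ltac:(by rewrite u0) e0'.
have [n3 n3P] := Hgamma e0'.
pose n := maxn (maxn n1 n2) n3.
have {n1P} b1 : integral_bound P (fun w => (Y s w - sp_integral B (hm n) s w) ^+ 2) (e / 12).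
  by apply: n1P; rewrite !leq_max leqnn.
have {n2P} b2 : integral_bound P (fun w => (Y u w - sp_integral B (hm n) u w) ^+ 2) (e / 12).
  by apply: n2P; rewrite !leq_max leqnn !orbT.
have {n3P} b3 : integral_bound M (fun p => (gamma p - sp_eval (hm n) p.1 p.2) ^+ 2) (e / 12).
  by apply: n3P; rewrite leq_max leqnn orbT.
have [v [N [gv _ vx]]] := exists_grid (u :: s :: sp_times (hm n)) t0 ltr01.
have vu : splits v N u by apply: vx; rewrite inE eqxx.
have vs : splits v N s by apply: vx; rewrite !inE eqxx orbT.
have vh x : x \in sp_times (hm n) -> splits v N x by move=> xh; apply: vx; rewrite 2!in_cons xh !orbT.
pose G j w := if u <= v j < s then left_value (hm n) (v j) w else 0.
pose f (p : measurableTypeR R * Omega) :=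
  (2 * C ^+ 2) * (\1_(`]u, s]%classic : set (measurableTypeR R)) p.1) +
  2 * (gamma p - sp_eval (hm n) p.1 p.2) ^+ 2.
have bf : integral_bound M f (2 * C ^+ 2 * (s - u) + 2 * (e / 12)).
  apply: integral_boundD; apply: integral_boundZ => //.
    by rewrite mulr_ge0 ?sqr_ge0.
  exact: integral_bound_time_indic.
have bI : integral_bound P
    (fun w => (sp_integral B (hm n) s w - sp_integral B (hm n) u w) ^+ 2)
    (2 * C ^+ 2 * (s - u) + 2 * (e / 12)).
  apply: (@integral_bound_eq _ _ _ P (fun w => (\sum_(j < N) G j w * (B (v j.+1) w - B (v j) w)) ^+ 2)).
    by move=> w; rewrite (sp_integral_increment gv vh _ vu vs).
  apply: (integral_bound_increment_sum_time_space gv BM ZB (G := G) _ _ _ bf).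
  - move=> j jN; rewrite /G; case: (u <= v j < s); last exact: measurable_wrt_cst.
    exact: left_value_measurable_wrt.
  - move=> j jN; have [K K0 HK] := left_value_bounded (hm n); exists K => w.
    by rewrite /G; case: ifPn => _; rewrite ?normr0.
  - move=> j r w jN jr; rewrite /G /f /= -(sp_eval_grid vh w jN jr).
    have q0 := sqr_ge0 (gamma (r, w) - sp_eval (hm n) r w).
    have c0 := sqr_ge0 C.
    case: ifPn => [/andP[uj js]|_]; last first.
      by rewrite expr0n/= addr_ge0// mulr_ge0// ?mulr_ge0// indicE.
    rewrite indicE mem_set; last first.
      rewrite /= in_itv/=; case/andP: (jr) => jr1 _.
      by rewrite (le_lt_trans uj jr1)/= leNgt (splits_lt vs jN jr) -ltNge.
    have g2 : gamma (r, w) ^+ 2 <= C ^+ 2.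
      by rewrite -(real_normK (num_real (gamma _))) lerXn2r// ?nnegrE.
    have := sqr_ge0 (2 * gamma (r, w) - sp_eval (hm n) r w).
    rewrite /=; nra.
have b := integral_boundZ (ler0n _ 3) (integral_boundD bI (integral_boundD b1 b2)).
apply: (integral_bound_le _ _ b).
- by apply: measurable_funX; apply: measurable_funB; apply: mY; rewrite ?s0 ?u0.
- move=> w; rewrite sqr_ge0/=.
  set a1 := sp_integral _ _ s w; set a2 := sp_integral _ _ u w.
  have := sqr_ge0 ((Y s w - a1) - (a1 - a2)); have := sqr_ge0 ((Y s w - a1) + (Y u w - a2)).
  have := sqr_ge0 ((Y u w - a2) + (a1 - a2)).
  set y1 := Y s w; set y2 := Y u w; nra.
- lra.
Qed.

Section error.
Variables (v : nat -> R) (N : nat) (h : simple_process F) (eta K : R).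
Variable psi : nat -> Omega -> R.
Hypothesis gv : grid v N t.
Hypothesis hv : forall x, x \in sp_times h -> splits v N x.
Hypothesis eta0 : 0 < eta.
Hypothesis heta : integral_bound M (fun p => (gamma p - sp_eval h p.1 p.2) ^+ 2) eta.
Hypothesis psiF : forall k, (k < N)%N -> measurable_wrt (T' := R) (F (v k)) (psi k).
Hypothesis psiK : forall k w, (k < N)%N -> `|psi k w| <= K.
Hypothesis K0 : 0 <= K.

Let eps k w := Y (v k.+1) w - Y (v k) w -
  left_value h (v k) w * (B (v k.+1) w - B (v k) w).

(** The increments of [Y] are compared with those of the integral of a much
    better approximation [hm n], on a common refinement of the grid. *)
Lemma ito_error :
  integral_bound P (fun w => (\sum_(k < N) psi k w * eps k w) ^+ 2) (10 * K ^+ 2 * eta) /\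
  integral_bound P (fun w => \sum_(k < N) eps k w ^+ 2) (10 * eta).
Proof.
have N1 : 0 < N.+1%:R :> R by rewrite ltr0n.
(* The errors [r k] of the better approximation are not orthogonal and are summed by the
   Cauchy-Schwarz inequality, which costs [N ^ 2] times [4 e]; this choice keeps the total below
   [eta]. *)
pose e := eta / (4 * N.+1%:R ^+ 2).
have e0 : 0 < e by rewrite divr_gt0// mulr_gt0// exprn_gt0.
have [n [bM bY]] := approx_on_grid gv e0.
have [v' [N' [gv' _ vx]]] :=
  exists_grid (sp_times (hm n) ++ sp_times h ++ [seq v k | k <- iota 0 N.+1]) t0 ltr01.
have v'm x : x \in sp_times (hm n) -> splits v' N' x.
  by move=> xh; apply: vx; rewrite mem_cat xh.
have v'h x : x \in sp_times h -> splits v' N' x.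
  by move=> xh; apply: vx; rewrite !mem_cat xh orbT.
have v'v k : (k <= N)%N -> splits v' N' (v k).
  move=> kN; apply: vx; rewrite !mem_cat; apply/orP; right; apply/orP; right.
  by apply/mapP; exists k => //; rewrite mem_iota add0n ltnS.
have vS k : (k < N)%N -> v k <= v k.+1 by case: gv => _ _; exact.
have vt k : (k <= N)%N -> 0 <= v k <= t.
  by move=> kN; rewrite (grid_ge0 gv kN) (grid_le gv kN).
pose D j w := left_value (hm n) (v' j) w - left_value h (v' j) w.
pose dB' j w := B (v' j.+1) w - B (v' j) w.
(* [eps' k] is the integral of [hm n - h] over cell [k], and [r k] the error of [hm n] itself on
   that cell. *)
pose eps' k w := \sum_(j < N') (if v k <= v' j < v k.+1 then D j w else 0) * dB' j w.
pose r k w := (Y (v k.+1) w - Y (v k) w) -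
  (sp_integral B (hm n) (v k.+1) w - sp_integral B (hm n) (v k) w).
have epsE k w : (k < N)%N -> eps k w = eps' k w + r k w.
  move=> kN; have /andP[vk0 _] := vt _ (ltnW kN); have /andP[_ vkt] := vt _ kN.
  have E1 := sp_integral_increment gv' v'm w (v'v _ (ltnW kN)) (v'v _ kN) vk0 (vS _ kN) vkt.
  have E2 := sp_integral_increment gv' v'h w (v'v _ (ltnW kN)) (v'v _ kN) vk0 (vS _ kN) vkt.
  have E3 : sp_integral B h (v k.+1) w - sp_integral B h (v k) w =
      left_value h (v k) w * (B (v k.+1) w - B (v k) w).
    by rewrite !(sp_integral_grid gv hv) ?(ltnW kN)// big_ord_recr/= addrAC subrr add0r.
  rewrite /eps /r -E3 E1 E2 /eps'.
  have -> : \sum_(j < N') (if v k <= v' j < v k.+1 then D j w else 0) * dB' j w =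
      \sum_(j < N') (if v k <= v' j < v k.+1 then left_value (hm n) (v' j) w else 0) * dB' j w -
      \sum_(j < N') (if v k <= v' j < v k.+1 then left_value h (v' j) w else 0) * dB' j w.
    by rewrite -sumrB; apply: eq_bigr => j _; rewrite -mulrBl; case: ifP; rewrite ?subr0.
  rewrite /dB'; ring.
have mr k : (k < N)%N -> measurable_fun setT (r k).
  move=> kN; apply: measurable_funB; first by apply: measurable_funB; apply: mY; apply: vt => //; exact: ltnW.
  have mI l : (l <= N)%N -> measurable_fun setT (sp_integral B (hm n) (v l)).
    move=> lN; apply: measurable_sum => i; apply: measurable_funM; first exact: sp_val_measurable.
    exact: increment_measurable.
  by apply: measurable_funB; apply: mI => //; exact: ltnW.
have br k : (k < N)%N -> integral_bound P (fun w => r k w ^+ 2) (4 * e).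
  move=> kN; have b := integral_boundZ (ler0n _ 2) (integral_boundD (bY _ (ltnW kN)) (bY _ kN)).
  apply: (integral_bound_le _ _ b); last lra.
    by apply: measurable_funX; exact: mr.
  move=> w; rewrite sqr_ge0/= /r.
  set y1 := Y _ w; set y2 := Y _ w; set a1 := sp_integral _ _ _ w; set a2 := sp_integral _ _ _ w.
  have := sqr_ge0 ((y1 - a1) + (y2 - a2)); nra.
have mD j : measurable_wrt (T' := R) (F (v' j)) (D j).
  by apply: measurable_wrtB; exact: left_value_measurable_wrt.
have [KD KD0 HKD] : exists2 KD : R, 0 <= KD & forall j w, `|D j w| <= KD.
  have [K1 K10 HK1] := left_value_bounded (hm n); have [K2 K20 HK2] := left_value_bounded h.
  exists (K1 + K2); first exact: addr_ge0.
  by move=> j w; rewrite (le_trans (ler_normB _ _))// lerD.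
pose f (p : measurableTypeR R * Omega) := (sp_eval (hm n) p.1 p.2 - sp_eval h p.1 p.2) ^+ 2.
have Df j s w : (j < N')%N -> v' j < s <= v' j.+1 -> D j w ^+ 2 = f (s, w).
  by move=> jN js; rewrite /f /D/= (sp_eval_grid v'm w jN js) (sp_eval_grid v'h w jN js).
have eeta : e <= eta.
  rewrite /e ler_pdivrMr ?mulr_gt0 ?exprn_gt0// ler_peMr ?(ltW eta0)//.
  by rewrite -natrX -natrM ler1n muln_gt0 expn_gt0.
(* Here [2 (e + eta) <= 4 eta]. Together with [eta] for the sums of the [r k], and a factor 2 for
   splitting the square, this yields the constant [10 = 2 (4 + 1)] of both estimates. *)
have bf : integral_bound M f (4 * eta).
  have b := integral_boundZ (ler0n _ 2) (integral_boundD bM heta).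
  apply: (integral_bound_le _ _ b); last lra.
    by apply: measurable_funX; apply: measurable_funB; exact: sp_eval_measurable.
  move=> p; rewrite sqr_ge0/= /f.
  set y := gamma p; set y1 := sp_eval _ _ _; set y2 := sp_eval _ _ _.
  have := sqr_ge0 ((y - y1) + (y - y2)); nra.
have Ne : N%:R * (N%:R * (4 * e)) <= eta.
  have -> : N%:R * (N%:R * (4 * e)) = eta * (N%:R ^+ 2 / N.+1%:R ^+ 2).
    by rewrite /e; field; rewrite gt_eqF.
  rewrite ler_piMr ?(ltW eta0)// ler_pdivrMr ?exprn_gt0// mul1r.
  by rewrite lerXn2r ?nnegrE ?ler0n// ler_nat.
have br2 : integral_bound P (fun w => \sum_(k < N) r k w ^+ 2) (N%:R * (4 * e)).
  have b := @integral_bound_fin_sum _ _ _ P N (fun k w => r k w ^+ 2) (fun=> 4 * e) br.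
  by move: b; rewrite sumr_const card_ord -[_ *+ N]mulr_natl.
have meps' k : measurable_fun setT (eps' k).
  apply: measurable_sum => j; apply: measurable_funM; last exact: increment_measurable.
  by case: (v k <= v' j < v k.+1) => //; exact: measurable_wrt_measurable_fun (mD j).
have meps k : (k < N)%N -> measurable_fun setT (eps k).
  move=> kN; rewrite (_ : eps k = fun w => eps' k w + r k w).
    by apply: measurable_funD => //; exact: mr.
  by apply/funext => w; exact: epsE.
have mpsi k : (k < N)%N -> measurable_fun setT (psi k).
  by move=> kN; exact: measurable_wrt_measurable_fun (psiF kN).
split.
(* The weights are spread over the refined grid, each cell inheriting the weight of the coarse cell
   around it. The sum then becomes a single integral of [Psi D] along the refined grid, to which the
   isometry applies. *)
- pose Psi j w := \sum_(k < N) (if v k <= v' j < v k.+1 then psi k w else 0).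
  have PsiK j w : `|Psi j w| <= K.
    by apply: (@grid_sum_cell_le R v N t (v' j) (psi^~ w)) => // k kN; exact: psiK.
  have b1 : integral_bound P (fun w => (\sum_(k < N) psi k w * eps' k w) ^+ 2) (K ^+ 2 * (4 * eta)).
    apply: (@integral_bound_eq _ _ _ P
        (fun w => (\sum_(j < N') (Psi j w * D j w) * dB' j w) ^+ 2)).
      move=> w; congr (_ ^+ 2); rewrite /eps' /Psi.
      under [RHS]eq_bigr do rewrite mulr_sumr.
      rewrite exchange_big/=; apply: eq_bigr => j _.
      rewrite !mulr_suml; apply: eq_bigr => k _.
      by case: ifP => _; rewrite ?mul0r ?mulr0// !mulrA.
    apply: (integral_bound_increment_sum_time_space gv' BM ZB
      (G := fun j w => Psi j w * D j w) (f := fun p => K ^+ 2 * f p)).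
    + move=> j jN; apply: measurable_wrtM; last exact: mD.
      rewrite /Psi; apply: measurable_wrt_sum => k _.
      case: (boolP (v k <= v' j < v k.+1)) => [/andP[kj _]|_]; last exact: measurable_wrt_cst.
      exact: measurable_wrt_filtrationW kj (psiF (ltn_ord k)).
    + by move=> j jN; exists (K * KD) => w; rewrite normrM ler_pM.
    + move=> j s w jN js; rewrite exprMn (Df _ _ _ jN js) ler_wpM2r ?sqr_ge0//.
      by rewrite -(real_normK (num_real (Psi j w))) lerXn2r// ?nnegrE.
    + by apply: integral_boundZ => //; exact: sqr_ge0.
  have b2 : integral_bound P (fun w => (\sum_(k < N) psi k w * r k w) ^+ 2) (K ^+ 2 * eta).
    have b := integral_boundZ (sqr_ge0 K) (integral_boundZ (ler0n _ N) br2).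
    apply: (integral_bound_le _ _ b).
    + apply: measurable_funX; apply: measurable_sum => k; apply: measurable_funM; [exact: mpsi|exact: mr].
    + move=> w; rewrite sqr_ge0/=.
      rewrite (le_trans (sqr_sum_le N (fun k => psi k w * r k w)))//.
      rewrite mulrCA ler_wpM2l// mulr_sumr; apply: ler_sum => k _.
      rewrite exprMn ler_wpM2r ?sqr_ge0//.
      by rewrite -(real_normK (num_real (psi k w))) lerXn2r// ?nnegrE// psiK.
    + by rewrite ler_wpM2l ?sqr_ge0.
  have b := integral_boundZ (ler0n _ 2) (integral_boundD b1 b2).
  apply: (integral_bound_le _ _ b); last lra.
    apply: measurable_funX; apply: measurable_sum => k; apply: measurable_funM; [exact: mpsi|exact: meps].
  move=> w; rewrite sqr_ge0/=.
  have -> : \sum_(k < N) psi k w * eps k w =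
      \sum_(k < N) psi k w * eps' k w + \sum_(k < N) psi k w * r k w.
    by rewrite -big_split/=; apply: eq_bigr => k _; rewrite epsE// mulrDr.
  set a := \sum_(k < N) psi k w * eps' k w; set a' := \sum_(k < N) _.
  have := sqr_ge0 (a - a'); nra.
- have [||||b [bD bs]] := @step_bound _ _ _ P v' N' t gv' (fun j w => D j w ^+ 2) f _ _ _ _ _ bf.
  + by move=> j _; apply: measurable_funX; exact: measurable_wrt_measurable_fun (mD j).
  + by move=> j w _; exact: sqr_ge0.
  + by move=> j _; exists (KD ^+ 2) => w; rewrite normrX lerXn2r// ?nnegrE.
  + by move=> j s w jN js; rewrite (Df _ _ _ jN js).
  have b'0 j : (j < N')%N -> 0 <= b j by move=> /bD /integral_bound_ge0.
  have b1 k : (k < N)%N -> integral_bound P (fun w => eps' k w ^+ 2)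
      (\sum_(j < N') (v' j.+1 - v' j) * (if v k <= v' j < v k.+1 then b j else 0)).
    move=> kN; apply: (integral_bound_increment_sum BM ZB
      (G := fun j w => if v k <= v' j < v k.+1 then D j w else 0)
      (a := fun j => if v k <= v' j < v k.+1 then b j else 0)).
    + by case: gv' => ->.
    + by case: gv' => _ _.
    + by move=> j jN; case: (v k <= v' j < v k.+1); [exact: mD|exact: measurable_wrt_cst].
    + by move=> j jN; exists KD => w; case: ifP => _; rewrite ?normr0.
    + move=> j jN; case: (v k <= v' j < v k.+1); first exact: bD.
      by apply: integral_bound_eq (integral_bound0 P) => w; rewrite expr0n.
  have b2 := integral_boundZ (ler0n _ 2) (integral_boundD (integral_bound_fin_sum b1) br2).
  apply: (integral_bound_le _ _ b2).
  + by apply: measurable_sum => k; apply: measurable_funX; exact: meps.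
  + move=> w; rewrite sumr_ge0/= => [|k _]; last exact: sqr_ge0.
    rewrite -big_split/= mulr_sumr; apply: ler_sum => k _; rewrite epsE//.
    have := sqr_ge0 (eps' k w - r k w); nra.
  + have h1 : \sum_(k < N) \sum_(j < N') (v' j.+1 - v' j) *
        (if v k <= v' j < v k.+1 then b j else 0) <= 4 * eta.
      apply: le_trans bs; rewrite exchange_big/=; apply: ler_sum => j _.
      rewrite -mulr_sumr ler_wpM2l ?subr_ge0 ?(grid_mono gv')//.
      apply: le_trans (ler_norm _) _.
      by apply: (@grid_sum_cell_le R v N t (v' j) (fun=> b j)) => //; [exact: b'0|
        move=> k _; rewrite ger0_norm// b'0].
    have h2 : N%:R * (4 * e) <= eta.
      case: (posnP N) => [->|Np]; first by rewrite mul0r ltW.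
      apply: le_trans Ne; rewrite -[leLHS]mul1r ler_wpM2r ?ler1n//.
      by rewrite mulr_ge0// mulr_ge0// ltW.
    lra.
Qed.

End error.

Lemma time_integral_increment (f : measurableTypeR R * Omega -> R) (K u s : R) w :
  measurable_fun setT f -> (forall p, `|f p| <= K) -> 0 <= u -> u <= s ->
  time_integral s f w - time_integral u f w =
    \int[lambda]_(r in `]u, s]) f (r, w) /\
  `|time_integral s f w - time_integral u f w| <= K * (s - u).
Proof.
move=> mf fK u0 us.
have i0s := @bounded_integrable _ _ _ f K mf fK 0 s w.
have E : time_integral s f w - time_integral u f w =
    \int[lambda]_(r in `]u, s]) f (r, w).
  by apply: Rintegral_itvB => //; rewrite bnd_simp.
have ius : lambda.-integrable `]u, s] (fun r : measurableTypeR R => (f (r, w))%:E).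
  apply: integrableS i0s => //.
  by move=> r; rewrite /= !in_itv/= => /andP[ur ->]; rewrite (le_trans u0 (ltW ur)).
split=> //; rewrite E.
have ic : lambda.-integrable `]u, s] (fun r : measurableTypeR R => K%:E).
  apply: (@measurable_bounded_integrable _ _ _ lambda (fun=> K)) => //.
    by have := ltry (s - u); rewrite -(lebesgue_measure_itvoc us).
  by exists `|K|; split; [exact: num_real|move=> x Kx r _; exact: ltW].
apply: (@le_trans _ _ (\int[lambda]_(r in `]u, s]) K)).
  apply: (le_trans (le_normr_Rintegral _ ius)) => //.
  apply: le_Rintegral => //.
  exact: integrable_abse ius.
rewrite Rintegral_cst// le_eqVlt; apply/orP; left; apply/eqP; congr (_ * _).
exact: (congr1 fine (lebesgue_measure_itvoc us)).
Qed.

(** The constant of [X_increment], namely [2 (C ^ 2 t + 6 C ^ 2)]: the drift contributes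
    [C ^ 2 (s - u) ^ 2 <= C ^ 2 t (s - u)], the martingale part [6 C ^ 2 (s - u)]. *)
Let KX := 2 * C ^+ 2 * t + 12 * C ^+ 2.

Let X_increment u s : 0 <= u -> u <= s -> s <= t ->
  integral_bound P (fun w => (X s w - X u w) ^+ 2) (KX * (s - u)).
Proof.
move=> u0 us st; have s0 := le_trans u0 us; have ut := le_trans us st.
have su : 0 <= s - u by rewrite subr_ge0.
have b1 := integral_bound_cst P (mulr_ge0 (mulr_ge0 (sqr_ge0 C) t0) su).
have b := integral_boundZ (ler0n _ 2) (integral_boundD b1 (Y_increment u0 us st)).
apply: (integral_bound_le _ _ b).
- by apply: measurable_funX; apply: measurable_funB; apply: mX; rewrite ?s0 ?u0.
- move=> w; rewrite sqr_ge0/=.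
  have [_ Jle] := time_integral_increment w mb bC u0 us.
  have J2 : (time_integral s beta w - time_integral u beta w) ^+ 2 <= C ^+ 2 * t * (s - u).
    rewrite -(real_normK (num_real (_ - _))).
    apply: (@le_trans _ _ ((C * (s - u)) ^+ 2)).
      by rewrite lerXn2r// nnegrE// mulr_ge0.
    rewrite exprMn expr2 (expr2 (s - u)) -!mulrA !ler_wpM2l// ler_wpM2r//; lra.
  have -> : X s w - X u w = (time_integral s beta w - time_integral u beta w) + (Y s w - Y u w).
    by rewrite /Y; ring.
  set J := time_integral s beta w - _ in J2 *; set y := Y s w - _.
  have := sqr_ge0 (J - y); nra.
- by rewrite /KX; lra.
Qed.

Let KX0 : 0 <= KX.
Proof. by rewrite /KX addr_ge0// !mulr_ge0// sqr_ge0. Qed.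

Variable Xt : measurableTypeR R * Omega -> R.
Hypothesis mXt : measurable_fun setT Xt.
Hypothesis XtX : forall s, 0 <= s <= t -> {ae P, forall w, Xt (s, w) = X s w}.

(** [Xt] and [X] agree almost surely at each fixed time, so [X_increment] bounds the inner integral
    at every time, and the bound is then integrated over time. *)
Lemma step_close (v : nat -> R) (N : nat) delta : grid v N t -> 0 <= delta ->
  (forall j, (j < N)%N -> v j.+1 - v j <= delta) ->
  integral_bound M (fun p => (step v N (fun k => X (v k)) p - Xt p) ^+ 2)
    (t * (KX * delta)).
Proof.
move=> gv d0 mesh.
have vt k : (k <= N)%N -> 0 <= v k <= t.
  by move=> kN; rewrite (grid_ge0 gv kN) (grid_le gv kN).
apply: integral_bound_time_space => //.
- apply: measurable_funX; apply: measurable_funB => //; apply: measurable_step => j jN.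
  by apply: mX; apply: vt; exact: ltnW.
- by move=> p; exact: sqr_ge0.
- exact: mulr_ge0.
- move=> s st; have [j jN /andP[js sj]] := grid_cell gv st.
  have st' : 0 <= s <= t by case/andP: st => /ltW -> ->.
  have [vj0 vjt] := andP (vt _ (ltnW jN)).
  have [_ _ b] := X_increment vj0 (ltW js) (andP st).2.
  apply: (@le_trans _ _ (\int[P]_w ((X s w - X (v j) w) ^+ 2)%:E)%E).
    rewrite le_eqVlt; apply/orP; left; apply/eqP; apply: ae_eq_integral => //.
    + apply/measurable_EFinP; apply: measurable_funX; apply: measurable_funB; last exact: measurable_fun_pair2.
      rewrite (_ : (fun _ => _) = X (v j)); first exact/mX/vt/ltnW.
      by apply/funext => w; rewrite (step_cell gv _ w jN)// js.
    + by apply/measurable_EFinP; apply: measurable_funX; apply: measurable_funB; apply: mX => //; apply: vt; exact: ltnW.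
    + apply: filterS (XtX st') => w /= -> _.
      by rewrite (step_cell gv _ w jN) ?js// -sqrrN opprB.
  apply: le_trans b _; rewrite lee_fin ler_wpM2l//.
  by apply: le_trans (mesh _ jN); rewrite lerD2r.
Qed.

Lemma time_integral_step (v : nat -> R) (N : nat) (G : nat -> Omega -> R)
    (f : measurableTypeR R * Omega -> R) (K L : R) w : grid v N t ->
  (forall j, (j < N)%N -> measurable_fun setT (G j)) ->
  0 <= L -> (forall j w, (j < N)%N -> `|G j w| <= L) ->
  measurable_fun setT f -> (forall p, `|f p| <= K) ->
  time_integral t (fun p => step v N G p * f p) w =
  \sum_(j < N) G j w * (time_integral (v j.+1) f w - time_integral (v j) f w).
Proof.
move=> gv mG L0 GL mf fK.
pose g (p : measurableTypeR R * Omega) := step v N G p * f p.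
have mg' : measurable_fun setT g by apply: measurable_funM => //; exact: measurable_step.
have gK p : `|g p| <= L * K.
  by rewrite normrM ler_pM//; exact: (step_le gv).
case: (gv) => v0 vN vS.
suff H : forall n, (n <= N)%N -> time_integral (v n) g w =
    \sum_(j < n) G j w * (time_integral (v j.+1) f w - time_integral (v j) f w).
  by rewrite -[LHS]/(time_integral t g w) -{1}vN H.
elim=> [_|n IH nN].
  rewrite big_ord0 /time_integral v0 (_ : `[0, 0]%classic = [set 0]) ?Rintegral_set1//.
  by rewrite set_itv1.
rewrite big_ord_recr/= -IH ?(ltnW nN)//.
have vn0 := grid_ge0 gv (ltnW nN).
have [E1 _] := time_integral_increment w mg' gK vn0 (vS _ nN).
have [E2 _] := time_integral_increment w mf fK vn0 (vS _ nN).
rewrite E2; apply/eqP; rewrite addrC -subr_eq E1; apply/eqP.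
rewrite -RintegralZl//.
  apply: eq_Rintegral => r; rewrite inE/= in_itv/= => rn.
  by rewrite /g (step_cell gv _ w nN rn).
apply: integrableS (bounded_integrable mf fK 0 (v n.+1) w) => //.
by move=> r; rewrite /= !in_itv/= => /andP[ur ->]; rewrite (le_trans vn0 (ltW ur)).
Qed.

Variables (phi phi1 phi2 : R -> R) (K : R).
Hypotheses (mphi : measurable_fun setT phi) (mphi1 : measurable_fun setT phi1)
  (mphi2 : measurable_fun setT phi2).
Hypotheses (phi1K : forall x, `|phi1 x| <= K) (phi2K : forall x, `|phi2 x| <= K).
Hypothesis phi1_lip : forall x y, `|phi1 x - phi1 y| <= K * `|x - y|.
Hypothesis phi2_lip : forall x y, `|phi2 x - phi2 y| <= K * `|x - y|.
Hypothesis taylor : forall x a c e, 0 < e <= 1 ->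
  `|phi (x + (a + c)) - phi x - phi1 x * (a + c) - 2^-1 * phi2 x * a ^+ 2|
    <= K * (e * a ^+ 2 + e^-1 * a ^+ 4 + e^-1 * c ^+ 2).

Let K0 : 0 <= K. Proof. exact: le_trans (phi1K 0). Qed.

Let drift p := beta p * phi1 (Xt p) + 2^-1 * (gamma p ^+ 2 * phi2 (Xt p)).
(** What Ito's formula asserts to be the stochastic integral of [gamma phi1 (Xt)]. *)
Let remainder w := phi (X t w) - phi (X 0 w) - time_integral t drift w.

Let mdrift : measurable_fun setT drift.
Proof.
apply: measurable_funD; first by apply: measurable_funM => //; exact: measurableT_comp.
apply: measurable_funM => //; apply: measurable_funM; first exact: measurable_funX.
exact: measurableT_comp.
Qed.

Let driftL p : `|drift p| <= C * K + 2^-1 * (C ^+ 2 * K).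
Proof.
apply: le_trans (ler_normD _ _) _; apply: lerD; first by rewrite normrM ler_pM.
rewrite normrM (ger0_norm (_ : 0 <= 2^-1))// ler_wpM2l//.
by rewrite normrM ler_pM// normrX lerXn2r// ?nnegrE// gC.
Qed.

(** * Ito's formula for one simple process on one grid *)

Section estimate.
Variables (e Ch : R) (h : simple_process F) (v : nat -> R) (N : nat).
Hypothesis e01 : 0 < e <= 1.
Hypothesis gv : grid v N t.
Hypothesis hv : forall x, x \in sp_times h -> splits v N x.
Hypothesis he : integral_bound M (fun p => (gamma p - sp_eval h p.1 p.2) ^+ 2) (e ^+ 2).
Hypothesis Ch0 : 0 <= Ch.
Hypothesis hC : forall r w, `|left_value h r w| <= Ch.
Variable delta : R.
Hypothesis delta0 : 0 <= delta.
Hypothesis mesh : forall j, (j < N)%N -> v j.+1 - v j <= delta.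
Hypothesis delta_e : delta <= e ^+ 2.
Hypothesis delta_Ch : Ch ^+ 4 * delta <= e ^+ 2.

Let x k := X (v k).
Let H k := left_value h (v k).
Let dv k := v k.+1 - v k.
Let dB k w := B (v k.+1) w - B (v k) w.
Let a k w := H k w * dB k w.
Let c k w := x k.+1 w - x k w - a k w.
Let dJ k w := time_integral (v k.+1) beta w - time_integral (v k) beta w.
Let eps k w := Y (v k.+1) w - Y (v k) w - left_value h (v k) w * (B (v k.+1) w - B (v k) w).
Let r (p : measurableTypeR R * Omega) := gamma p - sp_eval h p.1 p.2.
Let q p := step v N x p - Xt p.

Let e0 : 0 < e. Proof. by case/andP: e01. Qed.
Let e1 : e <= 1. Proof. by case/andP: e01. Qed.
Let e2 : e ^+ 2 <= e. Proof. by rewrite expr2 ler_piMl// ltW. Qed.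

Let vt k : (k <= N)%N -> 0 <= v k <= t.
Proof. by move=> kN; rewrite (grid_ge0 gv kN) (grid_le gv kN). Qed.

Let dv0 k : (k < N)%N -> 0 <= dv k.
Proof. by move=> kN; rewrite subr_ge0 (grid_mono gv). Qed.

Let sum_dv : \sum_(k < N) dv k = t.
Proof.
case: (gv) => v0 vN _.
by rewrite -(big_mkord xpredT dv) telescope_sumr// v0 vN subr0.
Qed.

Let sum_dv2 : \sum_(k < N) dv k ^+ 2 <= delta * t.
Proof.
rewrite -sum_dv mulr_sumr; apply: ler_sum => k _.
by rewrite expr2 ler_wpM2r ?dv0// mesh.
Qed.

Let xF k : (k <= N)%N -> measurable_wrt (T' := R) (F (v k)) (x k).
Proof. by move=> kN; apply: XF; exact: vt. Qed.

Let mx k : (k <= N)%N -> measurable_fun setT (x k).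
Proof. by move=> kN; apply: mX; exact: vt. Qed.

Let HF k : measurable_wrt (T' := R) (F (v k)) (H k).
Proof. exact: left_value_measurable_wrt. Qed.

Let mH k : measurable_fun setT (H k).
Proof. exact: measurable_wrt_measurable_fun (@HF k). Qed.

Let mdB k : measurable_fun setT (dB k).
Proof. exact: increment_measurable. Qed.

Let ma k : measurable_fun setT (a k).
Proof. exact: measurable_funM. Qed.

Let mdJ k : (k < N)%N -> measurable_fun setT (dJ k).
Proof.
move=> kN; apply: measurable_funB; apply: measurable_time_integral bC => //.
- by case/andP: (vt kN).
- by case/andP: (vt (ltnW kN)).
Qed.

Let mc k : (k < N)%N -> measurable_fun setT (c k).
Proof. by move=> kN; apply: measurable_funB => //; apply: measurable_funB; apply: mx => //; exact: ltnW. Qed.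

Let cE k w : c k w = dJ k w + eps k w.
Proof. by rewrite /c /dJ /eps /Y /a /H /dB /x; ring. Qed.

Let meps k : (k < N)%N -> measurable_fun setT (eps k).
Proof.
move=> kN; rewrite (_ : eps k = fun w => c k w - dJ k w).
  by apply: measurable_funB; [exact: mc|exact: mdJ].
by apply/funext => w; rewrite cE; ring.
Qed.

(** The energy of [H] is bounded independently of its uniform bound [Ch], because [h] is L2-close to
    [gamma], which is bounded by [C]. *)
Let H_bound : exists b, (forall k, (k < N)%N -> integral_bound P (fun w => H k w ^+ 2) (b k)) /\
  \sum_(k < N) dv k * b k <= 2 * C ^+ 2 * t + 2 * e ^+ 2.
Proof.
have bi := integral_boundZ (mulr_ge0 (ler0n _ 2) (sqr_ge0 C)) (integral_bound_time_indic (lexx 0) t0 (lexx t)).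
have b := integral_boundD bi (integral_boundZ (ler0n _ 2) he).
rewrite subr0 in b.
apply: (step_bound gv _ _ _ _ b).
- by move=> k kN; exact: measurable_funX.
- by move=> k w _; exact: sqr_ge0.
- by move=> k kN; exists (Ch ^+ 2) => w; rewrite normrX lerXn2r// ?nnegrE// hC.
- move=> k s w kN ks /=; rewrite indicE mem_set; last first.
    rewrite /= in_itv/=; case/andP: (ks) => ks1 ks2.
    rewrite (le_lt_trans (grid_ge0 gv (ltnW kN)) ks1)/=.
    by rewrite (le_trans ks2)// (grid_le gv).
  rewrite (sp_eval_grid hv w kN ks) -/(H k w).
  have g2 : gamma (s, w) ^+ 2 <= C ^+ 2.
    by rewrite -(real_normK (num_real (gamma _))) lerXn2r// ?nnegrE.
  have := sqr_ge0 (2 * gamma (s, w) - H k w); rewrite /=; nra.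
Qed.

Let eps_bounds :
  integral_bound P (fun w => (\sum_(k < N) phi1 (x k w) * eps k w) ^+ 2) (10 * K ^+ 2 * e ^+ 2) /\
  integral_bound P (fun w => \sum_(k < N) eps k w ^+ 2) (10 * e ^+ 2).
Proof.
apply: (@ito_error v N h (e ^+ 2) K (fun k w => phi1 (x k w))) => //.
- by rewrite exprn_gt0.
- by move=> k kN; apply: measurable_wrt_comp => //; apply: xF; exact: ltnW.
Qed.

(* Up to [T1 + T2 + T4 / 2] and the time integral of [Theta], the remainder of
   Ito's formula is the integral of the simple process [phi1 (x k) * H k]: [T1]
   collects the Taylor remainders, [T2] the errors in the martingale part, and
   [T4] the deviations of the quadratic variation from time. *)
Let T1 w := \sum_(k < N) (phi (x k.+1 w) - phi (x k w) - phi1 (x k w) * (a k w + c k w)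
   - 2^-1 * phi2 (x k w) * a k w ^+ 2).
Let T2 w := \sum_(k < N) phi1 (x k w) * eps k w.
Let T4 w := \sum_(k < N) (phi2 (x k w) * H k w ^+ 2) * (dB k w ^+ 2 - dv k).
Let Theta p := (step v N (fun k w => phi1 (x k w)) p - phi1 (Xt p)) * beta p +
  2^-1 * (step v N (fun k w => phi2 (x k w) * H k w ^+ 2) p - gamma p ^+ 2 * phi2 (Xt p)).

(** In the bound [taylor] for one cell, the sum of the [a ^ 2] is controlled by [H_bound], that of
    the [a ^ 4] by [Ch] and the mesh, and that of the [c ^ 2] through [c = dJ + eps], where [dJ] is
    of the order of the cell length. *)
Let T1_bound : integral_bound P (fun w => `|T1 w|)
  (K * ((4 * C ^+ 2 * t + 29 * t + 22) * e)).
Proof.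
have [b [Hb bs]] := H_bound.
have [_ eb] := eps_bounds.
have a2 k : (k < N)%N -> integral_bound P (fun w => a k w ^+ 2) (dv k * b k).
  move=> kN; have [_ _ Hbk] := Hb _ kN; split => [|w|]; [exact: measurable_funX|exact: sqr_ge0|].
  under eq_integral do rewrite exprMn.
  rewrite (integral_increment_sqr BM ZB).
  - by rewrite EFinM lee_wpmul2l// lee_fin dv0.
  - exact: grid_ge0 gv (ltnW kN).
  - exact: grid_mono gv (leqnSn k) kN.
  - by apply: measurable_wrtX; exact: HF.
  - by move=> w; exact: sqr_ge0.
have a4 k : (k < N)%N -> integral_bound P (fun w => a k w ^+ 4) (29 * dv k ^+ 2 * Ch ^+ 4).
  move=> kN; apply: (@integral_bound_eq _ _ _ P (fun w => H k w ^+ 4 * dB k w ^+ 4)).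
    by move=> w; rewrite exprMn.
  apply: (integral_bound_increment4 BM ZB).
  - exact: grid_ge0 gv (ltnW kN).
  - exact: grid_mono gv (leqnSn k) kN.
  - by apply: measurable_wrtX; exact: HF.
  apply: (integral_bound_le _ _ (integral_bound_cst P (exprn_ge0 4 Ch0))) => //.
    exact: measurable_funX.
  move=> w; rewrite exprn_even_ge0//= -[leLHS]ger0_norm ?exprn_even_ge0// normrX.
  by rewrite lerXn2r// ?nnegrE// hC.
have J2 w : \sum_(k < N) dJ k w ^+ 2 <= C ^+ 2 * (delta * t).
  apply: le_trans (ler_wpM2l (sqr_ge0 C) sum_dv2).
  rewrite mulr_sumr; apply: ler_sum => k _.
  have [_ Jle] := time_integral_increment w mb bC (grid_ge0 gv (ltnW (ltn_ord k)))
    (grid_mono gv (leqnSn k) (ltn_ord k)).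
  rewrite -(real_normK (num_real (dJ k w))) -exprMn lerXn2r// nnegrE// mulr_ge0//.
  exact: dv0.
have bc := integral_boundD
  (integral_bound_cst P (mulr_ge0 (mulr_ge0 (ler0n _ 2) (sqr_ge0 C)) (mulr_ge0 delta0 t0)))
  (integral_boundZ (ler0n _ 2) eb).
have bA := integral_bound_fin_sum a2; have bA4 := integral_bound_fin_sum a4.
have ei0 : 0 <= e^-1 by rewrite invr_ge0 ltW.
have bT := integral_boundZ K0 (integral_boundD (integral_boundD
  (integral_boundZ (ltW e0) bA) (integral_boundZ ei0 bA4)) (integral_boundZ ei0 bc)).
apply: (integral_bound_le _ _ bT).
- apply: measurableT_comp => //; apply: measurable_sum => k.
  have kN := ltn_ord k; have mxk := mx (ltnW kN); have mxk1 := mx kN; have mck := mc kN.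
  apply: measurable_funB; last first.
    apply: measurable_funM; last exact: measurable_funX.
    by apply: measurable_funM => //; exact: measurableT_comp.
  apply: measurable_funB; last first.
    by apply: measurable_funM; [exact: measurableT_comp|exact: measurable_funD].
  by apply: measurable_funB; exact: measurableT_comp.
- move=> w; rewrite normr_ge0/=.
  apply: (@le_trans _ _ (\sum_(k < N) K * (e * a k w ^+ 2 + e^-1 * a k w ^+ 4 + e^-1 * c k w ^+ 2))).
    apply: le_trans (ler_norm_sum _ _ _) _; apply: ler_sum => k _.
    have -> : x k.+1 w = x k w + (a k w + c k w) by rewrite /c; ring.
    exact: taylor.
  rewrite -mulr_sumr ler_wpM2l// !big_split/= -!mulr_sumr lerD2l ler_wpM2l//.
  apply: (@le_trans _ _ (2 * \sum_(k < N) dJ k w ^+ 2 + 2 * \sum_(k < N) eps k w ^+ 2)).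
    rewrite !mulr_sumr -big_split/=; apply: ler_sum => k _; rewrite cE.
    have := sqr_ge0 (dJ k w - eps k w); nra.
  rewrite lerD2r -mulrA ler_wpM2l//; exact: J2.
- apply: (ler_wpM2l K0); apply: (ito_taylor_arith e0 e1 t0 delta_e bs).
  exact: (sum_sqr_mesh_le (ler0n _ _) (exprn_ge0 4 Ch0) t0 sum_dv2 delta_Ch).
Qed.

Let sqr_to_abs (T : Omega -> R) A : measurable_fun setT T ->
  integral_bound P (fun w => T w ^+ 2) (A * e ^+ 2) ->
  integral_bound P (fun w => `|T w|) ((1 + A) * e).
Proof.
move=> mT bT.
have ei0 : 0 <= e^-1 by rewrite invr_ge0 ltW.
have b := integral_boundD (integral_bound_cst P (ltW e0)) (integral_boundZ ei0 bT).
apply: (integral_bound_le _ _ b).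
- exact: measurableT_comp.
- move=> w; rewrite normr_ge0/=; exact: normr_le_sqr.
- by rewrite expr2 mulrCA (mulrA e^-1) mulVf ?mul1r ?gt_eqF// mulrDl mul1r.
Qed.

Let T2_bound : integral_bound P (fun w => `|T2 w|) ((1 + 10 * K ^+ 2) * e).
Proof.
apply: sqr_to_abs; last by case: eps_bounds.
apply: measurable_sum => k; apply: measurable_funM; last exact: meps.
by apply: measurableT_comp => //; apply: mx; exact: ltnW.
Qed.

(** The terms are orthogonal, so the L2 bound is [60 K ^ 2 Ch ^ 4] times the sum of the [dv ^ 2].
    This sum is at most [delta t], and [delta_Ch] absorbs the factor [Ch ^ 4]. *)
Let T4_bound : integral_bound P (fun w => `|T4 w|) ((1 + 60 * t * K ^+ 2) * e).
Proof.
have G2 k w : (phi2 (x k w) * H k w ^+ 2) ^+ 2 <= K ^+ 2 * Ch ^+ 4.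
  rewrite exprMn -exprM ler_pM ?sqr_ge0 ?exprn_even_ge0//.
  - by rewrite -(real_normK (num_real (phi2 _))) lerXn2r// ?nnegrE.
  - by rewrite -[leLHS]ger0_norm ?exprn_even_ge0// normrX lerXn2r// ?nnegrE// hC.
apply: sqr_to_abs.
  apply: measurable_sum => k; apply: measurable_funM.
    apply: measurable_funM; last exact: measurable_funX.
    by apply: measurableT_comp => //; apply: mx; exact: ltnW.
  by apply: measurable_funB => //; exact: measurable_funX.
have KC0 : 0 <= K ^+ 2 * Ch ^+ 4 by rewrite mulr_ge0 ?sqr_ge0 ?exprn_ge0.
have b : forall k, (k < N)%N -> integral_bound P (fun w => (phi2 (x k w) * H k w ^+ 2) ^+ 2)
    (K ^+ 2 * Ch ^+ 4).
  move=> k kN; apply: (integral_bound_le _ _ (integral_bound_cst P KC0)) => //.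
    apply: measurable_funX; apply: measurable_funM; last exact: measurable_funX.
    by apply: measurableT_comp => //; apply: mx; exact: ltnW.
  by move=> w; rewrite sqr_ge0 G2.
have := @integral_bound_increment_var_sum _ _ _ P B Z BM ZB v N
  (fun k w => phi2 (x k w) * H k w ^+ 2) (fun=> K ^+ 2 * Ch ^+ 4).
move=> /(_ _ _ _ _ b) bT.
have {bT} bT : integral_bound P (fun w => T4 w ^+ 2) (\sum_(j < N) 60 * dv j ^+ 2 * (K ^+ 2 * Ch ^+ 4)).
  apply: bT.
  - by case: gv => ->.
  - by case: gv.
  - move=> k kN; apply: measurable_wrtM; last by apply: measurable_wrtX; exact: HF.
    by apply: measurable_wrt_comp => //; apply: xF; exact: ltnW.
  - move=> k kN; exists (K * Ch ^+ 2) => w; rewrite normrM normrX ler_pM//.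
    by rewrite lerXn2r// ?nnegrE// hC.
apply: (integral_boundW bT).
have hKC : K ^+ 2 * Ch ^+ 4 * delta <= K ^+ 2 * e ^+ 2.
  by have := ler_wpM2l (sqr_ge0 K) delta_Ch; rewrite mulrA.
have := sum_sqr_mesh_le (ler0n _ 60) KC0 t0 sum_dv2 hKC.
by rewrite mulrA.
Qed.

Let Phi1 := step v N (fun k w => phi1 (x k w)).
Let Phi2 := step v N (fun k w => phi2 (x k w) * H k w ^+ 2).

Let mr : measurable_fun setT r.
Proof. by apply: measurable_funB => //; exact: sp_eval_measurable. Qed.

Let mq : measurable_fun setT q.
Proof. by apply: measurable_funB => //; apply: measurable_step => k kN; apply: mx; exact: ltnW. Qed.

Let mPhi1 : measurable_fun setT Phi1.
Proof.
by apply: measurable_step => k kN; apply: measurableT_comp => //; apply: mx; exact: ltnW.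
Qed.

Let mPhi2 : measurable_fun setT Phi2.
Proof.
apply: measurable_step => k kN; apply: measurable_funM; last exact: measurable_funX.
by apply: measurableT_comp => //; apply: mx; exact: ltnW.
Qed.

Let mTheta : measurable_fun setT Theta.
Proof.
apply: measurable_funD.
  by apply: measurable_funM => //; apply: measurable_funB => //; exact: measurableT_comp.
apply: measurable_funM => //; apply: measurable_funB => //.
by apply: measurable_funM; [exact: measurable_funX|exact: measurableT_comp].
Qed.

Let q_bound : integral_bound M (fun p => q p ^+ 2) (t * KX * e ^+ 2).
Proof.
have := step_close gv delta0 mesh; rewrite mulrA => b.
by apply: (integral_boundW b); rewrite ler_wpM2l// mulr_ge0.
Qed.

Let cells p : 0 < p.1 <= t -> exists k, [/\ (k < N)%N, Phi1 p = phi1 (x k p.2),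
  Phi2 p = phi2 (x k p.2) * (sp_eval h p.1 p.2) ^+ 2, q p = x k p.2 - Xt p
  & sp_eval h p.1 p.2 = H k p.2].
Proof.
case: p => s w /= st; have [k kN ks] := grid_cell gv st.
exists k; rewrite /Phi1 /Phi2 /q !(step_cell gv _ w kN ks).
by rewrite (sp_eval_grid hv w kN ks).
Qed.

Let CTheta := (C * K + C ^+ 2 * K) * (t + t * KX) + K * (1 + 2 * C * (t + 1)).

(** Pointwise, [Theta] is at most [(C K + C ^ 2 K) |q| + K (r ^ 2 + 2 C |r|)], where [q] is the
    error in the state and [r] the one in the diffusion coefficient. Both are small in L2, and
    [normr_le_sqr] turns this into the L1 bound with constant [CTheta]. *)
Let Theta_bound : integral_bound M (fun p => `|Theta p|) (CTheta * e).
Proof.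
have ei0 : 0 <= e^-1 by rewrite invr_ge0 ltW.
have bt := integral_boundZ (ltW e0) (integral_bound_time_indic (lexx 0) t0 (lexx t)).
rewrite subr0 in bt.
have cA : 0 <= C * K + C ^+ 2 * K by rewrite addr_ge0 ?mulr_ge0 ?sqr_ge0.
have b1 := integral_boundZ cA (integral_boundD bt (integral_boundZ ei0 q_bound)).
have c2 : 0 <= 2 * C by rewrite mulr_ge0.
have b2 := integral_boundZ K0 (integral_boundD he (integral_boundZ c2
  (integral_boundD bt (integral_boundZ ei0 he)))).
apply: (integral_bound_le_time_space _ _ _ (integral_boundD b1 b2)).
- exact: measurableT_comp.
- by move=> p; exact: normr_ge0.
- move=> p pt; have [k [kN E1 E2 Eq Eh]] := cells pt.
  rewrite indicE mem_set; last by rewrite /= in_itv.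
  rewrite mulr1 /Theta -/Phi1 -/Phi2 E1 E2.
  set s := sp_eval h _ _ in E2 *; set g := gamma p; set y := x k p.2 in E1 E2 Eq *.
  set z := Xt p in Eq *.
  have hq : `|q p| <= e + e^-1 * q p ^+ 2 by exact: normr_le_sqr.
  have hr : `|g - s| <= e + e^-1 * (g - s) ^+ 2 by exact: normr_le_sqr.
  have h1 : `|(phi1 y - phi1 z) * beta p| <= C * K * `|q p|.
    by rewrite normrM mulrC -mulrA ler_pM// Eq.
  have h2 : `|phi2 y * s ^+ 2 - g ^+ 2 * phi2 z| <=
      K * ((g - s) ^+ 2 + 2 * C * `|g - s|) + C ^+ 2 * K * `|q p|.
    have -> : phi2 y * s ^+ 2 - g ^+ 2 * phi2 z =
        phi2 y * (s ^+ 2 - g ^+ 2) + g ^+ 2 * (phi2 y - phi2 z) by ring.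
    apply: le_trans (ler_normD _ _) _; apply: lerD; rewrite normrM.
      apply: ler_pM => //.
      have -> : s ^+ 2 - g ^+ 2 = (g - s) ^+ 2 - 2 * g * (g - s) by ring.
      apply: le_trans (ler_normB _ _) _.
      rewrite (ger0_norm (sqr_ge0 _)) lerD2l normrM ler_wpM2r//.
      by rewrite normrM ger0_norm// ler_wpM2l// gC.
    rewrite -mulrA ler_pM// ?Eq// normrX lerXn2r// ?nnegrE//; exact: gC.
  apply: le_trans (ler_normD _ _) _.
  apply: le_trans (_ : C * K * `|q p| + (K * ((g - s) ^+ 2 + 2 * C * `|g - s|) + C ^+ 2 * K * `|q p|) <= _).
    apply: lerD => //; rewrite normrM; apply: le_trans h2.
    by rewrite ler_piMl// ger0_norm// invf_le1// ler1n.
  have hq' := ler_wpM2l cA hq.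
  have hr' := ler_wpM2l K0 (ler_wpM2l c2 hr).
  move: hq' hr'; set Q := `|q p|; set q2 := e^-1 * q p ^+ 2; set Rr := `|g - s|.
  set r2 := (g - s) ^+ 2; set r3 := e^-1 * r2; lra.
- have ee (y : R) : e^-1 * (y * e ^+ 2) = y * e.
    by rewrite expr2 mulrCA (mulrA e^-1) mulVf ?mul1r// gt_eqF.
  rewrite ee -[in e^-1 * e ^+ 2](mul1r (e ^+ 2)) ee /CTheta.
  have := ler_wpM2l K0 e2; set c1 := C * K + C ^+ 2 * K; set kx := KX.
  rewrite mul1r; lra.
Qed.

Lemma ito_estimate_noise :
  integral_bound M (fun p => (gamma p * phi1 (Xt p) - Phi1 p * sp_eval h p.1 p.2) ^+ 2)
    ((2 * K ^+ 2 + 2 * C ^+ 2 * K ^+ 2 * (t * KX)) * e).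
Proof.
have c1 : 0 <= 2 * K ^+ 2 by rewrite mulr_ge0 ?sqr_ge0.
have c2 : 0 <= 2 * C ^+ 2 * K ^+ 2 by rewrite !mulr_ge0 ?sqr_ge0.
apply: (integral_bound_le_time_space _ _ _
  (integral_boundD (integral_boundZ c1 he) (integral_boundZ c2 q_bound))).
- apply: measurable_funX; apply: measurable_funB; apply: measurable_funM => //.
    exact: measurableT_comp.
  exact: sp_eval_measurable.
- by move=> p; exact: sqr_ge0.
- move=> p pt; have [k [kN E1 _ Eq _]] := cells pt; rewrite E1.
  set s := sp_eval h _ _; set g := gamma p; set y := x k p.2 in E1 Eq *.
  set z := Xt p in Eq *.
  have -> : g * phi1 z - phi1 y * s = (g - s) * phi1 y - g * (phi1 y - phi1 z) by ring.
  apply: (@le_trans _ _ (2 * ((g - s) * phi1 y) ^+ 2 + 2 * (g * (phi1 y - phi1 z)) ^+ 2)).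
    have := sqr_ge0 ((g - s) * phi1 y + g * (phi1 y - phi1 z)).
    set a1 := (g - s) * phi1 y; set a2 := g * _; nra.
  have p1 : ((g - s) * phi1 y) ^+ 2 <= K ^+ 2 * (g - s) ^+ 2.
    rewrite exprMn mulrC ler_wpM2r ?sqr_ge0//.
    by rewrite -(real_normK (num_real (phi1 y))) lerXn2r// ?nnegrE.
  have p2 : (g * (phi1 y - phi1 z)) ^+ 2 <= C ^+ 2 * (K ^+ 2 * q p ^+ 2).
    rewrite exprMn ler_pM ?sqr_ge0//.
      by rewrite -(real_normK (num_real g)) lerXn2r// ?nnegrE// gC.
    rewrite -exprMn -(real_normK (num_real (_ - _))) -[leRHS](real_normK (num_real _)).
    by rewrite lerXn2r// ?nnegrE// normrM (ger0_norm K0) Eq.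
  move: p1 p2; rewrite mulrA => p1 p2; lra.
- have h1 := ler_wpM2l c1 e2.
  have tk : 0 <= t * KX by rewrite mulr_ge0.
  have h2 := ler_wpM2l c2 (ler_wpM2l tk e2).
  rewrite [leRHS]mulrDl; apply: lerD => //.
  by rewrite -[leRHS]mulrA.
Qed.

(** The sums over cells are time integrals of step processes, so their deviation from the drift is
    exactly the time integral of [Theta]. *)
Let Theta_integral w : time_integral t Theta w = \sum_(k < N) phi1 (x k w) * dJ k w +
  2^-1 * (\sum_(k < N) (phi2 (x k w) * H k w ^+ 2) * dv k) - time_integral t drift w.
Proof.
have P1 p : `|Phi1 p| <= K by apply: (step_le gv) => // j w' _.
have G2 k w' : `|phi2 (x k w') * H k w' ^+ 2| <= K * Ch ^+ 2.
  by rewrite normrM normrX ler_pM// lerXn2r// ?nnegrE// hC.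
have KC0 : 0 <= K * Ch ^+ 2 by rewrite mulr_ge0 ?sqr_ge0.
have P2 p : `|Phi2 p| <= K * Ch ^+ 2 by apply: (step_le gv).
have m1 k : (k < N)%N -> measurable_fun setT (fun w' => phi1 (x k w')).
  by move=> kN; apply: measurableT_comp => //; apply: mx; exact: ltnW.
have m2 k : (k < N)%N -> measurable_fun setT (fun w' => phi2 (x k w') * H k w' ^+ 2).
  move=> kN; apply: measurable_funM; last exact: measurable_funX.
  by apply: measurableT_comp => //; apply: mx; exact: ltnW.
have E1 := time_integral_step w gv m1 K0 (fun j w' _ => phi1K (x j w')) mb bC.
have n1 (p : measurableTypeR R * Omega) : `|(1 : R)| <= 1 by rewrite normr1.
have mc1 : measurable_fun setT (fun _ : (measurableTypeR R * Omega)%type => 1 : R) by [].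
have E2 := time_integral_step w gv m2 KC0 (fun j w' _ => G2 j w') mc1 n1.
have tc u : 0 <= u -> time_integral u (fun=> 1 : R) w = u.
  move=> u0; rewrite /time_integral Rintegral_cst// mul1r.
  have := @lebesgue_measure_itv R `[0, u]; rewrite /= lte_fin => -> .
  by move: u0; rewrite le_eqVlt => /predU1P[<-|->]; rewrite ?ltxx//= oppr0 addr0.
have {}E2 : time_integral t (fun p => Phi2 p * 1) w =
    \sum_(k < N) (phi2 (x k w) * H k w ^+ 2) * dv k.
  rewrite E2; apply: eq_bigr => k _; rewrite !tc//; apply: (grid_ge0 gv) => //.
  exact: ltnW.
rewrite -E1 -E2 /drift /time_integral.
have i1 : lambda.-integrable `[0, t] (fun s : measurableTypeR R => (Phi1 (s, w) * beta (s, w))%:E).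
  apply: (bounded_integrable (C := K * C) (f := fun p => Phi1 p * beta p)).
    exact: measurable_funM.
  by move=> p; rewrite normrM ler_pM.
have i2 : lambda.-integrable `[0, t] (fun s : measurableTypeR R => (Phi2 (s, w) * 1)%:E).
  apply: (bounded_integrable (C := K * Ch ^+ 2) (f := fun p => Phi2 p * 1)).
    exact: measurable_funM.
  by move=> p; rewrite mulr1.
have i3 : lambda.-integrable `[0, t] (fun s : measurableTypeR R => (drift (s, w))%:E).
  exact: bounded_integrable mdrift driftL 0 t w.
have i4 : lambda.-integrable `[0, t] (fun s : measurableTypeR R => (2^-1 * (Phi2 (s, w) * 1))%:E).
  exact: (integrableZl _ 2^-1 i2).
have i5 : lambda.-integrable `[0, t]
    (fun s : measurableTypeR R => (Phi1 (s, w) * beta (s, w) + 2^-1 * (Phi2 (s, w) * 1))%:E).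
  exact: (integrableD _ i1 i4).
rewrite -RintegralZl// -RintegralD// -RintegralB//.
apply: eq_Rintegral => s _; rewrite /Theta /drift -/Phi1 -/Phi2; ring.
Qed.

Lemma ito_estimate_drift :
  integral_bound P (fun w => `|remainder w -
      \sum_(k < N) (phi1 (x k w) * H k w) * dB k w|)
    ((K * (4 * C ^+ 2 * t + 29 * t + 22) + (1 + 10 * K ^+ 2) + (1 + 60 * t * K ^+ 2) + CTheta) * e).
Proof.
have [L L0 ThetaL] : exists2 L, 0 <= L & forall p, `|Theta p| <= L.
  exists ((K + K) * C + (K * Ch ^+ 2 + C ^+ 2 * K)).
    by rewrite !(addr_ge0, mulr_ge0, sqr_ge0).
  have P1 p : `|Phi1 p| <= K by apply: (step_le gv) => // j w _.
  have P2 p : `|Phi2 p| <= K * Ch ^+ 2.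
    apply: (step_le gv) => [|j w _]; first by rewrite mulr_ge0 ?sqr_ge0.
    by rewrite normrM normrX ler_pM// ?exprn_ge0// lerXn2r// ?nnegrE// hC.
  move=> p; apply: le_trans (ler_normD _ _) _; apply: lerD.
    rewrite normrM ler_pM//; apply: le_trans (ler_normB _ _) _; exact: lerD.
  rewrite normrM; apply: (@le_trans _ _ (1 * `|Phi2 p - gamma p ^+ 2 * phi2 (Xt p)|)).
    by rewrite ler_wpM2r// ger0_norm// invf_le1// ler1n.
  rewrite mul1r; apply: le_trans (ler_normB _ _) _; apply: lerD => //.
  by rewrite normrM ler_pM// normrX lerXn2r// ?nnegrE// gC.
have bJ := integral_bound_time_integral t0 mTheta ThetaL Theta_bound.
have b := integral_boundD (integral_boundD (integral_boundD T1_bound T2_bound) T4_bound) bJ.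
apply: (integral_bound_le _ _ b).
- apply: measurableT_comp => //; apply: measurable_funB; last first.
    apply: measurable_sum => k; apply: measurable_funM => //; apply: measurable_funM => //.
    by apply: measurableT_comp => //; apply: mx; exact: ltnW.
  apply: measurable_funB; last first.
    exact: measurable_time_integral driftL.
  by apply: measurable_funB; apply: measurableT_comp => //; apply: mX; rewrite ?lexx ?t0.
- move=> w; rewrite normr_ge0/=.
  (* In each cell, [phi1 (a + c)] is split by [a = H dB] and [c = dJ + eps], and in [phi2 a ^ 2] the
     square [dB ^ 2] is replaced by [(dB ^ 2 - dv) + dv]. The terms with [H dB] are the stochastic
     sum; those with [dJ] and [dv] make up the drift. *)
  have -> : remainder w - \sum_(k < N) (phi1 (x k w) * H k w) * dB k w =
     T1 w + T2 w + 2^-1 * T4 w + time_integral t Theta w.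
    have E1 : time_integral t Theta w = \sum_(k < N) phi1 (x k w) * dJ k w +
        2^-1 * (\sum_(k < N) (phi2 (x k w) * H k w ^+ 2) * dv k) - time_integral t drift w.
      exact: Theta_integral.
    rewrite E1 /remainder.
    have -> : phi (X t w) - phi (X 0 w) = \sum_(k < N) (phi (x k.+1 w) - phi (x k w)).
      case: (gv) => v0 vN _.
      rewrite -(big_mkord xpredT (fun k => phi (x k.+1 w) - phi (x k w))).
      by rewrite telescope_sumr// /x v0 vN.
    suff : \sum_(k < N) (phi (x k.+1 w) - phi (x k w)) -
        \sum_(k < N) phi1 (x k w) * H k w * dB k w =
        T1 w + T2 w + 2^-1 * T4 w + (\sum_(k < N) phi1 (x k w) * dJ k w +
        2^-1 * (\sum_(k < N) (phi2 (x k w) * H k w ^+ 2) * dv k)).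
      move: (\sum_(k < N) _) (\sum_(k < N) _) => s1 s2.
      move: (T1 w + _) => s3; lra.
    rewrite /T1 /T2 /T4 !mulr_sumr -sumrB -!big_split/=.
    by apply: eq_bigr => k _; rewrite cE /a; field.
  apply: le_trans (ler_normD _ _) _; rewrite lerD2r.
  apply: le_trans (ler_normD _ _) _; apply: lerD; first exact: ler_normD.
  by rewrite normrM (ger0_norm (_ : 0 <= 2^-1))// ler_piMl// invf_le1// ler1n.
- by rewrite (mulrA K) -!mulrDl.
Qed.

End estimate.

(** The order of the choices matters: the accuracy [a] of the simple process [hm n] comes from [e],
    then [Ch] is the bound of that process, and only then is the mesh fixed, by
    [(1 + Ch ^ 4) delta = a ^ 2], which implies both conditions on it. The witness is the simple
    process with value [phi1 (X (v j))] times that of [hm n] on cell [j]. *)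
Lemma ito_estimate e : 0 < e -> exists g : simple_process F,
  integral_bound M (fun p => (gamma p * phi1 (Xt p) - sp_eval g p.1 p.2) ^+ 2) e /\
  integral_bound P (fun w => `|remainder w - sp_integral B g t w|) e.
Proof.
move=> epos.
pose Kn := 2 * K ^+ 2 + 2 * C ^+ 2 * K ^+ 2 * (t * KX).
pose Kd := K * (4 * C ^+ 2 * t + 29 * t + 22) + (1 + 10 * K ^+ 2) +
  (1 + 60 * t * K ^+ 2) +
  ((C * K + C ^+ 2 * K) * (t + t * KX) + K * (1 + 2 * C * (t + 1))).
have Kn0 : 0 <= Kn by rewrite !(addr_ge0, mulr_ge0, sqr_ge0).
have Kd0 : 0 <= Kd by rewrite !(addr_ge0, mulr_ge0, sqr_ge0).
have KK0 : 0 < 1 + Kn + Kd by rewrite -addrA ltr_pwDl// addr_ge0.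
pose a := Num.min 1 (e / (1 + Kn + Kd)).
have a0 : 0 < a by rewrite lt_min ltr01 divr_gt0.
have a1 : a <= 1 by rewrite ge_min lexx.
have a01 : 0 < a <= 1 by rewrite a0.
have ae : (1 + Kn + Kd) * a <= e.
  by rewrite mulrC -ler_pdivlMr// ge_min lexx orbT.
have Kna : Kn * a <= e by apply: le_trans ae; rewrite ler_pM2r//; lra.
have Kda : Kd * a <= e by apply: le_trans ae; rewrite ler_pM2r//; lra.
have [n nP] := Hgamma (exprn_gt0 2 a0); have he := nP _ (leqnn n).
have [Ch Ch0 hC] := left_value_bounded (hm n).
have Ch4 : 0 < 1 + Ch ^+ 4 by rewrite ltr_pwDl// exprn_ge0.
pose delta := a ^+ 2 / (1 + Ch ^+ 4).
have delta0 : 0 < delta by rewrite divr_gt0// exprn_gt0.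
have deltaE : (1 + Ch ^+ 4) * delta = a ^+ 2 by rewrite mulrC divfK// gt_eqF.
have [delta_a delta_C] : delta <= a ^+ 2 /\ Ch ^+ 4 * delta <= a ^+ 2.
  have : 0 <= Ch ^+ 4 * delta by rewrite mulr_ge0 ?exprn_ge0// ltW.
  by rewrite -deltaE mulrDl mul1r; split; lra.
have [v [N [gv mesh hv]]] := exists_grid (sp_times (hm n)) t0 delta0.
have GF j : (j < N)%N -> measurable_wrt (T' := R) (F (v j))
    (fun w => phi1 (X (v j) w) * left_value (hm n) (v j) w).
  move=> jN; apply: measurable_wrtM; last exact: left_value_measurable_wrt.
  apply: measurable_wrt_comp => //; apply: XF.
  by rewrite (grid_ge0 gv (ltnW jN)) (grid_le gv (ltnW jN)).
have GC j : (j < N)%N -> exists C : R, forall w,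
    `|phi1 (X (v j) w) * left_value (hm n) (v j) w| <= C.
  by move=> _; exists (K * Ch) => w; rewrite normrM ler_pM.
exists (grid_simple gv GF GC); split.
  have bn := ito_estimate_noise a01 gv hv he (ltW delta0) mesh delta_a.
  apply: (integral_bound_le_time_space _ _ _ bn) => //.
  - apply: measurable_funX; apply: measurable_funB; last exact: sp_eval_measurable.
    by apply: measurable_funM => //; exact: measurableT_comp.
  - by move=> p; exact: sqr_ge0.
  - move=> [s w] st /=; have [k kN ks] := grid_cell gv st.
    by rewrite (sp_eval_grid_simple gv GF GC w kN ks) (step_cell gv _ w kN ks)
      (sp_eval_grid hv w kN ks).
have bd := ito_estimate_drift a01 gv hv he Ch0 hC (ltW delta0) mesh delta_a delta_C.
apply: (integral_boundW (integral_bound_eq _ bd)) Kda => w.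
by rewrite sp_integral_grid_simple.
Qed.

End ito.

(** * Taylor expansions of Schwartz functions *)

Section taylor.
Context {R : realType}.
Implicit Types (f df phi : R -> R).

Lemma mvt_bound f df (x y L : R) : (forall z : R, is_derive z (1 : R) f (df z)) ->
  (forall z, `|z - x| <= `|y - x| -> `|df z| <= L) -> `|f y - f x| <= L * `|y - x|.
Proof.
move=> Hf HL.
have cf : continuous f.
  by move=> z; apply: differentiable_continuous; apply/derivable1_diffP; case: (Hf z).
have [xy|yx] := leP x y.
- have [c /[!in_itv]/= /andP[xc cy] ->] := MVT_segment xy (fun z _ => Hf z) (continuous_subspaceT cf).
  rewrite normrM ler_wpM2r// HL// !ger0_norm ?subr_ge0// lerD2r//.
- have [c /[!in_itv]/= /andP[yc cx] E] := MVT_segment (ltW yx) (fun z _ => Hf z) (continuous_subspaceT cf).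
  rewrite distrC E normrM (distrC y) ler_wpM2r// HL//.
  by rewrite !ler0_norm ?subr_le0// ?(ltW yx)// !opprB lerD2l lerN2.
Qed.

(** The mean value inequality for [f] minus its tangent at [x], whose derivative is at most [K |h|]
    between [x] and [x + h]; the factor [1 / 2] is given up. *)
Lemma taylor1_bound f df d2f (K x h : R) : (forall z : R, is_derive z (1 : R) f (df z)) ->
  (forall z : R, is_derive z (1 : R) df (d2f z)) -> (forall z, `|d2f z| <= K) ->
  `|f (x + h) - f x - df x * h| <= K * `|h| * `|h|.
Proof.
move=> f1 f2 K2; have K0 : 0 <= K by exact: le_trans (K2 0).
have g1 (z : R) : is_derive z (1 : R) (f - (df x \*: id)) (df z - df x).
  have := f1 z => ?; by apply: is_derive_eq; rewrite /GRing.scale/= mulr1.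
have xh : x + h - x = h by ring.
have := @mvt_bound _ _ x (x + h) (K * `|h|) g1.
rewrite xh => H; apply: le_trans (H _).
  rewrite le_eqVlt; apply/orP; left; apply/eqP; congr (`|_|).
  by rewrite -[RHS]/(f (x + h) - df x * (x + h) - (f x - df x * x)); ring.
move=> z zx; apply: (le_trans (mvt_bound f2 (fun y _ => K2 y))).
by rewrite ler_wpM2l.
Qed.

(** The mean value inequality again, for [f] minus its second Taylor polynomial; the derivative is
    bounded by [taylor1_bound] for [df]. *)
Lemma taylor2_bound f df d2f d3f (K x h : R) : (forall z : R, is_derive z (1 : R) f (df z)) ->
  (forall z : R, is_derive z (1 : R) df (d2f z)) ->
  (forall z : R, is_derive z (1 : R) d2f (d3f z)) -> (forall z, `|d3f z| <= K) ->
  `|f (x + h) - f x - df x * h - 2^-1 * d2f x * h ^+ 2| <= K * (`|h| * h ^+ 2).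
Proof.
move=> f1 f2 f3 K3; have K0 : 0 <= K by exact: le_trans (K3 0).
have g1 (z : R) : is_derive z (1 : R)
    (f - (df x \*: id) - ((2^-1 * d2f x) \*: ((id - cst x) ^+ 2)))
    (df z - df x - d2f x * (z - x)).
  by have := f1 z => ?; apply: is_derive_eq; rewrite /GRing.scale/= !fctE /=; field.
have xh : x + h - x = h by ring.
have := @mvt_bound _ _ x (x + h) (K * `|h| * `|h|) g1.
rewrite xh => H.
apply: (@le_trans _ _ (K * `|h| * `|h| * `|h|)); first apply: le_trans (H _).
- rewrite le_eqVlt; apply/orP; left; apply/eqP; congr (`|_|).
  rewrite -[RHS]/(f (x + h) - df x * (x + h) - 2^-1 * d2f x * (x + h - x) ^+ 2 -
    (f x - df x * x - 2^-1 * d2f x * (x - x) ^+ 2)); ring.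
- move=> z zx; have := taylor1_bound x (z - x) f2 f3 K3.
  rewrite (addrC x) subrK => /le_trans; apply.
  by rewrite !ler_pM// ?mulr_ge0// ler_wpM2l.
- by rewrite -(real_normK (num_real h)) le_eqVlt; apply/orP; left; apply/eqP; ring.
Qed.

(** In an increment [a + c] of the solution, [a] is the Brownian part, whose
    fourth moment is of order [dt ^ 2], and [c] the rest, of which only the second
    moment is under control; hence no third power of [c] may occur. *)
Lemma ito_taylor_bound f df d2f d3f (K x a c e : R) :
  (forall z : R, is_derive z (1 : R) f (df z)) ->
  (forall z : R, is_derive z (1 : R) df (d2f z)) ->
  (forall z : R, is_derive z (1 : R) d2f (d3f z)) ->
  (forall z, `|d2f z| <= K) -> (forall z, `|d3f z| <= K) -> 0 < e <= 1 ->
  `|f (x + (a + c)) - f x - df x * (a + c) - 2^-1 * d2f x * a ^+ 2|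
    <= 2 * K * (e * a ^+ 2 + e^-1 * a ^+ 4 + e^-1 * c ^+ 2).
Proof.
move=> f1 f2 f3 K2 K3 /andP[e0 e1]; have K0 : 0 <= K by exact: le_trans (K3 0).
have h1 := taylor2_bound x a f1 f2 f3 K3.
have h2 := taylor1_bound (x + a) c f1 f2 K2.
have h3 : `|(df (x + a) - df x) * c| <= K * `|a| * `|c|.
  rewrite normrM ler_wpM2r//; have := @mvt_bound _ _ x (x + a) K f2 (fun y _ => K2 y).
  by rewrite (_ : x + a - x = a)//; ring.
(* Second order from [x] to [x + a], but only first order from [x + a] onwards, so that [c] occurs
   at most squared; the slopes at [x] and [x + a] differ by at most [K |a|]. *)
have -> : f (x + (a + c)) - f x - df x * (a + c) - 2^-1 * d2f x * a ^+ 2 =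
    (f (x + a) - f x - df x * a - 2^-1 * d2f x * a ^+ 2) +
    ((f (x + a + c) - f (x + a) - df (x + a) * c) + (df (x + a) - df x) * c).
  by rewrite addrA; ring.
have ei : 1 <= e^-1 by rewrite invr_ge1 ?unitfE ?gt_eqF.
have q1 : `|a| * a ^+ 2 <= e * a ^+ 2 + e^-1 * a ^+ 4.
  have := ler_wpM2r (sqr_ge0 a) (normr_le_sqr a e0).
  by rewrite mulrDl -mulrA -exprD.
have q2 : `|c| * `|c| <= e^-1 * c ^+ 2.
  by rewrite -expr2 real_normK ?num_real// ler_peMl ?sqr_ge0.
have q3 : `|a| * `|c| <= e * a ^+ 2 + e^-1 * c ^+ 2.
  have c0 := normr_ge0 c; have a0 := normr_ge0 a.
  rewrite -(real_normK (num_real a)) -(real_normK (num_real c)).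
  rewrite -(ler_pM2l e0) mulrDr !mulrA mulfV ?gt_eqF// mul1r.
  have := sqr_ge0 (e * `|a| - `|c|).
  have : 0 <= e * `|a| * `|c| by rewrite !mulr_ge0// ltW.
  move: (`|a|) (`|c|) => A D; nra.
have q4 : 0 <= e^-1 * a ^+ 4 by rewrite mulr_ge0 ?exprn_even_ge0// invr_ge0 ltW.
apply: le_trans (ler_normD _ _) _.
apply: (@le_trans _ _ (K * (e * a ^+ 2 + e^-1 * a ^+ 4) +
   (K * (e^-1 * c ^+ 2) + K * (e * a ^+ 2 + e^-1 * c ^+ 2)))).
  apply: lerD; first by apply: le_trans h1 _; rewrite ler_wpM2l.
  apply: le_trans (ler_normD _ _) _; apply: lerD.
    by apply: le_trans h2 _; rewrite -mulrA ler_wpM2l.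
  by apply: le_trans h3 _; rewrite -mulrA ler_wpM2l.
have := mulr_ge0 K0 q4; lra.
Qed.

Lemma schwartz_is_derive phi n (x : R) : schwartz phi ->
  is_derive x (1 : R) (derive1n n phi) (derive1n n.+1 phi x).
Proof. by move=> [/(_ n x) /derivableP]; rewrite -derive1E. Qed.

Lemma schwartz_continuous phi n : schwartz phi -> continuous (derive1n n phi).
Proof. by move=> [H _] x; apply/differentiable_continuous/derivable1_diffP. Qed.

Lemma schwartz_bounded phi n : schwartz phi ->
  exists2 K : R, 0 <= K & forall x, `|derive1n n phi x| <= K.
Proof.
move=> [_ /(_ 0%N n)[K HK]]; exists K => [|x].
  exact: le_trans (HK 0).
by rewrite -[X in `|X|]mul1r -(expr0 x).
Qed.

Lemma schwartz_ito_bounds phi : schwartz phi -> exists K : R,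
  [/\ forall x, `|derive1 phi x| <= K, forall x, `|derive1 (derive1 phi) x| <= K,
      forall x y, `|derive1 phi x - derive1 phi y| <= K * `|x - y|,
      forall x y, `|derive1 (derive1 phi) x - derive1 (derive1 phi) y| <= K * `|x - y|
    & forall x a c e, 0 < e <= 1 ->
      `|phi (x + (a + c)) - phi x - derive1 phi x * (a + c)
        - 2^-1 * derive1 (derive1 phi) x * a ^+ 2|
      <= K * (e * a ^+ 2 + e^-1 * a ^+ 4 + e^-1 * c ^+ 2)].
Proof.
move=> sphi; have d n (x : R) := @schwartz_is_derive phi n x sphi.
have [K1 K10 b1] := schwartz_bounded 1 sphi.
have [K2 K20 b2] := schwartz_bounded 2 sphi.
have [K3 K30 b3] := schwartz_bounded 3 sphi.
have K0 : 0 <= K2 + K3 by rewrite addr_ge0.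
(* [2 (K2 + K3)] is the constant of [ito_taylor_bound] when [K2 + K3] bounds both the second and the
   third derivative. *)
exists (K1 + 2 * (K2 + K3)); split.
- by move=> x; apply: le_trans (b1 x) _; lra.
- by move=> x; apply: le_trans (b2 x) _; lra.
- move=> x y; apply: (le_trans (mvt_bound (d 1%N) (fun z _ => b2 z))).
  by rewrite ler_wpM2r//; lra.
- move=> x y; apply: (le_trans (mvt_bound (d 2%N) (fun z _ => b3 z))).
  by rewrite ler_wpM2r//; lra.
- move=> x a c e e01; have [e0 _] := andP e01.
  have b2' z : `|derive1n 2 phi z| <= K2 + K3 by apply: le_trans (b2 z) _; lra.
  have b3' z : `|derive1n 3 phi z| <= K2 + K3 by apply: le_trans (b3 z) _; lra.
  apply: (le_trans (ito_taylor_bound x a c (d 0%N) (d 1%N) (d 2%N) b2' b3' e01)).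
  rewrite ler_wpM2r//; last by lra.
  by rewrite !addr_ge0// mulr_ge0 ?exprn_even_ge0// ?invr_ge0 ltW.
Qed.

End taylor.

(** * The Donsker delta measure *)

Section dirac.
Context {R : realType} {d : measure_display} {Omega : measurableType d}.
Variable P : probability Omega R.

Lemma ae_forall_countable (I : countType) (Q : I -> Omega -> Prop) :
  (forall i, {ae P, forall w, Q i w}) -> {ae P, forall w, forall i, Q i w}.
Proof.
move=> HQ.
have H n : {ae P, forall w, forall i, unpickle n = Some i -> Q i w}.
  case E : (unpickle n) => [i|]; last by apply: aeW.
  by apply: filterS (HQ i) => w Qw j [<-].
apply: filterS (ae_foralln H) => w Hw i.
by apply: (Hw (pickle i)); rewrite pickleK.
Qed.

(** The complement of [x] is a countable union of null rays. *)
Lemma measure_set1C_eq0 (m : probability (measurableTypeR R) R) (x : R) :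
  (forall q : rat, ratr q < x -> m `]-oo, ratr q]%classic = 0%E) ->
  (forall q : rat, x <= ratr q -> m `]ratr q, +oo[%classic = 0%E) ->
  forall A : set (measurableTypeR R), measurable A -> m A = \d_x A.
Proof.
move=> ml mr.
have [u uP] : exists u : nat -> option rat, forall q, exists n, u n = Some q.
  by exists unpickle => q; exists (pickle q); rewrite pickleK.
pose Fn n : set (measurableTypeR R) := if u n is Some q then
   if ratr q < x then `]-oo, ratr q]%classic else `]ratr q, +oo[%classic else set0.
have nF : m.-negligible (\bigcup_n Fn n).
  apply: negligible_bigcup => n; rewrite /Fn; case: (u n) => [q|]; last exact: negligible_set0.
  case: ltP => qx; apply/negligibleP; [exact: measurable_itv|exact: ml|exact: measurable_itv|exact: mr].
have n1 : m.-negligible (~` [set x]).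
  apply: negligibleS nF => y /= yx.
  have [lt_yx|lt_xy|//] := ltgtP y x.
    have [q] := rat_in_itvoo lt_yx; rewrite in_itv/= => /andP[yq qx].
    by have [n un] := uP q; exists n => //; rewrite /Fn un qx /= in_itv/= ltW.
  have [q] := rat_in_itvoo lt_xy; rewrite in_itv/= => /andP[xq qy].
  by have [n un] := uP q; exists n => //; rewrite /Fn un ltNge (ltW xq) /= in_itv/= qy.
move=> A mA; rewrite diracE; have [xA|xA] := boolP (x \in A).
  have h : m (~` A) = 0%E.
    apply/negligibleP; first exact: measurableC.
    by apply: negligibleS n1 => y yA /= yx; apply: yA; rewrite yx; rewrite inE in xA.
  have := probability_setC m (measurableC mA).
  by rewrite h sube0 setCK.
apply/negligibleP => //; apply: negligibleS n1 => y yA /= yx.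
by move: xA; rewrite -yx notin_setE.
Qed.

End dirac.

Section solution.
Context {R : realType} {d : measure_display} {Omega : measurableType d}.
Variables (P : probability Omega R) (B : R -> {RV P >-> R}) (Z : {RV P >-> R}).
Variables (T : R) (X : R -> {RV P >-> R}).
Variable mu : R -> Omega -> probability (measurableTypeR R) R.
Local Notation F := (filtration_of Z B).
Hypothesis XF : forall t, 0 <= t <= T -> measurable_wrt (T' := measurableTypeR R) (F t) (X t).
Hypothesis Xmu : regular_cond_distr P F T X mu.

Lemma cond_distr_indic t (A : set (measurableTypeR R)) : 0 <= t <= T -> measurable A ->
  is_condexp P (F t) (fun w => \1_A (X t w)) (fun w => mu t w A).
Proof.
move=> tT mA.
have mI : measurable_fun setT (\1_A : measurableTypeR R -> measurableTypeR R).
  exact: measurable_indic.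
have iI : P.-integrable setT (fun w => (\1_A (X t w) : R)%:E).
  apply: (@measurable_bounded_integrable _ _ _ P (fun w => \1_A (X t w))) => //.
  - by have := probability_setT P => /= ->; rewrite ltry.
  - exact: measurableT_comp.
  - exists 1; split; first exact: num_real.
    move=> x x1 w _ /=; rewrite indicE (le_trans _ (ltW x1))//.
    by rewrite ger0_norm// lern1 leq_b1.
have := Xmu tT mI iI.
rewrite (_ : (fun w => _) = fun w => mu t w A)//.
by apply/funext => w; rewrite integral_indic// setIT.
Qed.

(** The event that [X t] is outside [A] belongs to [F t], and on it the conditional probability has
    the same integral as the indicator of [A] at [X t], namely zero; being nonnegative, it vanishes
    almost surely there. *)
Lemma cond_distr_notin t (A : set (measurableTypeR R)) : 0 <= t <= T -> measurable A ->
  {ae P, forall w, ~ A (X t w) -> mu t w A = 0%E}.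
Proof.
move=> tT mA; have [_ /measurable_int mV HV] := cond_distr_indic tT mA.
pose A' := X t @^-1` (~` A).
have FA' : F t A' by apply: XF => //; exact: measurableC.
have mA' : measurable A' by exact: filtration_measurable FA'.
have E0 : (\int[P]_(w in A') (\1_A (X t w))%:E = 0)%E.
  by apply: integral0_eq => w wA; rewrite indicE memNset.
have := HV _ FA'; rewrite E0.
have mV' : measurable_fun A' (fun w => mu t w A) by exact: measurable_funTS.
rewrite (_ : (\int[P]_(w in A') _ = \int[P]_(w in A') `|mu t w A|)%E); last first.
  by apply: eq_integral => w _; rewrite gee0_abs.
move=> /(ae_eq_integral_abs P mA' mV').
by apply: filterS => w H wA; apply: H.
Qed.

Lemma cond_distr_mean t (A : set (measurableTypeR R)) : 0 <= t <= T -> measurable A ->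
  (\int[P]_w mu t w A = distribution P (X t) A)%E.
Proof.
move=> tT mA; have [_ _ HV] := cond_distr_indic tT mA.
have FT : F t setT by rewrite -(preimage_setT (X t)); exact: XF.
have mXA : measurable (X t @^-1` A) by exact: measurable_funPTI.
rewrite HV//; transitivity (P (X t @^-1` A `&` setT)); last by rewrite setIT.
by rewrite -(integral_indic P measurableT mXA).
Qed.

(** The exceptional null set of [cond_distr_notin] depends on the Borel set. Rays with rational ends
    are countably many, and their masses already force a Dirac measure, so one null set serves all
    Borel sets. *)
Lemma mu_dirac t : 0 <= t <= T ->
  {ae P, forall w, forall A : set (measurableTypeR R), measurable A -> mu t w A = \d_(X t w) A}.
Proof.
move=> tT.
have h1 (q : rat) : {ae P, forall w, ratr q < X t w -> mu t w `]-oo, ratr q]%classic = 0%E}.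
  apply: filterS (cond_distr_notin tT (measurable_itv `]-oo, ratr q])) => w H qX; apply: H.
  by rewrite /= in_itv/= => /le_lt_trans/(_ qX); rewrite ltxx.
have h2 (q : rat) : {ae P, forall w, X t w <= ratr q -> mu t w `]ratr q, +oo[%classic = 0%E}.
  apply: filterS (cond_distr_notin tT (measurable_itv `]ratr q, +oo[)) => w H qX; apply: H.
  by rewrite /= in_itv/= andbT => /lt_le_trans/(_ qX); rewrite ltxx.
apply: filterS2 (ae_forall_countable h1) (ae_forall_countable h2) => w H1 H2.
exact: measure_set1C_eq0.
Qed.

End solution.

Section dirac_density.
Context {R : realType}.
Variables (m : probability (measurableTypeR R) R) (x : R).
Hypothesis mx : forall A : set (measurableTypeR R), measurable A -> m A = \d_x A.

Lemma density_dirac (f phi : measurableTypeR R -> R) : measurable_fun setT f ->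
  measurable_fun setT phi -> density f m phi = f x * phi x.
Proof.
move=> mf mphi; rewrite /density /Rintegral.
have E := @eq_measure_integral _ (measurableTypeR R) R setT (\d_(x : measurableTypeR R)) m
  (fun y => (f y * phi y)%:E) (fun A mA _ => mx mA).
rewrite E integral_dirac//; last by apply/measurable_EFinP; exact: measurable_funM.
by rewrite diracE in_setT mul1e.
Qed.

End dirac_density.

(** * Measurable modifications *)

Lemma integral_bound0_ae d (T : measurableType d) (R : realType)
    (m : {measure set T -> \bar R}) (f : T -> R) :
  integral_bound m f 0 -> {ae m, forall x, f x = 0}.
Proof.
move=> [mf f0 fa].
have mfE : measurable_fun setT (EFin \o f) by exact/measurable_EFinP.
have E : (\int[m]_x `|(EFin \o f) x| = 0)%E.
  apply/eqP; rewrite eq_le; apply/andP; split; last exact: integral_ge0.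
  apply: le_trans fa; rewrite le_eqVlt; apply/orP; left; apply/eqP.
  by apply: eq_integral => x _; rewrite /= ger0_norm.
have /(ae_eq_integral_abs m measurableT mfE) := E.
have FM : Filter (almost_everywhere m) by exact: (ae_filter_ringOfSetsType m).
by apply: filterS => x /(_ I) [].
Qed.

Lemma cvge0_le (R : realType) (u : nat -> \bar R) (e : R) : u n @[n --> \oo] --> 0%E ->
  0 < e -> exists n0, forall n, (n0 <= n)%N -> (u n <= e%:E)%E.
Proof.
move=> u0 e0.
have /u0 [n0 _ H] : nbhs (0%:E : \bar R) [set x | (x < e%:E)%E].
  by apply: open_nbhs_nbhs; split; [exact: open_ereal_lt_ereal|rewrite /= lte_fin].
by exists n0 => n /H /ltW.
Qed.

Section modification.
Context {R : realType} {d : measure_display} {Omega : measurableType d}.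
Variables (P : probability Omega R) (t : R).
Hypothesis t0 : 0 <= t.
Local Notation M := (time_space_measure P t).
Local Notation lambda := (@lebesgue_measure R).
Local Notation domain := (`[0, t] `*` setT : set (measurableTypeR R * Omega)%type).

Lemma measurable_integral_time s (f : measurableTypeR R * Omega -> R) :
  measurable_fun setT f -> (forall p, 0 <= f p) ->
  measurable_fun setT (fun w => \int[lambda]_(r in `[0%R, s]) (f (r, w))%:E)%E.
Proof.
move=> mf f0.
have mE : measurable_fun setT (EFin \o f) by exact/measurable_EFinP.
have E0 p : (0 <= (EFin \o f) p)%E by rewrite lee_fin.
have := measurable_fun_fubini_tonelli_G (m1 := time_measure s) _ mE E0.
congr (measurable_fun _ _); apply/funext => w.
by rewrite /fubini_G integral_time_measure//; exact: measurable_fun_pair1.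
Qed.

Lemma integral_bound_time_spaceS s (f : measurableTypeR R * Omega -> R) a : 0 <= s <= t ->
  integral_bound M f a -> integral_bound (time_space_measure P s) f a.
Proof.
move=> /andP[s0 st] [mf f0 fa]; split; [exact: mf|exact: f0|].
rewrite (integral_time_space P t mf f0) in fa.
rewrite (integral_time_space P s mf f0); apply: le_trans fa.
apply: ge0_le_integral => //.
- by move=> w _; apply: integral_ge0 => r _; rewrite lee_fin.
- exact: measurable_integral_time.
- exact: measurable_integral_time.
move=> w _; apply: ge0_subset_integral => //.
- by apply/measurable_EFinP; apply: measurable_funTS; exact: measurable_fun_pair1.
- by move=> r _; rewrite lee_fin.
- by move=> r; rewrite /= !in_itv/= => /andP[-> /le_trans]; apply.
Qed.

Let mdomain : measurable domain.
Proof. by apply: measurableX => //; exact: measurable_itv. Qed.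

(** [K] is extended by zero outside the time interval and truncated to [[- C, C]]; where it agrees
    with [H], the truncation changes nothing. *)
Lemma measurable_modification_patch (H K : R -> Omega -> R) (C : R) : 0 <= C ->
  (forall s w, 0 <= s <= t -> `|H s w| <= C) ->
  measurable_modification P t H K ->
  exists g : measurableTypeR R * Omega -> R, [/\ measurable_fun setT g,
    forall p, `|g p| <= C & forall s, 0 <= s <= t -> {ae P, forall w, H s w = g (s, w)}].
Proof.
move=> C0 HC [HK mK].
have mK' := (measurable_restrictT (fun p => K p.1 p.2 : measurableTypeR R) mdomain).1 mK.
exists (fun p => Num.max (- C) (Num.min C (((fun p => K p.1 p.2) \_ domain) p))); split.
- by apply: measurable_maxr => //; exact: measurable_minr.
- move=> p; rewrite ler_norml le_max lexx/= ge_max ge_min lexx andbT.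
  by have := C0; lra.
- move=> s st; apply: filterS (HK _ st) => w Hw.
  rewrite patchE mem_set; last by split => //=; rewrite in_itv.
  have := HC _ w st; rewrite Hw ler_norml => /andP[h1 h2].
  by rewrite /= (min_idPr h2) (max_idPr h1).
Qed.

Variables (K : R -> Omega -> R) (g : measurableTypeR R * Omega -> R).
Hypothesis mK : measurable_fun domain (fun p => K p.1 p.2 : measurableTypeR R).
Hypothesis mg : measurable_fun setT g.
Hypothesis Kg : forall s, 0 <= s <= t -> {ae P, forall w, K s w = g (s, w)}.

(** Equality almost surely at each time becomes, by Tonelli's theorem, equality at almost every time
    along almost every path. The difference is capped at 1 so that the bounds for bounded processes
    apply to it. *)
Lemma modification_ae : {ae P, forall w,
  {ae lambda, forall s, `[0, t]%classic s -> K s w = g (s, w)}}.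
Proof.
pose Kp : measurableTypeR R * Omega -> R := (fun p => K p.1 p.2) \_ domain.
have mKp : measurable_fun setT Kp.
  exact: (measurable_restrictT (fun p => K p.1 p.2 : measurableTypeR R) mdomain).1 mK.
pose f p := Num.min 1 `|Kp p - g p|.
have mf : measurable_fun setT f.
  apply: measurable_minr => //; apply: measurableT_comp => //; exact: measurable_funB.
have f0 p : 0 <= f p by rewrite le_min ler01 normr_ge0.
have f1 p : `|f p| <= 1 by rewrite ger0_norm// ge_min lexx.
have fb : integral_bound M f (t * 0).
  apply: integral_bound_time_space => // s /andP[s0 st].
  have st' : 0 <= s <= t by rewrite ltW.
  have mfs : measurable_fun setT (fun w => (f (s, w))%:E).
    by apply/measurable_EFinP; exact: measurable_fun_pair2.
  rewrite (@ae_eq_integral _ _ _ P setT (cst 0%E))//; first by rewrite integral0.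
  apply: filterS (Kg st') => w Hw _; congr EFin.
  rewrite /f /Kp patchE mem_set; last by split => //=; rewrite in_itv.
  by rewrite /= Hw subrr normr0 min_r.
rewrite mulr0 in fb.
have fb' : integral_bound M (fun p => `|f p|) 0.
  by apply: integral_bound_eq fb => p; rewrite ger0_norm.
have /integral_bound0_ae := integral_bound_time_integral t0 mf f1 fb'.
apply: filterS => w /normr0P/eqP Hw.
have mfw : measurable_fun `[0, t]%classic (fun s : measurableTypeR R => (f (s, w))%:E).
  by apply/measurable_EFinP; apply: measurable_funTS; exact: measurable_fun_pair1.
have E : (\int[lambda]_(s in `[0%R, t]) `|(f (s, w))%:E| = 0)%E.
  have ifw := bounded_integrable mf f1 0 t w.
  rewrite (eq_integral (fun s : measurableTypeR R => (f (s, w))%:E)); last first.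
    by move=> s _; rewrite gee0_abs ?lee_fin.
  by rewrite -(fineK (integrable_fin_num _ ifw))//; congr EFin.
have mI : measurable (`[0, t]%classic : set (measurableTypeR R)) by exact: measurable_itv.
have := (ae_eq_integral_abs lambda mI mfw).1 E.
apply: filterS => s H st; have {}H := H st.
case: H => /eqP; rewrite /f minEle; case: ifPn => [_|_]; first by rewrite oner_eq0.
rewrite normr_eq0 subr_eq0 => /eqP <-.
by rewrite /Kp patchE mem_set.
Qed.

Lemma modification_measurable_section w :
  measurable_fun `[0, t]%classic (fun s : measurableTypeR R => K s w : measurableTypeR R).
Proof.
have mp : measurable_fun `[0, t]%classic (fun s : measurableTypeR R => (s, w)).
  by apply: measurable_funTS; exact: measurable_pair2.
apply: (measurable_comp mdomain _ mK mp).
by move=> _ [s st <-].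
Qed.

Lemma modification_time_integral :
  {ae P, forall w, \int[lambda]_(s in `[0, t]) K s w = time_integral t g w}.
Proof.
apply: filterS modification_ae => w Hw; rewrite /time_integral /Rintegral; congr fine.
apply: ae_eq_integral => //.
- by apply/measurable_EFinP; exact: modification_measurable_section.
- by apply/measurable_EFinP; apply: measurable_funTS; exact: measurable_fun_pair1.
- have FL : Filter (almost_everywhere lambda) := ae_filter_ringOfSetsType lambda.
  by apply: filterS Hw => s H st; rewrite H.
Qed.

Lemma modification_integral_sqr (F : R -> set (set Omega)) (h : simple_process F) :
  measurable_fun setT (fun p : measurableTypeR R * Omega => sp_eval h p.1 p.2) ->
  (\int[P]_w \int[lambda]_(s in `[0%R, t]) ((K s w - sp_eval h s w) ^+ 2)%:E
   = \int[M]_p ((g p - sp_eval h p.1 p.2) ^+ 2)%:E)%E.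
Proof.
move=> mh.
pose Kp : measurableTypeR R * Omega -> R := (fun p => K p.1 p.2) \_ domain.
have mKp : measurable_fun setT Kp.
  exact: (measurable_restrictT (fun p => K p.1 p.2 : measurableTypeR R) mdomain).1 mK.
pose f1 (p : measurableTypeR R * Omega) := (Kp p - sp_eval h p.1 p.2) ^+ 2.
pose f2 (p : measurableTypeR R * Omega) := (g p - sp_eval h p.1 p.2) ^+ 2.
have mf1 : measurable_fun setT f1 by apply: measurable_funX; exact: measurable_funB.
have mf2 : measurable_fun setT f2 by apply: measurable_funX; exact: measurable_funB.
have f10 p : 0 <= f1 p by exact: sqr_ge0.
have f20 p : 0 <= f2 p by exact: sqr_ge0.
have KpE s w : `[0, t]%classic s -> Kp (s, w) = K s w.
  by move=> st; rewrite /Kp patchE mem_set.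
rewrite (integral_time_space P t mf2 f20).
transitivity (\int[P]_w \int[lambda]_(s in `[0%R, t]) (f1 (s, w))%:E)%E.
  apply: eq_integral => w _; apply: eq_integral => s; rewrite inE => st.
  by rewrite /f1 KpE.
apply: ae_eq_integral => //; [exact: measurable_integral_time|exact: measurable_integral_time|].
apply: filterS modification_ae => w Hw _; apply: ae_eq_integral => //.
- by apply/measurable_EFinP; apply: measurable_funTS; exact: measurable_fun_pair1.
- by apply/measurable_EFinP; apply: measurable_funTS; exact: measurable_fun_pair1.
- have FL : Filter (almost_everywhere lambda) := ae_filter_ringOfSetsType lambda.
  by apply: filterS Hw => s H st; rewrite /f1 /f2 KpE ?H.
Qed.

End modification.

(** * Integrals of simple processes and their limits *)

(** Monotone convergence in the level of truncation. It yields square integrability where only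
    bounds on the truncated squares are at hand. *)
Lemma integral_bound_sqr_truncate d (T : measurableType d) (R : realType)
    (m : {measure set T -> \bar R}) (f : T -> R) (a : R) : measurable_fun setT f ->
  (forall n : nat, integral_bound m (fun x => Num.min (f x ^+ 2) (n%:R ^+ 2)) a) ->
  integral_bound m (fun x => f x ^+ 2) a.
Proof.
move=> mf H; split => [|x|]; [exact: measurable_funX|exact: sqr_ge0|].
pose g n x := (Num.min (f x ^+ 2) (n%:R ^+ 2))%:E.
have cg x : g n x @[n --> \oo] --> (f x ^+ 2)%:E.
  apply: cvg_near_cst; exists (Num.truncn `|f x|).+1 => // n /= fn.
  congr EFin; apply/min_idPl; rewrite -(real_normK (num_real (f x))) lerXn2r ?nnegrE//.
  by rewrite (le_trans (ltW (truncnS_gt _)))// ler_nat.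
have -> : (\int[m]_x (f x ^+ 2)%:E)%E = (\int[m]_x limn (g ^~ x))%E.
  by apply: eq_integral => x _; apply/esym/cvg_lim => //; exact: cg.
rewrite monotone_convergence//.
- apply: lime_le.
    apply: ereal_nondecreasing_is_cvgn => i j ij; apply: ge0_le_integral => //.
    + by move=> x _; have [_ h _] := H i; rewrite lee_fin h.
    + by apply/measurable_EFinP; case: (H i).
    + by apply/measurable_EFinP; case: (H j).
    + move=> x _; rewrite lee_fin le_min ge_min lexx/= ge_min.
      by apply/orP; right; rewrite lerXn2r ?nnegrE// ler_nat.
  by apply: nearW => n; case: (H n).
- by move=> n; apply/measurable_EFinP; case: (H n).
- by move=> n x _; have [_ h _] := H n; rewrite lee_fin h.
- move=> x _ i j ij; rewrite lee_fin le_min ge_min lexx/= ge_min.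
  by apply/orP; right; rewrite lerXn2r ?nnegrE// ler_nat.
Qed.

Section ito_integral.
Context {R : realType} {d : measure_display} {Omega : measurableType d}.
Variables (P : probability Omega R) (B : R -> {RV P >-> R}) (Z : {RV P >-> R}).
Local Notation F := (filtration_of Z B).
Hypothesis BM : brownian_motion B.
Hypothesis ZB : independent P (sigma_rv Z) (sigma_process `[0, +oo[ B).
Local Notation M := (time_space_measure P).

Lemma sp_integral_measurable (h : simple_process F) t : measurable_fun setT (sp_integral B h t).
Proof.
apply: measurable_sum => i; apply: measurable_funM; last exact: measurable_funB.
exact: measurable_wrt_measurable_fun (sp_adapted (ltn_ord i)).
Qed.

(** The isometry for [h1 - h2] on a grid adapted to both, together with [(h1 - h2) ^ 2 <= 2 (g - h1)
    ^ 2 + 2 (g - h2) ^ 2]. *)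
Lemma sp_integral_distance t (h1 h2 : simple_process F)
    (g : measurableTypeR R * Omega -> R) a1 a2 : 0 <= t ->
  integral_bound (M t) (fun p => (g p - sp_eval h1 p.1 p.2) ^+ 2) a1 ->
  integral_bound (M t) (fun p => (g p - sp_eval h2 p.1 p.2) ^+ 2) a2 ->
  integral_bound P (fun w => (sp_integral B h1 t w - sp_integral B h2 t w) ^+ 2)
    (2 * a1 + 2 * a2).
Proof.
move=> t0 b1 b2.
have [v [N [gv _ vx]]] := exists_grid (sp_times h1 ++ sp_times h2) t0 ltr01.
have v1 x : x \in sp_times h1 -> splits v N x by move=> xh; apply: vx; rewrite mem_cat xh.
have v2 x : x \in sp_times h2 -> splits v N x by move=> xh; apply: vx; rewrite mem_cat xh orbT.
pose G j w := left_value h1 (v j) w - left_value h2 (v j) w.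
have bf := integral_boundD (integral_boundZ (ler0n _ 2) b1) (integral_boundZ (ler0n _ 2) b2).
have vN : v N = t by case: gv.
apply: (@integral_bound_eq _ _ _ P (fun w => (\sum_(j < N) G j w * (B (v j.+1) w - B (v j) w)) ^+ 2)).
  move=> w; rewrite -vN (sp_integral_grid gv v1 w (leqnn N)) (sp_integral_grid gv v2 w (leqnn N)).
  by rewrite -sumrB; congr (_ ^+ 2); apply: eq_bigr => j _; rewrite mulrBl.
apply: (integral_bound_increment_sum_time_space gv BM ZB (G := G) _ _ _ bf).
- by move=> j jN; apply: measurable_wrtB; exact: left_value_measurable_wrt.
- move=> j jN; have [K1 _ H1] := left_value_bounded h1; have [K2 _ H2] := left_value_bounded h2.
  by exists (K1 + K2) => w; apply: le_trans (ler_normB _ _) _; exact: lerD.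
- move=> j s w jN sj; rewrite (sp_eval_grid v1 w jN sj) (sp_eval_grid v2 w jN sj) /G /=.
  set x1 := left_value _ _ _; set x2 := left_value _ _ _.
  by have := sqr_ge0 (g (s, w) - x1 + (g (s, w) - x2)); move: (g (s, w)) => y; nra.
Qed.

Section approx.
Variable g : measurableTypeR R * Omega -> R.
Hypothesis mg : measurable_fun setT g.

Lemma ito_integral_approx t (H : R -> Omega -> R) (I : Omega -> R) : 0 <= t ->
  (forall s, 0 <= s <= t -> {ae P, forall w, H s w = g (s, w)}) ->
  is_ito_integral P F B H t I ->
  exists h : nat -> simple_process F,
  (forall e, 0 < e -> exists n0, forall n, (n0 <= n)%N ->
    integral_bound (M t) (fun p => (g p - sp_eval (h n) p.1 p.2) ^+ 2) e) /\
  (forall e, 0 < e -> exists n0, forall n, (n0 <= n)%N ->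
    integral_bound P (fun w => (I w - sp_integral B (h n) t w) ^+ 2) e).
Proof.
move=> t0 Hg [mI [K [h [[HK mK] hK hI]]]]; exists h.
have Kg s : 0 <= s <= t -> {ae P, forall w, K s w = g (s, w)}.
  by move=> st; apply: filterS2 (HK _ st) (Hg _ st) => w <-.
split => e e0.
- have [n0 n0P] := cvge0_le hK e0; exists n0 => n /n0P.
  rewrite (modification_integral_sqr t0 mK mg Kg)//; last exact: sp_eval_measurable.
  move=> b; split; [|by move=> p; exact: sqr_ge0|exact: b].
  by apply: measurable_funX; apply: measurable_funB => //; exact: sp_eval_measurable.
- have [n0 n0P] := cvge0_le hI e0; exists n0 => n /n0P b.
  split; [|by move=> p; exact: sqr_ge0|exact: b].
  by apply: measurable_funX; apply: measurable_funB => //; exact: sp_integral_measurable.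
Qed.

(** The integral up to [s] comes with its own approximating sequence [h']. As [h] and [h']
    approximate the same integrand on [[0, s]], the isometry brings their integrals together, so the
    sequence chosen for [t] serves every earlier time. The errors are
    [2 e / 10 + 2 (2 e / 10 + 2 e / 10) = e]. *)
Lemma ito_integral_approx_le s t (h : nat -> simple_process F) (H : R -> Omega -> R)
    (I : Omega -> R) : 0 <= s <= t ->
  (forall s, 0 <= s <= t -> {ae P, forall w, H s w = g (s, w)}) ->
  (forall e, 0 < e -> exists n0, forall n, (n0 <= n)%N ->
    integral_bound (M t) (fun p => (g p - sp_eval (h n) p.1 p.2) ^+ 2) e) ->
  is_ito_integral P F B H s I ->
  forall e, 0 < e -> exists n0, forall n, (n0 <= n)%N ->
    integral_bound P (fun w => (I w - sp_integral B (h n) s w) ^+ 2) e.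
Proof.
move=> st Hg hh HI e e0; have [s0 st'] := andP st.
have t0 := le_trans s0 st'.
have e10 : 0 < e / 10 by rewrite divr_gt0.
have Hg' r : 0 <= r <= s -> {ae P, forall w, H r w = g (r, w)}.
  by move=> /andP[r0 rs]; apply: Hg; rewrite r0 (le_trans rs).
have mI : measurable_fun setT I by case: HI.
have [h' [h'g h'I]] := ito_integral_approx s0 Hg' HI.
have [n1 n1P] := h'g _ e10; have [n2 n2P] := h'I _ e10.
have [n0 n0P] := hh _ e10.
exists n0 => n /n0P /(integral_bound_time_spaceS st) b.
have b1 := n1P _ (leq_maxl n1 n2); have b2 := n2P _ (leq_maxr n1 n2).
set S' := sp_integral B (h' _) s in b2.
have b3 := sp_integral_distance s0 b1 b.
have b4 := integral_boundD (integral_boundZ (ler0n _ 2) b2) (integral_boundZ (ler0n _ 2) b3).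
apply: (integral_bound_le _ _ b4).
- by apply: measurable_funX; apply: measurable_funB => //; exact: sp_integral_measurable.
- move=> w; rewrite sqr_ge0/= -/S'; set S := sp_integral _ _ s w.
  by have := sqr_ge0 (I w - S' w - (S' w - S)); move: (I w) (S' w) => x y; nra.
- lra.
Qed.

(** For [x = I - S'] and [y = S' - S] one has
    [min ((x + y) ^ 2) (n ^ 2) <= 2 y ^ 2 + 2 n |x|]: with the isometry for [y],
    closeness in L1 of the integrals [S'] to [I] yields closeness in L2. *)
Lemma sp_integral_L2_limit t (I : Omega -> R) (h : simple_process F) a : 0 <= t ->
  measurable_fun setT I ->
  (forall e, 0 < e -> exists h' : simple_process F,
    integral_bound (M t) (fun p => (g p - sp_eval h' p.1 p.2) ^+ 2) e /\
    integral_bound P (fun w => `|I w - sp_integral B h' t w|) e) ->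
  integral_bound (M t) (fun p => (g p - sp_eval h p.1 p.2) ^+ 2) a ->
  integral_bound P (fun w => (I w - sp_integral B h t w) ^+ 2) (4 * a).
Proof.
move=> t0 mI HI ha; set S := sp_integral B h t.
have mS : measurable_fun setT S by exact: sp_integral_measurable.
apply: integral_bound_sqr_truncate => [|n]; first exact: measurable_funB.
apply: integral_bound_lim => e e0.
(* With [e / c] as the accuracy of [h'], the errors sum to [(4 + 2 n) e / c = e]; the level [n] is
   fixed before [h'] is chosen. *)
pose c : R := 4 + 2 * n%:R.
have n0 : 0 <= n%:R :> R by [].
have c0 : 0 < c by rewrite /c; lra.
have [h' [b1 b2]] := HI _ (divr_gt0 e0 c0).
have b3 := sp_integral_distance t0 b1 ha.
have b4 := integral_boundD (integral_boundZ (ler0n _ 2) b3)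
  (integral_boundZ (mulr_ge0 (ler0n _ 2) n0) b2).
apply: (integral_bound_le _ _ b4).
- by apply: measurable_minr => //; apply: measurable_funX; exact: measurable_funB.
- move=> w; rewrite -/S; set S' := sp_integral B h' t w; rewrite le_min !sqr_ge0/=.
  have -> : I w - S w = (I w - S') + (S' - S w) by ring.
  move: (I w - S') (S' - S w) => x y; rewrite ge_min.
  have x0 := normr_ge0 x; have y0 := sqr_ge0 y.
  have [xn|nx] := leP `|x| n%:R; apply/orP; [left|right].
    have : x ^+ 2 <= n%:R * `|x| by rewrite -(real_normK (num_real x)) expr2 ler_wpM2r.
    by have := sqr_ge0 (x - y); nra.
  have : n%:R ^+ 2 <= n%:R * `|x| by rewrite expr2 ler_wpM2l// ltW.
  nra.
- have E : c * (e / c) = e by rewrite mulrC divfK// gt_eqF.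
  have -> : 2 * (2 * (e / c) + 2 * a) + 2 * n%:R * (e / c) = 4 * a + c * (e / c).
    by rewrite /c; ring.
  by rewrite E.
Qed.

(** The sequence is chosen by the accuracy of the integrands alone, [1 / (n + 1)] at index [n];
    [sp_integral_L2_limit] then bounds the L2 distance of the integrals from [I] by four times
    this. *)
Lemma is_ito_integral_L1 t (H : R -> Omega -> R) (I : Omega -> R) : 0 <= t ->
  (forall s, 0 <= s <= t -> {ae P, forall w, H s w = g (s, w)}) ->
  measurable_fun setT I ->
  (forall e, 0 < e -> exists h : simple_process F,
    integral_bound (M t) (fun p => (g p - sp_eval h p.1 p.2) ^+ 2) e /\
    integral_bound P (fun w => `|I w - sp_integral B h t w|) e) ->
  is_ito_integral P F B H t I.
Proof.
move=> t0 Hg mI HI; split=> //.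
have [h hP] : exists h : nat -> simple_process F, forall n,
    integral_bound (M t) (fun p => (g p - sp_eval (h n) p.1 p.2) ^+ 2) (harmonic n).
  have H' n : exists h : simple_process F,
      integral_bound (M t) (fun p => (g p - sp_eval h p.1 p.2) ^+ 2) (harmonic n).
    by have [h [? _]] := HI _ (harmonic_gt0 n); exists h.
  by exists (fun n => projT1 (cid (H' n))) => n; exact: projT2 (cid (H' n)).
have ch (c : R) : ((c * harmonic n)%:E : \bar R) @[n --> \oo] --> 0%E.
  apply: cvg_EFin; first exact: nearW.
  by rewrite /= -(mulr0 c); apply: cvgMr; exact: cvg_harmonic.
exists (fun s w => g (s, w)), h; split.
- split=> //; apply: measurable_funTS.
  rewrite (_ : (fun p => _) = g)//; by apply/funext => -[].
- apply: (@squeeze_cvge _ _ _ _ (cst 0%E) _ (fun n => (1 * harmonic n)%:E)).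
  + apply: nearW => n; apply/andP; split.
      by apply: integral_ge0 => w _; apply: integral_ge0 => s _; rewrite lee_fin sqr_ge0.
    rewrite mul1r; have [mf f0] := hP n.
    by rewrite (integral_time_space P t mf f0).
  + exact: cvg_cst.
  + exact: ch.
- apply: (@squeeze_cvge _ _ _ _ (cst 0%E) _ (fun n => (4 * harmonic n)%:E)).
  + apply: nearW => n; apply/andP; split.
      by apply: integral_ge0 => w _; rewrite lee_fin sqr_ge0.
    by have [] := sp_integral_L2_limit t0 mI HI (hP n).
  + exact: cvg_cst.
  + exact: ch.
Qed.

End approx.
End ito_integral.

(** * A jointly measurable version of the solution *)

Section measurable_version.
Context {R : realType} {d : measure_display} {Omega : measurableType d}.
Variables (P : probability Omega R) (X : R -> Omega -> R) (t T : R).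
Hypothesis tT : 0 <= t <= T.
Hypothesis mX : forall s, 0 <= s <= T -> measurable_fun setT (X s).
Hypothesis cX : {ae P, forall w, {within `[0, T], continuous (fun t => X t w)}}.

Lemma within_continuous_approx (f : R -> R) s (e : R) : {within `[0, T], continuous f} ->
  0 <= s <= T -> 0 < e ->
  exists2 delta, 0 < delta & forall u, 0 <= u <= T -> `|s - u| < delta -> `|f s - f u| < e.
Proof.
move=> /subspace_continuousP cf sT e0.
have /cvgrPdist_lt/(_ _ e0) := cf s ltac:(by rewrite /= in_itv).
move=> [delta /= d0 H]; exists delta => // u uT su.
by apply: H; rewrite //= in_itv.
Qed.

(** A jointly measurable version of [X], as the upper limit of the step processes
    along finer and finer grids. *)
Lemma measurable_version : exists Xt : measurableTypeR R * Omega -> R,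
  measurable_fun setT Xt /\
  forall s, 0 <= s <= t -> {ae P, forall w, Xt (s, w) = X s w}.
Proof.
have [t0 tT'] := andP tT.
have H n := exists_grid [::] t0 (harmonic_gt0 n).
have [v vP] : exists v : nat -> nat -> R, forall n, exists N, grid (v n) N t /\
    forall j, (j < N)%N -> v n j.+1 - v n j <= harmonic n.
  exists (fun n => projT1 (cid (H n))) => n.
  by have [N [? ? _]] := projT2 (cid (H n)); exists N.
pose N n := projT1 (cid (vP n)).
have gv n : grid (v n) (N n) t by have [] := projT2 (cid (vP n)).
have mesh n j : (j < N n)%N -> v n j.+1 - v n j <= harmonic n.
  by have [_] := projT2 (cid (vP n)); apply.
have vT n j : (j <= N n)%N -> 0 <= v n j <= T.
  by move=> jN; rewrite (grid_ge0 (gv n) jN) (le_trans (grid_le (gv n) jN)).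
pose Xn n := step (v n) (N n) (fun k => X (v n k)).
have mXn n : measurable_fun setT (Xn n).
  by apply: measurable_step => j jN; apply: mX; apply: vT; exact: ltnW.
pose L p := fine (limn_esup (fun n => (Xn n p)%:E)).
have mL : measurable_fun setT L.
  apply: measurableT_comp => //; apply: measurable_fun_limn_esup => n.
  exact/measurable_EFinP.
(* Time 0 is treated apart, since the step processes vanish there; at later times path continuity
   makes the upper limit a limit. *)
exists (fun p => if p.1 == 0 then X 0 p.2 else L p); split.
  apply: measurable_fun_ifT => //.
    by apply: measurable_fun_eqr => //; exact: measurable_fst.
  apply: measurableT_comp; last exact: measurable_snd.
  by apply: mX; rewrite lexx (le_trans t0).
move=> s /andP[s0 st]; apply: filterS cX => w cw /=.
have [->//|sn0] := eqVneq s 0.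
have st' : 0 < s <= t by rewrite lt_neqAle eq_sym sn0 s0.
have sT : 0 <= s <= T by rewrite s0 (le_trans st).
have cvgX : (Xn n (s, w))%:E @[n --> \oo] --> (X s w)%:E.
  apply: cvg_EFin; first exact: nearW.
  apply/cvgrPdist_lt => e e0; have [delta d0 Hd] := within_continuous_approx cw sT e0.
  have := @cvg_harmonic R => /cvgrPdist_lt/(_ _ d0); apply: filterS => n.
  rewrite sub0r normrN ger0_norm ?ltW ?harmonic_gt0// => hn.
  have [k kN /andP[ks sk]] := grid_cell (gv n) st'.
  rewrite /= /Xn (step_cell (gv n) _ w kN) ?ks//; apply: Hd.
    by apply: vT; exact: ltnW.
  rewrite ger0_norm ?subr_ge0 ?ltW// (le_lt_trans _ hn)//.
  by apply: le_trans (mesh _ _ kN); rewrite lerD2r.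
rewrite /L is_cvg_limn_esupE; last by apply/cvg_ex; exists (X s w)%:E.
by rewrite (cvg_lim _ cvgX).
Qed.

End measurable_version.

(** * The stochastic Fokker-Planck equation *)

Section evaluation.
Context {R : realType} {d : measure_display} {Omega : measurableType d}.

Lemma schwartz_measurable (phi : R -> R) n : schwartz phi -> measurable_fun setT (derive1n n phi).
Proof. by move=> sphi; apply: continuous_measurable_fun; exact: schwartz_continuous. Qed.

Lemma schwartz_derive1n_linear (a : R) (phi psi : R -> R) n : schwartz phi -> schwartz psi ->
  derive1n n (fun x => a * phi x + psi x) =
  fun x => a * derive1n n phi x + derive1n n psi x.
Proof.
move=> sphi spsi; elim: n => [//|n IH].
rewrite derive1nS IH; apply/funext => x.
have d1 := @schwartz_is_derive R phi n x sphi; have d2 := @schwartz_is_derive R psi n x spsi.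
rewrite derive1E.
exact: (@derive_val _ _ _ _ _ _ _ (is_deriveD (is_deriveZ a d1) d2)).
Qed.

Lemma coefficient_measurable (F : R -> set (set Omega)) (T : R) (f : @coefficient R d Omega) s m w :
  admissible_coefficient F T f -> 0 <= s <= T ->
  measurable_fun setT (fun x => f s x m w : R).
Proof.
move=> [_ _ cf _] sT; apply: continuous_measurable_fun => x V /= Vx.
have /subspace_continuousP/(_ (s, x)) := cf m w.
move=> /(_ ltac:(by split => //=; rewrite in_itv))/(_ V Vx).
move=> [[Q1 Q2] [/= n1 n2] Q].
apply: filterS n2 => y Q2y; apply: (Q (s, y)); first by split => //; exact: nbhs_singleton.
by split => //=; rewrite in_itv.
Qed.

Variables (b sigma : @coefficient R d Omega) (mu : R -> Omega -> probability (measurableTypeR R) R).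
Variables (F : R -> set (set Omega)) (T : R) (x : R) (w : Omega) (t : R).
Hypothesis bT : admissible_coefficient F T b.
Hypothesis sT : admissible_coefficient F T sigma.
Hypothesis tT : 0 <= t <= T.
Hypothesis mux : forall A : set (measurableTypeR R), measurable A -> mu t w A = \d_x A.

Lemma dist_of_dirac (phi : R -> R) : measurable_fun setT phi -> dist_of (mu t w) phi = phi x.
Proof. by move=> mphi; rewrite /dist_of (density_dirac mux)// mul1r. Qed.

Lemma noise_dist_dirac (phi : R -> R) : measurable_fun setT (derive1 phi : R -> R) ->
  noise_dist sigma mu t w phi = sigma t x (mu t w) w * derive1 phi x.
Proof.
move=> mphi; rewrite /noise_dist /D opprK.
by rewrite (density_dirac mux (coefficient_measurable (mu t w) w sT tT) mphi).
Qed.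

Lemma drift_dist_dirac (phi : R -> R) : measurable_fun setT (derive1 phi : R -> R) ->
  measurable_fun setT (derive1 (derive1 phi) : R -> R) ->
  drift_dist b sigma mu t w phi = b t x (mu t w) w * derive1 phi x +
    2^-1 * (sigma t x (mu t w) w ^+ 2 * derive1 (derive1 phi) x).
Proof.
move=> m1 m2; have ms := @coefficient_measurable F T sigma t (mu t w) w sT tT.
transitivity (density (fun x => b t x (mu t w) w) (mu t w) (derive1 phi) +
    2^-1 * density (fun x => sigma t x (mu t w) w ^+ 2) (mu t w) (derive1 (derive1 phi))).
  by congr (_ + _ * _); exact: opprK.
rewrite (density_dirac mux (coefficient_measurable (mu t w) w bT tT) m1).
by rewrite (density_dirac mux (measurable_funX 2 ms) m2).
Qed.

(** At a Dirac mass every pairing is a combination of values of the test function and its first two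
    derivatives at one point, whence the order 2. *)
Lemma tempered_dirac : [/\ tempered (dist_of (mu t w)), tempered (drift_dist b sigma mu t w)
  & tempered (noise_dist sigma mu t w)].
Proof.
have m0 phi : schwartz phi -> measurable_fun setT phi := @schwartz_measurable phi 0.
have m1 phi : schwartz phi -> measurable_fun setT (derive1 phi : R -> R) := @schwartz_measurable phi 1.
have m2 phi : schwartz phi -> measurable_fun setT (derive1 (derive1 phi) : R -> R) := @schwartz_measurable phi 2.
have mZ (f g : R -> R) (a : R) : measurable_fun setT f -> measurable_fun setT g ->
    measurable_fun setT (fun y => a * f y + g y).
  by move=> mf mg; apply: measurable_funD => //; exact: measurable_funM.
have l1 (a : R) (phi psi : R -> R) : schwartz phi -> schwartz psi ->
    derive1 (fun y => a * phi y + psi y) = fun y => a * derive1 phi y + derive1 psi y.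
  exact: (@schwartz_derive1n_linear a phi psi 1).
have l2 (a : R) (phi psi : R -> R) : schwartz phi -> schwartz psi ->
    derive1 (derive1 (fun y => a * phi y + psi y)) =
    fun y => a * derive1 (derive1 phi) y + derive1 (derive1 psi) y.
  exact: (@schwartz_derive1n_linear a phi psi 2).
have bd (phi : R -> R) (A : R) n : (forall m n x, (m <= 2)%N -> (n <= 2)%N ->
    `|x ^+ m * derive1n n phi x| <= A) -> (n <= 2)%N -> `|derive1n n phi x| <= A.
  by move=> H n2; have := H 0%N n x isT n2; rewrite expr0 mul1r.
have M1 (a : R) (phi psi : R -> R) : schwartz phi -> schwartz psi ->
    measurable_fun setT (derive1 (fun y => a * phi y + psi y) : R -> R).
  by move=> sphi spsi; rewrite l1//; exact: mZ (m1 _ sphi) (m1 _ spsi).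
have M2 (a : R) (phi psi : R -> R) : schwartz phi -> schwartz psi ->
    measurable_fun setT (derive1 (derive1 (fun y => a * phi y + psi y)) : R -> R).
  by move=> sphi spsi; rewrite l2//; exact: mZ (m2 _ sphi) (m2 _ spsi).
split; split.
- move=> a phi psi sphi spsi.
  by rewrite (dist_of_dirac (mZ _ _ a (m0 _ sphi) (m0 _ spsi)))
    (dist_of_dirac (m0 _ sphi)) (dist_of_dirac (m0 _ spsi)).
- exists 1, 2%N => phi A sphi HA; rewrite (dist_of_dirac (m0 _ sphi)).
  by rewrite mul1r; exact: (bd _ _ 0%N HA).
- move=> a phi psi sphi spsi.
  rewrite (drift_dist_dirac (M1 a _ _ sphi spsi) (M2 a _ _ sphi spsi))
    (drift_dist_dirac (m1 _ sphi) (m2 _ sphi)) (drift_dist_dirac (m1 _ spsi) (m2 _ spsi)).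
  rewrite (congr1 (fun f => f x) (l2 a phi psi sphi spsi)).
  rewrite (congr1 (fun f => f x) (l1 a phi psi sphi spsi)).
  move: (derive1 phi x) (derive1 psi x) (derive1 (derive1 phi) x) (derive1 (derive1 psi) x).
  by move: (b t x _ w) (sigma t x _ w) => y1 y2 y3 y4 y5 y6; ring.
- exists (`|b t x (mu t w) w| + 2^-1 * `|sigma t x (mu t w) w| ^+ 2), 2%N => phi A sphi HA.
  rewrite (drift_dist_dirac (m1 _ sphi) (m2 _ sphi)).
  apply: le_trans (ler_normD _ _) _; rewrite mulrDl; apply: lerD.
    by rewrite normrM ler_wpM2l//; exact: (bd _ _ 1%N HA).
  move: (bd _ _ 2%N HA isT : `|derive1 (derive1 phi) x| <= A).
  move: (derive1 (derive1 phi) x) (sigma t x _ w) => y s yA.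
  by rewrite 2!normrM normrX (ger0_norm (_ : 0 <= 2^-1))// mulrA ler_wpM2l//.
- move=> a phi psi sphi spsi.
  rewrite (noise_dist_dirac (M1 a _ _ sphi spsi))
    (noise_dist_dirac (m1 _ sphi)) (noise_dist_dirac (m1 _ spsi)).
  rewrite (congr1 (fun f => f x) (l1 a phi psi sphi spsi)).
  move: (derive1 phi x) (derive1 psi x).
  by move: (sigma t x _ w) => y1 y2 y3; ring.
- exists `|sigma t x (mu t w) w|, 2%N => phi A sphi HA.
  rewrite (noise_dist_dirac (m1 _ sphi)).
  by rewrite normrM ler_wpM2l//; exact: (bd _ _ 1%N HA).
Qed.

End evaluation.

(** * Ito's formula for the solution, the equation and the initial condition *)

Section main.
Context {R : realType} {d : measure_display} {Omega : measurableType d}.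
Variables (P : probability Omega R) (B : R -> {RV P >-> R}) (Z : {RV P >-> R}) (T : R)
  (b sigma : @coefficient R d Omega) (X : R -> {RV P >-> R})
  (mu : R -> Omega -> probability (measurableTypeR R) R).
Local Notation F := (filtration_of Z B).
Hypothesis T0 : 0 < T.
Hypothesis BM : brownian_motion B.
Hypothesis ZB : independent P (sigma_rv Z) (sigma_process `[0, +oo[ B).
Hypothesis bT : admissible_coefficient F T b.
Hypothesis sT : admissible_coefficient F T sigma.
Hypothesis sol : mckean_vlasov_solution T Z B b sigma X mu.

Let XF t : 0 <= t <= T -> measurable_wrt (T' := measurableTypeR R) (F t) (X t).
Proof. by case: sol => H _ _ _ _; exact: H. Qed.

Let mu_X t : 0 <= t <= T ->
  {ae P, forall w, forall A : set (measurableTypeR R), measurable A -> mu t w A = \d_(X t w) A}.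
Proof. by case: sol => _ _ Xmu _ _; exact: mu_dirac XF Xmu t. Qed.

Let coefficient_bound : exists2 C : R, 0 <= C &
  (forall t x m w, 0 <= t <= T -> `|b t x m w| <= C) /\
  (forall t x m w, 0 <= t <= T -> `|sigma t x m w| <= C).
Proof.
case: bT => -[C1 H1] _ _ _; case: sT => -[C2 H2] _ _ _.
exists (`|C1| + `|C2|); first exact: addr_ge0.
split=> t x m w tT; [apply: le_trans (H1 _ _ _ _ tT) _|apply: le_trans (H2 _ _ _ _ tT) _].
  by apply: (le_trans (ler_norm _)); rewrite lerDl.
by apply: (le_trans (ler_norm _)); rewrite lerDr.
Qed.

(** [I] is defined as the difference between the increment of [phi (X t)] and the drift, so the
    identity holds by construction. The content is that this [I] is an Ito integral, which follows
    from [ito_estimate] and [is_ito_integral_L1]. *)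
Lemma ito_formula t (phi : R -> R) : 0 <= t <= T -> schwartz phi ->
  exists J I : Omega -> R,
    [/\ is_time_integral P (fun s w => drift_dist b sigma mu s w phi) t J,
        is_ito_integral P F B (fun s w => noise_dist sigma mu s w phi) t I
      & {ae P, forall w, phi (X t w) = phi (X 0 w) + J w + I w}].
Proof.
move=> tT sphi; have [t0 tT'] := andP tT.
have surj (f : measurableTypeR R * Omega -> R) : (fun p => f (p.1, p.2)) = f.
  by apply/funext => -[].
have sT' s : 0 <= s <= t -> 0 <= s <= T.
  by move=> /andP[-> st]; rewrite (le_trans st).
have [C C0 [bC sC]] := coefficient_bound.
have [_ cX _ X0 eqX] := sol.
(* The equation at the final time yields the bounded measurable versions [beta] and [gamma] of the
   coefficients on all of [[0, t]], and the approximating sequence [h]. *)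
have [_ [It [[Kb [modb _ _]] HI _]]] := eqX _ tT.
have bC' s w : 0 <= s <= t -> `|b s (X s w) (mu s w) w| <= C by move=> st; apply: bC; exact: sT'.
have sC' s w : 0 <= s <= t -> `|sigma s (X s w) (mu s w) w| <= C by move=> st; apply: sC; exact: sT'.
have [beta [mbeta betaC betaE]] := measurable_modification_patch C0 bC' modb.
have [_ [Ks [_ [mods _ _]]]] := HI.
have [gamma [mgamma gammaC gammaE]] := measurable_modification_patch C0 sC' mods.
have [h [hgamma _]] := ito_integral_approx mgamma t0 gammaE HI.
have XF' s : 0 <= s <= t -> measurable_wrt (T' := R) (F s) (X s).
  by move=> st; exact: XF (sT' _ st).
(* At an earlier time [s] the equation holds with modifications and integrals of its own. Its time
   integral is that of [beta] almost surely, and its stochastic integral is approximated by the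
   sequence [h] of the final time. *)
have HY s : 0 <= s <= t -> forall e, 0 < e -> exists n0, forall n, (n0 <= n)%N ->
    integral_bound P (fun w => (X s w - X 0 w - time_integral s beta w
      - sp_integral B (h n) s w) ^+ 2) e.
  move=> st e e0; have [s0 st'] := andP st.
  have [J [I [[K [[HK mK] _ JE]] HIs XE]]] := eqX _ (sT' _ st).
  have [n0 n0P] := ito_integral_approx_le BM ZB mgamma st gammaE hgamma HIs e0.
  have KE r : 0 <= r <= s -> {ae P, forall w, K r w = beta (r, w)}.
    move=> rs; apply: filterS2 (HK _ rs) (betaE r _) => [w <- //|].
    by have /andP[-> rs'] := rs; exact: le_trans st'.
  exists n0 => n /n0P; apply: integral_bound_ae.
  - apply: measurable_funX; apply: measurable_funB; last exact: sp_integral_measurable.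
    by apply: measurable_funB; [exact: measurable_funB|exact: measurable_time_integral betaC].
  - by move=> w; exact: sqr_ge0.
  - have JE' := modification_time_integral s0 mK mbeta KE.
    have XE' : {ae P, forall w, X s w - X 0 w = J w + I w}.
      by apply: filterS2 XE X0 => w -> ->; ring.
    by apply: filterS3 XE' JE JE' => w -> -> ->; congr (_ ^+ 2); ring.
have mXs s : 0 <= s <= T -> measurable_fun setT (X s) by [].
have [Xt [mXt XtX]] := measurable_version tT mXs cX.
have [K [phi1K phi2K lip1 lip2 taylor]] := schwartz_ito_bounds sphi.
have m0 := schwartz_measurable 0 sphi; have m1 := schwartz_measurable 1 sphi.
have m2 := schwartz_measurable 2 sphi.
have est := ito_estimate BM ZB t0 mbeta mgamma betaC gammaC XF' hgamma HY mXt XtX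
  m0 m1 m2 phi1K phi2K lip1 lip2 taylor.
pose drift p := beta p * derive1 phi (Xt p) +
  2^-1 * (gamma p ^+ 2 * derive1 (derive1 phi) (Xt p)).
have mdrift : measurable_fun setT drift.
  apply: measurable_funD; first by apply: measurable_funM => //; exact: measurableT_comp m1 mXt.
  apply: measurable_funM => //; apply: measurable_funM; first exact: measurable_funX.
  exact: measurableT_comp m2 mXt.
have [L driftL] : exists L, forall p, `|drift p| <= L.
  exists (C * K + 2^-1 * (C ^+ 2 * K)) => p.
  apply: le_trans (ler_normD _ _) _; apply: lerD; first by rewrite normrM ler_pM.
  rewrite normrM (ger0_norm (_ : 0 <= 2^-1))// ler_wpM2l//.
  by rewrite normrM ler_pM// normrX lerXn2r// ?nnegrE// gammaC.
exists (time_integral t drift), (fun w => phi (X t w) - phi (X 0 w) - time_integral t drift w).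
split.
- exists (fun s w => drift (s, w)); split; last exact: aeW.
    split; last first.
      by apply: measurable_funTS; rewrite (surj drift).
    move=> s st; have mus := mu_X (sT' _ st).
    have be : {ae P, forall w, b s (X s w) (mu s w) w = beta (s, w) /\
        sigma s (X s w) (mu s w) w = gamma (s, w)}.
      by apply: filterS2 (betaE _ st) (gammaE _ st) => w; split.
    apply: filterS3 be mus (XtX _ st) => w [e1 e2] e3 e4.
    by rewrite (drift_dist_dirac bT sT (sT' _ st) e3 m1 m2) /drift e1 e2 e4.
  by apply: aeW => w; exact: (bounded_integrable mdrift driftL 0 t w).
- apply: (is_ito_integral_L1 BM ZB (g := fun p => gamma p * derive1 phi (Xt p))) => //.
  + by apply: measurable_funM => //; exact: measurableT_comp m1 mXt.
  + move=> s st; have mus := mu_X (sT' _ st).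
    apply: filterS3 (gammaE _ st) mus (XtX _ st) => w e2 e3 e4.
    by rewrite (noise_dist_dirac sT (sT' _ st) e3 m1) e2 e4.
  + apply: measurable_funB; last exact: (measurable_time_integral t0 mdrift driftL).
    by apply: measurable_funB; apply: (measurableT_comp m0).
- by apply: aeW => w; ring.
Qed.

Lemma stochastic_fokker_planck_solution : stochastic_fokker_planck P b sigma mu F T B.
Proof.
split=> [t tT|phi sphi t tT].
  by apply: filterS (mu_X tT) => w mux; exact: tempered_dirac bT sT tT mux.
have [J [I [HJ HI E]]] := ito_formula tT sphi; exists J, I; split => //.
have T00 : 0 <= (0 : R) <= T by rewrite lexx ltW.
have mphi := schwartz_measurable 0 sphi.
apply: filterS3 (mu_X tT) (mu_X T00) E => w e1 e2 e3.
by rewrite (dist_of_dirac e1 mphi) (dist_of_dirac e2 mphi).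
Qed.

Lemma initial_condition_solution : initial_condition (X 0) (mu 0).
Proof.
have T00 : 0 <= (0 : R) <= T by rewrite lexx ltW.
have H0 := mu_X T00.
split.
- exact: H0.
- by case: sol => _ _ Xmu _ _ A mA; exact: (cond_distr_mean XF Xmu T00 mA).
- split=> [[c Hc]|H]; first have Hc2 := Hc.
    apply: filterS2 H0 Hc => w e1 e2 A mA; rewrite e1// e2.
    have mXA : measurable (X 0 @^-1` A) by exact: measurable_funPTI.
    transitivity (P (X 0 @^-1` A `&` setT)); last by rewrite setIT.
    rewrite -(integral_indic P measurableT mXA).
    have -> : (\int[P]_w (\1_(X 0 @^-1` A) w)%:E = \int[P]_w (\1_A (c : measurableTypeR R))%:E)%E.
      apply: ae_eq_integral => //; first by apply/measurable_EFinP; exact: measurable_indic.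
      by apply: filterS Hc2 => w' e _; rewrite -[in RHS]e !indicE; congr (_ %:R%:E); apply/idP/idP; rewrite !inE.
    rewrite integral_cst//; have := probability_setT P; rewrite /= => ->; by rewrite mule1.
  have PT0 : (0 < P setT)%E by rewrite probability_setT.
  have PP := ae_properfilter_algebraOfSetsType PT0.
  (* An almost sure event of a probability space is nonempty. At one such [w] the law of [X 0]
     equals the Dirac mass at [X 0 w], so [X 0] takes the value [X 0 w] with probability 1. *)
  have [w [e1 e2]] := filter_ex (filterI H0 H).
  exists (X 0 w); have m1 := @measurable_set1 _ (X 0 w : measurableTypeR R).
  have mX1 : measurable (X 0 @^-1` [set X 0 w]) by exact: measurable_funPTI.
  have := e2 _ m1; rewrite e1// diracE mem_set// => E.
  exists (~` (X 0 @^-1` [set X 0 w])); split.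
  + exact: measurableC.
  + rewrite probability_setC// (_ : P _ = 1%E) ?subee//.
  + by move=> w'.
Qed.

End main.

Theorem theorem3p3 (R : realType) (d : measure_display)
    (Omega : measurableType d) (P : probability Omega R)
    (B : R -> {RV P >-> R}) (Z : {RV P >-> R}) (T : R)
    (b sigma : @coefficient R d Omega) (X : R -> {RV P >-> R})
    (mu : R -> Omega -> probability (measurableTypeR R) R) :
  0 < T ->
  brownian_motion B ->
  independent P (sigma_rv Z) (sigma_process `[0, +oo[ B) ->
  ('E_P[fun w => (`|Z w| ^+ 2)%R] < +oo)%E ->
  admissible_coefficient (filtration_of Z B) T b ->
  admissible_coefficient (filtration_of Z B) T sigma ->
  mckean_vlasov_unique_solution T Z B b sigma X mu ->
  stochastic_fokker_planck P b sigma mu (filtration_of Z B) T B /\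
  initial_condition (X 0) (mu 0).
Proof.
move=> T0 BM ZB _ bT sT [sol _].
split; first exact: stochastic_fokker_planck_solution T0 BM ZB bT sT sol.
exact: initial_condition_solution T0 sol.
Qed.
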